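(* Let $X$ be a smooth, connected, paracompact Hausdorff manifold of dimension $n$, let $G$ be a Lie group, and let $\Psi:G\times X\supseteq\mathcal{V}\to X$ be a regular (local, smooth) Lie group action on $X$ with $s$-dimensional orbits. Then for each $x_0\in X$ there exist a neighborhood $U$ of $x_0$ and a complete set of functionally independent invariants $f_1,\dots,f_{n-s}$ of $\Psi$ on $U$ such that every $\Psi$-invariant $u\in\mathcal{G}(U)$ is of the form $$u(x)=v(f_1(x),\dots,f_{n-s}(x))$$ for some $v\in\mathcal{G}(V)$, where $V$ is an appropriate open subset of $\mathbb{R}^{n-s}$ (containing $(f_1,\dots,f_{n-s})(U)$, so that the composition is defined).
   Context: Let $I=(0,1]$. For a smooth manifold $M$, $\mathcal{E}_M(M)$ denotes the set of nets $(u_\varepsilon)_{\varepsilon\in I}$ in $C^\infty(M)$ that are moderate: for every compact $K\subset M$ and every linear differential operator $P$ on $M$ with smooth coefficients there is $N\in\mathbb{N}$ with $\sup_{x\in K}|Pu_\varepsilon(x)|=O(\varepsilon^{-N})$ as $\varepsilon\to 0$. $\mathcal{N}(M)$ denotes the set of negligible nets: for all such $K,P$ and every $m\in\mathbb{N}$, $\sup_{x\in K}|Pu_\varepsilon(x)|=O(\varepsilon^{m})$. The Colombeau algebra is $\mathcal{G}(M)=\mathcal{E}_M(M)/\mathcal{N}(M)$; write $u=[(u_\varepsilon)_\varepsilon]$. If $F:M'\to M$ is smooth, $u\circ F:=[(u_\varepsilon\circ F)_\varepsilon]\in\mathcal{G}(M')$; the identity $u(x)=v(f_1(x),\dots,f_{n-s}(x))$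 means $u=v\circ(f_1,\dots,f_{n-s})$ in $\mathcal{G}(U)$. $\Psi:\mathcal{V}\to X$ is a smooth local transformation group in the usual sense (as in Olver's books): $\mathcal{V}\subseteq G\times X$ is open with $\{e\}\times X\subseteq\mathcal{V}$, $\Psi(e,x)=x$, and $\Psi(g,\Psi(h,x))=\Psi(gh,x)$ and $\Psi(g^{-1},\Psi(g,x))=x$ wherever defined. It is called regular if all orbits have the same dimension as submanifolds and each point in $X$ has a base of neighborhoods whose elements intersect each orbit in a connected subset thereof. Invariance: $u\in\mathcal{G}(X)$ is invariant under $\Psi$ if $u\circ\Psi=u\circ\pi_2$ in $\mathcal{G}(\mathcal{V})$, where $\pi_2:G\times X\to X$ is the projection onto the second factor. For an open set $U\subseteq X$, invariance is understood with respect to the restricted local action: with $\mathcal{V}_U=\{(g,x)\in\mathcal{V}: x\in U,\ \Psi(g,x)\in U\}$, $u\in\mathcal{G}(U)$ is $\Psi$-invariant if $u\circ\Psi=u\circ\pi_2$ in $\mathcal{G}(\mathcal{V}_U)$, and a function $f\in C^\infty(U)$ is an invariant of $\Psi$ on $U$ if $f\circ\Psi=f\circ\pi_2$ on $\mathcal{V}_U$. Smooth functions $f_1,\dots,f_k$ on a manifold $M$ are functionally dependent if for each $x\in M$ there exist a neighborhood $W$ of $x$ and a smooth function $F$, not identically zero on any open subset of $\mathbb{R}^k$, such that $y\mapsto F(f_1(y),\dots,f_k(y))$ vanishes identically on $W$. They are functionally independent if they are not functionally dependent on any open subset of $M$. A complete set of functionally independent invariants of $\Psi$ on $U$ is a family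 $f_1,\dots,f_{n-s}$ of functionally independent smooth invariants of $\Psi$ on $U$ such that any other smooth local invariant $f$ of $\Psi$ (on $U$) is of the form $f(x)=F(f_1(x),\dots,f_{n-s}(x))$ for some smooth function $F$. *)

(* Defs.v *)
From HB Require Import structures.
From mathcomp Require Import all_boot all_order all_algebra.
From mathcomp Require Import all_classical all_reals all_analysis.

Set Implicit Arguments.
Unset Strict Implicit.
Unset Printing Implicit Defensive.

Import Order.TTheory GRing.Theory Num.Theory.
Import numFieldNormedType.Exports.

Local Open Scope classical_set_scope.
Local Open Scope ring_scope.

Section SmoothEuclidean.
Context {R : realType}.

(* [pderivs [:: i1; ...; ij] f] is the iterated partial derivative
   d_{i1} (... (d_{ij} f)). *)
Fixpoint pderivs n (s : seq 'I_n) (f : 'rV[R]_n -> R) : 'rV[R]_n -> R :=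
  if s is i :: s' then 'D_('e_i) (pderivs s' f) else f.

(* C^oo at each point of A. The derivatives at a point only see f near that
   point; A is open in every use. *)
Definition smooth_on n (A : set 'rV[R]_n) (f : 'rV[R]_n -> R) : Prop :=
  forall s x, A x ->
    {for x, continuous (pderivs s f)} /\
    forall i, derivable (pderivs s f) x 'e_i.

Definition vsmooth_on n m (A : set 'rV[R]_n) (f : 'rV[R]_n -> 'rV[R]_m) :=
  forall j, smooth_on A (fun x => f x ord0 j).

Lemma derive_coord n (j : 'I_n) (x v : 'rV[R]_n) :
  is_derive x v (fun y : 'rV[R]_n => y ord0 j) (v ord0 j).
Proof.
have E : (fun h : R => h^-1 *: (((fun y : 'rV[R]_n => y ord0 j) \o shift x)
     (h *: v) - x ord0 j)) @ 0^' --> (v ord0 j : R).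
  apply: cvg_near_cst; near=> h.
  rewrite /= !mxE addrK /GRing.scale/= mulrA mulVf ?mul1r//.
  by near: h; exact: nbhs_dnbhs_neq.
by apply: DeriveDef; [apply/cvg_ex; eexists; exact: E | exact: cvg_lim E].
Unshelve. all: by end_near. Qed.

Lemma vsmooth_id n (A : set 'rV[R]_n) : vsmooth_on A id.
Proof.
move=> j; set c := fun x : 'rV[R]_n => id x ord0 j.
have S s : pderivs s c = c \/ exists r : R, pderivs s c = cst r.
  elim: s => [|i s [IH|[r IH]]] /=; [by left| |]; right; rewrite IH.
    exists (('e_i : 'rV[R]_n) ord0 j); apply/funext => x.
    by have [] := derive_coord j x 'e_i.
  by exists 0; apply/funext => x; exact: derive_cst.
move=> s x _; case: (S s) => [|[r]] ->; split.
- exact: coord_continuous.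
- by move=> i; have [] := derive_coord j x 'e_i.
- exact: cst_continuous.
- by move=> i; exact: derivable_cst.
Qed.

Lemma smooth_linear n m (L : {linear 'rV[R]_n -> 'rV[R]_m})
    (A : set 'rV[R]_n) (B : set 'rV[R]_m) f :
  continuous L ->
  (forall i, (exists k, L 'e_i = 'e_k) \/ L 'e_i = 0) ->
  smooth_on B f -> (forall y, A y -> B (L y)) -> smooth_on A (f \o L).
Proof.
move=> Lc Le sf AB.
have Q (g : 'rV[R]_m -> R) (y v : 'rV[R]_n) :
    (fun h : R => h^-1 *: (((g \o L) \o shift y) (h *: v) - (g \o L) y)) =
    (fun h : R => h^-1 *: ((g \o shift (L y)) (h *: L v) - g (L y))).
  by apply/funext => h /=; rewrite linearP.
have Q0 (g : 'rV[R]_m -> R) y :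
    (fun h : R => h^-1 *: ((g \o shift y) (h *: 0) - g y)) = cst 0.
  by apply/funext => h /=; rewrite scaler0 add0r subrr scaler0.
have S s : (exists s', pderivs s (f \o L) = pderivs s' f \o L) \/
           pderivs s (f \o L) = cst 0.
  elim: s => [|i s [[s' IH]|IH]] /=; first by left; exists [::].
    rewrite IH; case: (Le i) => [[k Lk]|L0]; [left; exists (k :: s') | right];
      apply/funext => y /=; rewrite /derive Q ?Lk// L0 Q0.
    exact: lim_cst.
  by right; rewrite IH; apply/funext => x; exact: derive_cst.
move=> s x Ax; case: (S s) => [[s' ->]|->]; split.
- apply: continuous_comp; first exact: Lc.
  by have [] := sf s' (L x) (AB _ Ax).
- move=> i; rewrite /derivable Q; have [_ d] := sf s' (L x) (AB _ Ax).
  case: (Le i) => [[k ->]|->]; first exact: d.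
  by rewrite Q0; exact: is_cvg_cst.
- exact: cst_continuous.
- by move=> i; exact: derivable_cst.
Qed.

End SmoothEuclidean.

Section Manifolds.
Context {R : realType}.

(* The maps are total; they are meaningful on the domain and on its image. *)
Record chart (T : topologicalType) n := Chart {
  dom : set T;
  chart_map :> T -> 'rV[R]_n;
  chart_inv : 'rV[R]_n -> T;
  dom_open : open dom;
  cod_open : open (chart_map @` dom);
  chartK : forall x, dom x -> chart_inv (chart_map x) = x;
  chart_continuous : forall x, dom x -> {for x, continuous chart_map};
  chart_inv_continuous :
    forall y, (chart_map @` dom) y -> {for y, continuous chart_inv} }.

(* Smooth manifolds without boundary. Separation and countability conditions
   are not part of the structure. The atlas need not be maximal. *)
Record manifold n := Manifold {
  carrier :> topologicalType;
  atlas : set (chart carrier n);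
  atlas_cover : forall x, exists2 c, atlas c & dom c x;
  atlas_compat : forall c d, atlas c -> atlas d ->
    vsmooth_on (c @` (dom c `&` dom d)) (d \o chart_inv c) }.

Section Euclid.
Variable k : nat.

Let euclid_cod_open : open (@id 'rV[R]_k @` setT).
Proof. by rewrite image_id; exact: openT. Qed.

Definition euclid_chart : chart 'rV[R]_k k :=
  @Chart _ _ setT id id openT euclid_cod_open (fun _ _ => erefl)
    (fun x _ => @cvg_id _ (nbhs x)) (fun x _ => @cvg_id _ (nbhs x)).

Lemma euclid_cover (x : 'rV[R]_k) :
  exists2 c, [set euclid_chart] c & dom c x.
Proof. by exists euclid_chart. Qed.

Lemma euclid_compat c d : [set euclid_chart] c -> [set euclid_chart] d ->
  vsmooth_on (c @` (dom c `&` dom d)) (d \o chart_inv c).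
Proof. by move=> -> ->; exact: vsmooth_id. Qed.

Definition euclid : manifold k := Manifold euclid_cover euclid_compat.

End Euclid.

Section Product.
Variables m n : nat.

Section ProductChart.
Variables (S T : topologicalType) (c : chart S m) (d : chart T n).

Definition prod_dom : set (S * T) := dom c `*` dom d.
Definition prod_map (z : S * T) : 'rV[R]_(m + n) := row_mx (c z.1) (d z.2).
Definition prod_inv (y : 'rV[R]_(m + n)) : S * T :=
  (chart_inv c (lsubmx y), chart_inv d (rsubmx y)).

Lemma prod_codE : prod_map @` prod_dom =
  lsubmx @^-1` (c @` dom c) `&` rsubmx @^-1` (d @` dom d).
Proof.
apply/seteqP; split => [_ [[x y] [/= cx dy] <-]|y [/= [a ca al] [b db br]]].
  by split; rewrite /= ?row_mxKl ?row_mxKr; [exists x | exists y].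
by exists (a, b); [split|rewrite /prod_map /= al br hsubmxK].
Qed.

Lemma prod_dom_open : open prod_dom.
Proof.
rewrite openE => -[x y] [/= cx dy]; exists (dom c, dom d) => //=.
by split; apply: open_nbhs_nbhs; split=> //; exact: dom_open.
Qed.

Lemma prod_cod_open : open (prod_map @` prod_dom).
Proof.
rewrite prod_codE; apply: openI; apply: open_comp; try exact: cod_open.
- by move=> x _; exact: continuous_lsubmx.
- by move=> x _; exact: continuous_rsubmx.
Qed.

Lemma prod_mapK z : prod_dom z -> prod_inv (prod_map z) = z.
Proof.
by case: z => x y [/= cx dy]; rewrite /prod_inv row_mxKl row_mxKr !chartK.
Qed.

Lemma prod_map_continuous z :
  prod_dom z -> {for z, continuous prod_map}.
Proof.
case: z => x y [/= cx dy] A [P zP PA]; rewrite /nbhs /=.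
have /(chart_continuous cx) cP :
    nbhs (c x) [set u | forall i j, P i (lshift n j) (u i j)].
  exists (fun i j => P i (lshift n j)) => // i j.
  by have := zP i (lshift n j); rewrite /prod_map /= row_mxEl.
have /(chart_continuous dy) dP :
    nbhs (d y) [set u | forall i j, P i (rshift m j) (u i j)].
  exists (fun i j => P i (rshift m j)) => // i j.
  by have := zP i (rshift m j); rewrite /prod_map /= row_mxEr.
exists (c @^-1` [set u | forall i j, P i (lshift n j) (u i j)],
        d @^-1` [set u | forall i j, P i (rshift m j) (u i j)]) => //=.
move=> [a b] [/= aP bP]; apply: PA => i j /=; rewrite /prod_map /=.
rewrite -[j]fintype.splitK; case: (fintype.split j) => k /=.
  by rewrite row_mxEl; exact: aP.
by rewrite row_mxEr; exact: bP.
Qed.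

Lemma prod_inv_continuous y :
  (prod_map @` prod_dom) y -> {for y, continuous prod_inv}.
Proof.
rewrite prod_codE => -[cy dy].
have cc : {for y, continuous (chart_inv c \o @lsubmx R 1 m n)}.
  apply: continuous_comp; first exact: continuous_lsubmx.
  exact: chart_inv_continuous.
have cd : {for y, continuous (chart_inv d \o @rsubmx R 1 m n)}.
  apply: continuous_comp; first exact: continuous_rsubmx.
  exact: chart_inv_continuous.
exact: cvg_pair cc cd.
Qed.

Definition prod_chart : chart (S * T)%type (m + n) :=
  Chart prod_dom_open prod_cod_open prod_mapK prod_map_continuous
    prod_inv_continuous.

End ProductChart.

Variables (M : manifold m) (N : manifold n).

Definition prod_atlas : set (chart (M * N)%type (m + n)) :=
  [set e | exists c d, [/\ atlas c, atlas d & e = prod_chart c d]].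

Lemma prod_cover (z : M * N) : exists2 e, prod_atlas e & dom e z.
Proof.
have [c Ac cz] := atlas_cover z.1; have [d Ad dz] := atlas_cover z.2.
by exists (prod_chart c d); [exists c, d | split].
Qed.

Lemma lsubmx_basis i : (exists k, lsubmx ('e_i : 'rV[R]_(m + n)) = 'e_k) \/
  lsubmx ('e_i : 'rV[R]_(m + n)) = 0.
Proof.
rewrite -[i]fintype.splitK; case: (fintype.split i) => k /=; [left; exists k | right];
  apply/rowP => j; rewrite !mxE /=.
  by rewrite (inj_eq (@lshift_inj _ _)).
by rewrite eq_lrshift.
Qed.

Lemma rsubmx_basis i : (exists k, rsubmx ('e_i : 'rV[R]_(m + n)) = 'e_k) \/
  rsubmx ('e_i : 'rV[R]_(m + n)) = 0.
Proof.
rewrite -[i]fintype.splitK; case: (fintype.split i) => k /=; [right | left; exists k];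
  apply/rowP => j; rewrite !mxE /=.
  by rewrite eq_rlshift.
by rewrite (inj_eq (@rshift_inj _ _)).
Qed.

Lemma prod_compat e e' : prod_atlas e -> prod_atlas e' ->
  vsmooth_on (e @` (dom e `&` dom e')) (e' \o chart_inv e).
Proof.
move=> [c [d [Ac Ad ->]]] [c' [d' [Ac' Ad' ->]]] j.
rewrite -[j]fintype.splitK; case: (fintype.split j) => k /=.
  rewrite (_ : (fun x => _) = (fun y => (c' \o chart_inv c) y ord0 k) \o
      @lsubmx _ 1 m n); last first.
    by apply/funext => y; rewrite /= /prod_map row_mxEl.
  apply: smooth_linear (atlas_compat Ac Ac' k) _.
  - exact: continuous_lsubmx.
  - exact: lsubmx_basis.
  - move=> _ [[x y] [[/= cx dy] [/= cx' dy']] <-].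
    by exists x => //; rewrite /prod_map row_mxKl.
rewrite (_ : (fun x => _) = (fun y => (d' \o chart_inv d) y ord0 k) \o
    @rsubmx _ 1 m n); last first.
  by apply/funext => y; rewrite /= /prod_map row_mxEr.
apply: smooth_linear (atlas_compat Ad Ad' k) _.
- exact: continuous_rsubmx.
- exact: rsubmx_basis.
- move=> _ [[x y] [[/= cx dy] [/= cx' dy']] <-].
  by exists y => //; rewrite /prod_map row_mxKr.
Qed.

Definition mprod : manifold (m + n) := Manifold prod_cover prod_compat.

End Product.

Definition paracompact (T : topologicalType) : Prop :=
  forall C : set (set T), (forall A, C A -> open A) -> \bigcup_(A in C) A = setT ->
  exists D : set (set T),
    [/\ forall B, D B -> open B,
        \bigcup_(B in D) B = setT,
        forall B, D B -> exists2 A, C A & B `<=` A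
      & forall x : T, exists2 W, nbhs x W &
          finite_set [set B | D B /\ B `&` W !=set0]].

(* C^oo(U) for an open set U of M; values outside U are irrelevant. *)
Definition msmooth n (M : manifold n) (U : set M) (f : M -> R) : Prop :=
  forall c, atlas c -> smooth_on (c @` (dom c `&` U)) (f \o chart_inv c).

Definition smooth_map m n (M : manifold m) (N : manifold n) (U : set M)
    (F : M -> N) : Prop :=
  (forall x, U x -> {for x, continuous F}) /\
  forall c d, atlas c -> atlas d ->
    vsmooth_on (c @` (dom c `&` U `&` F @^-1` dom d)) (d \o F \o chart_inv c).

Definition immersion m n (M : manifold m) (N : manifold n) (F : M -> N) : Prop :=
  smooth_map setT F /\
  forall x c d, atlas c -> atlas d -> dom c x -> dom d (F x) ->
    row_free ('J (d \o F \o chart_inv c) (c x)).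

(* Immersed submanifolds, as in Olver: the intrinsic topology may be finer than
   the subspace topology. Second countability makes the dimension depend on the
   set S only. *)
Definition submanifold n (M : manifold n) (s : nat) (S : set M) : Prop :=
  exists (N : manifold s) (i : N -> M),
    [/\ hausdorff_space N, @second_countable N, injective i, immersion i
      & range i = S].

End Manifolds.
Arguments manifold : clear implicits.
Arguments euclid : clear implicits.
Arguments mprod {R m n} M N.

Section LocalActions.
Context {R : realType}.

Record lie_group d := LieGroup {
  lie_manifold :> manifold R d;
  lmul : lie_manifold -> lie_manifold -> lie_manifold;
  linv : lie_manifold -> lie_manifold;
  lone : lie_manifold;
  lmulA : associative lmul;
  lmul1 : left_id lone lmul;
  lmulV : left_inverse lone linv lmul;
  lmul_smooth : @smooth_map R _ _ (mprod lie_manifold lie_manifold)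
    lie_manifold setT (fun z => lmul z.1 z.2);
  linv_smooth : @smooth_map R _ _ lie_manifold lie_manifold setT linv;
  lie_hausdorff : hausdorff_space lie_manifold;
  lie_second_countable : @second_countable lie_manifold }.

Section Action.
Context {d n : nat} {G : lie_group d} {X : manifold R n}.
Implicit Types (V : set (mprod G X)) (Psi : mprod G X -> X).

(* Local groups of transformations in the sense of Olver; in particular V is
   stable under (g, x) |-> (g^-1, g.x). *)
Record local_action V Psi : Prop := LocalAction {
  la_open : open V;
  la_smooth : smooth_map V Psi;
  la_mem1 : forall x, V (lone G, x);
  la_mul : forall g h x, V (h, x) -> V (g, Psi (h, x)) -> V (lmul g h, x) ->
    Psi (g, Psi (h, x)) = Psi (lmul g h, x);
  la_one : forall x, Psi (lone G, x) = x;
  la_inv : forall g x, V (g, x) ->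
    V (linv g, Psi (g, x)) /\ Psi (linv g, Psi (g, x)) = x }.

Definition stable V Psi (S : set X) : Prop :=
  forall z, V z -> S z.2 -> S (Psi z).

(* Orbits are the minimal nonempty stable sets; for a local action these need
   not be the sets {g.x | (g, x) in V}. *)
Definition is_orbit V Psi (O : set X) : Prop :=
  [/\ O !=set0, stable V Psi O
    & forall S, S `<=` O -> stable V Psi S -> S = set0 \/ S = O].

Definition orbits_of_dim V Psi (s : nat) : Prop :=
  forall O, is_orbit V Psi O -> submanifold s O.

Definition regular_action V Psi : Prop :=
  (exists s, orbits_of_dim V Psi s) /\
  forall (x : X) W, nbhs x W -> exists N, [/\ nbhs x N, N `<=` W
    & forall O, is_orbit V Psi O -> connected (O `&` N)].

Definition restr_dom V Psi (U : set X) : set (mprod G X) :=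
  [set z | [/\ V z, U z.2 & U (Psi z)]].

Definition invariant V Psi (U : set X) (f : X -> R) : Prop :=
  msmooth U f /\ forall z, restr_dom V Psi U z -> f (Psi z) = f z.2.

End Action.

Definition tuple_map n k (M : manifold R n) (f : 'I_k -> M -> R) (x : M) :
  euclid R k := \row_i f i x.

Definition functionally_dependent n k (M : manifold R n) (A : set M)
    (f : 'I_k -> M -> R) : Prop :=
  forall x, A x -> exists W (F : 'rV[R]_k -> R),
    [/\ [/\ open W, W x & W `<=` A], smooth_on setT F,
        forall B, open B -> B !=set0 -> exists2 y, B y & F y != 0
      & forall y, W y -> F (tuple_map f y) = 0].

Definition functionally_independent n k (M : manifold R n) (U : set M)
    (f : 'I_k -> M -> R) : Prop :=
  forall A, open A -> A !=set0 -> A `<=` U -> ~ functionally_dependent A f.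

Definition complete_invariants d n k (G : lie_group d) (X : manifold R n)
    (V : set (mprod G X)) (Psi : mprod G X -> X) (U : set X)
    (f : 'I_k -> X -> R) : Prop :=
  [/\ forall i, invariant V Psi U (f i),
      functionally_independent U f
    & forall g, invariant V Psi U g -> exists W (F : 'rV[R]_k -> R),
        [/\ open W, tuple_map f @` U `<=` W, smooth_on W F
          & forall x, U x -> g x = F (tuple_map f x)]].

End LocalActions.
Arguments lie_group : clear implicits.

Section Colombeau.
Context {R : realType}.

(* Linear differential operators on an open set U of M, with smooth
   coefficients and of order at most k: in each chart, a combination of the
   iterated partial derivatives d_{t1} ... d_{tj}, j <= k. *)
Definition diffop n (M : manifold R n) (U : set M)
    (P : (M -> R) -> (M -> R)) : Prop :=
  exists k, forall c, atlas c -> exists a : seq 'I_n -> M -> R,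
    (forall t, msmooth (dom c `&` U) (a t)) /\
    forall f, msmooth U f -> forall x, dom c x -> U x ->
      P f x = \sum_(j < k.+1) \sum_(t : j.-tuple 'I_n)
                a t x * pderivs t (f \o chart_inv c) (c x).

Section Algebra.
Variables (n : nat) (M : manifold R n).

(* Nets on U, indexed by (0, 1]; values at other indices or outside U are
   irrelevant. *)
Definition net := R -> M -> R.

Definition smooth_net (U : set M) (u : net) : Prop :=
  forall e, 0 < e <= 1 -> msmooth U (u e).

Definition sup_on (K : set M) (f : M -> R) : R := sup [set `|f x| | x in K].

Definition moderate (U : set M) : set net :=
  [set u | smooth_net U u /\
    forall K P, compact K -> K `<=` U -> diffop U P ->
    exists N : nat, (fun e => sup_on K (P (u e))) =O_ (0^'+) (fun e => e ^- N)].

Definition negligible_net (U : set M) : set net :=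
  [set u | smooth_net U u /\
    forall K P, compact K -> K `<=` U -> diffop U P ->
    forall m : nat, (fun e => sup_on K (P (u e))) =O_ (0^'+) (fun e => e ^+ m)].

(* the class [(u_e)_e] modulo negligible nets *)
Definition net_class (U : set M) (u : net) : set net :=
  [set w | moderate U w /\ negligible_net U (fun e x => w e x - u e x)].

(* G(U), as the set of classes of moderate nets *)
Definition colombeau (U : set M) : set (set net) :=
  [set net_class U u | u in moderate U].

End Algebra.

(* u o F in G(U'), the class of (u_e o F)_e; all representatives of u give
   the same class. *)
Definition colombeau_comp m n (M' : manifold R m) (M : manifold R n)
    (U' : set M') (u : set (net M)) (F : M' -> M) : set (net M') :=
  \bigcup_(r in u) net_class U' (fun e => r e \o F).

Definition colombeau_invariant d n (G : lie_group R d) (X : manifold R n)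
    (V : set (mprod G X)) (Psi : mprod G X -> X) (U : set X)
    (u : set (net X)) : Prop :=
  colombeau_comp (restr_dom V Psi U) u Psi =
  @colombeau_comp _ _ (mprod G X) X (restr_dom V Psi U) u snd.

End Colombeau.

(* Main.v *)
From HB Require Import structures.
Require Import Defs.
From mathcomp Require Import all_boot all_order all_algebra.
From mathcomp Require Import all_classical all_reals all_analysis.
From mathcomp Require Import perm ring lra.

(** The proof replaces the flows of vector fields by orbit maps and the inverse
    function theorem, so that no differential equation is solved.

    The rank at the identity of the orbit map [g |-> Psi (g, x)] is constant
    along orbits [orbit_rank]. Around [x], let elements close to the identity,
    chosen in as many directions as this rank, act on a slice complementary to
    the orbit: the inverse function theorem makes this a coordinate system, with
    a coordinate along the orbit and a transverse one [flowbox_exists]. As long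
    as the rank is the dimension of the box along the orbit, small steps do not
    change the transverse coordinate [plaque]: the orbit is locally a union of
    plaques, countably many because the group is second countable
    [orbit_plaques].

    The rank is the dimension [s] of the orbits [orbit_rank_dim]. The orbit has a
    countable cover by charts of dimension [s] and one by plaques of dimension
    [r], and each of them would map onto an open set of larger dimension if [r]
    and [s] were different. Smooth maps cannot do this: by Baire's theorem a
    single map on a ball would have an image with interior, and counting cells
    against grid points rules that out [smooth_images_no_interior].

    The transverse coordinate [t] takes countably many values on an orbit. A
    regular action has a neighbourhood of [x0] that meets the orbit in a
    connected set, on which [t] is continuous and hence constant. In it [t] is
    invariant, and each [x] is moved by an element [kappa x], depending smoothly
    on [x], to the point [sigma (t x)] of the slice [adapted_box].

    An invariant smooth function [g] is therefore [(g \o sigma) \o t]. For a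
    net [r] that is invariant up to a negligible net, composing the difference
    with [x |-> (kappa x, x)] shows that [r \o sigma \o t] and [r] differ by a
    negligible net. This uses that composition with a smooth map preserves
    moderate and negligible nets [moderate_comp, negligible_comp]: derivatives
    of [f \o F] on a compact set are controlled by finitely many differential
    operators applied to [f] [dominated_compact]. Finally the components of [t]
    are independent because [t] is an open map. *)

Set Implicit Arguments.
Unset Strict Implicit.
Unset Printing Implicit Defensive.

Import Order.TTheory GRing.Theory Num.Theory.
Import numFieldNormedType.Exports.

Local Open Scope classical_set_scope.
Local Open Scope ring_scope.

(** * Calculus on open subsets of Euclidean spaces *)

Section MeanValue.
Context {R : realType}.

Lemma derivable_line n (f : 'rV[R]_n -> R) p v (t : R) :
  derivable f (p + t *: v) v ->
  is_derive t 1 (fun t => f (p + t *: v)) ('D_v f (p + t *: v)).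
Proof.
move=> df.
have E : (fun h : R => h^-1 *: (((fun t => f (p + t *: v)) \o shift t) (h *: 1)
    - f (p + t *: v))) =
  (fun h : R => h^-1 *: ((f \o shift (p + t *: v)) (h *: v) - f (p + t *: v))).
  apply/funext => h /=.
  by rewrite scaler1 scalerDl addrCA.
by split; rewrite /derivable /derive E.
Qed.

Definition btw (a b c : R) := (a <= c <= b) || (b <= c <= a).

Lemma mvt_unordered (h : R -> R) a b :
  (forall t, btw a b t -> derivable h t 1) ->
  exists2 c, btw a b c & h a - h b = (a - b) * 'D_1 h c.
Proof.
wlog ab : a b / a <= b => [W dh|dh].
  have [/W|/ltW/W W'] := leP a b; first exact.
  have [|c cb e] := W'; first by move=> t; rewrite /btw orbC; exact: dh.
  by exists c; [rewrite /btw orbC | rewrite -opprB e -mulNr opprB].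
have dh' t : a <= t <= b -> derivable h t 1.
  by move=> tab; apply: dh; rewrite /btw tab.
have [t tab||c cab e] := @MVT_segment R h ('D_1 h) a b ab.
- apply/derivableP/dh'; move: tab; rewrite in_itv /= => /andP[? ?].
  by rewrite !ltW.
- by apply: derivable_within_continuous => t; rewrite in_itv /=; exact: dh'.
exists c; first by move: cab; rewrite in_itv /= /btw => ->.
by rewrite -opprB e mulrC -mulNr opprB.
Qed.

(** The box with opposite corners [x] and [y]; as the norm is the sup norm, a
    ball contains the boxes spanned by its points. *)
Definition vbtw n (x y p : 'rV[R]_n) :=
  forall j, btw (x ord0 j) (y ord0 j) (p ord0 j).

Lemma btw_ball (a b c z e : R) :
  btw a b c -> `|a - z| <= e -> `|b - z| <= e -> `|c - z| <= e.
Proof. by rewrite /btw !ler_distl => /orP[] ? ? ?; lra. Qed.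

Lemma mx_norm_leP n (x : 'rV[R]_n) e :
  0 <= e -> (`|x| <= e) <-> forall j, `|x ord0 j| <= e.
Proof.
move=> e0; rewrite [`|x|]/Num.norm /= mx_normrE; split => [/bigmax_leP[_ H] j|H].
  exact: (H (ord0, j)).
by apply/bigmax_leP; split=> // -[i j] _; rewrite /= ord1.
Qed.

Lemma coord_le_norm n (x : 'rV[R]_n) j : `|x ord0 j| <= `|x|.
Proof. exact: (mx_norm_leP x (normr_ge0 x)).1. Qed.

Lemma vbtw_ball n (x y p z : 'rV[R]_n) e :
  vbtw x y p -> `|x - z| <= e -> `|y - z| <= e -> `|p - z| <= e.
Proof.
move=> b xz yz; have e0 : 0 <= e by exact: le_trans xz.
apply/mx_norm_leP => // j; rewrite !mxE; apply: btw_ball (b j) _ _.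
  by move: xz => /(mx_norm_leP _ e0)/(_ j); rewrite !mxE.
by move: yz => /(mx_norm_leP _ e0)/(_ j); rewrite !mxE.
Qed.

Lemma cvg_epsdelta (U W : normedModType R) (g : U -> W) y l :
  (forall e, 0 < e -> exists2 r, 0 < r &
    forall x, `|x - y| < r -> `|g x - l| <= e) -> g x @[x --> y] --> l.
Proof.
move=> H; apply/(@cvgrPdist_le _ _ _ _ (nbhs_filter y)) => e /H [r r0 xr].
apply/nbhs_ballP; exists r => // x; rewrite -ball_normE /ball_ /= distrC => xy.
by rewrite distrC; exact: xr.
Qed.

Lemma cvg_epsdeltaP (U W : normedModType R) (g : U -> W) y l :
  g x @[x --> y] --> l -> forall e, 0 < e -> exists2 r, 0 < r &
    forall x, `|x - y| < r -> `|g x - l| <= e.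
Proof.
move=> /(@cvgrPdist_le _ _ _ _ (nbhs_filter y)) H e /H /nbhs_ballP [r r0 xr].
exists r => // x xy; rewrite distrC; apply: xr.
by rewrite -ball_normE /ball_ /= distrC.
Qed.

(** Moving from [y] to [x] one coordinate at a time reduces the mean value
    theorem in several variables to the one in one variable. Only partial
    derivatives are involved, as in the definition of smooth functions. *)
Lemma mvt_box n (f : 'rV[R]_n -> R) x y :
  (forall p i, vbtw x y p -> derivable f p 'e_i) ->
  exists xi : 'I_n -> 'rV[R]_n, (forall i, vbtw x y (xi i)) /\
    f x - f y = \sum_i (x ord0 i - y ord0 i) * 'D_('e_i) f (xi i).
Proof.
move=> df.
pose z k : 'rV[R]_n := \row_i (if (i < k)%N then x ord0 i else y ord0 i).
have zE (k : 'I_n) (t : R) i : (z k + (t - y ord0 k) *: 'e_k) ord0 i =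
    if (i < k)%N then x ord0 i else if i == k then t else y ord0 i.
  rewrite !mxE eqxx /=; case: (eqVneq i k) => [->|ik].
    by rewrite ltnn mulr1 addrC subrK.
  by rewrite mulr0 addr0.
have zb (k : 'I_n) t : btw (x ord0 k) (y ord0 k) t ->
    vbtw x y (z k + (t - y ord0 k) *: 'e_k).
  move=> bt i; rewrite zE; case: ifP => _; first by rewrite /btw !lexx /= andbT le_total.
  by case: eqVneq => [->//|_]; rewrite /btw !lexx andbT le_total.
have step (k : 'I_n) : exists2 p, vbtw x y p &
    f (z k.+1) - f (z k) = (x ord0 k - y ord0 k) * 'D_('e_k) f p.
  pose h t := f (z k + (t - y ord0 k) *: 'e_k).
  have dh t : btw (x ord0 k) (y ord0 k) t ->
      is_derive t 1 h ('D_('e_k) f (z k + (t - y ord0 k) *: 'e_k)).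
    move=> bt; have := @derivable_line _ f (z k - y ord0 k *: 'e_k) 'e_k t.
    have E u : z k - y ord0 k *: 'e_k + u *: 'e_k
        = z k + (u - y ord0 k) *: 'e_k.
      by rewrite scalerBl -addrA [- _ + _]addrC.
    by under eq_fun do rewrite E; rewrite !E; apply; apply: df; exact: zb.
  have [|c cb e] := @mvt_unordered h (x ord0 k) (y ord0 k).
    by move=> t /dh [].
  exists (z k + (c - y ord0 k) *: 'e_k); first exact: zb.
  rewrite -(@derive_val _ _ _ _ _ _ _ (dh c cb)) -e /h.
  congr (f _ - f _); apply/rowP => i; rewrite zE !mxE.
    rewrite ltnS -val_eqE /=; case: (ltngtP i k) => [||/val_inj ->] //=.
  by case: ifP => //; case: eqVneq => // ->.
have [xi Hxi] := choice (fun k => let: ex_intro2 p a b := step k in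
   ex_intro (fun p => vbtw x y p /\ f (z k.+1) - f (z k) =
     (x ord0 k - y ord0 k) * 'D_('e_k) f p) p (conj a b)).
exists xi; split=> [i|]; first by have [] := Hxi i.
rewrite (eq_bigr (fun k : 'I_n => f (z k.+1) - f (z k))); last first.
  by move=> i _; have [] := Hxi i.
rewrite -(big_mkord xpredT (fun k => f (z k.+1) - f (z k))).
rewrite telescope_sumr//; congr (f _ - f _); apply/rowP => i; rewrite mxE.
  by rewrite ltn_ord.
by rewrite ltn0.
Qed.

(** The slopes [D_i f (xi i)] of the mean value theorem, as functions of the
    moving end point, give a factorization in the manner of Hadamard. Slopes
    that converge at [y] suffice for the chain rule. *)
Lemma hadamard n (f : 'rV[R]_n -> R) (A : set 'rV[R]_n) y :
  open A -> A y -> (forall p i, A p -> derivable f p 'e_i) ->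
  (forall i, {for y, continuous ('D_('e_i) f)}) ->
  exists q : 'I_n -> 'rV[R]_n -> R,
    (forall i, q i x @[x --> y] --> 'D_('e_i) f y) /\
    \forall x \near y, f x - f y = \sum_i (x ord0 i - y ord0 i) * q i x.
Proof.
move=> oA Ay df cf.
have /nbhs_ballP [r /= r0 rA] : nbhs y A by exact: open_nbhs_nbhs.
have H x : exists xi : 'I_n -> 'rV[R]_n, ball y r x ->
    (forall i, vbtw x y (xi i)) /\
    f x - f y = \sum_i (x ord0 i - y ord0 i) * 'D_('e_i) f (xi i).
  have [Bx|] := pselect (ball y r x); last by exists (fun=> 0).
  have [|xi xiP] := @mvt_box n f x y; last by exists xi.
  move=> p i b; apply: df; apply: rA.
  move: Bx; rewrite -ball_normE /ball_ /= => Bx.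
  rewrite distrC; apply: le_lt_trans (Bx); rewrite [leRHS]distrC.
  by apply: (vbtw_ball b); rewrite // subrr normr0.
have [xi xiP] := choice H.
exists (fun i x => 'D_('e_i) f (xi x i)); split=> [i|]; last first.
  apply/nbhs_ballP; exists r => //= x Bx.
  by have [] := xiP x Bx.
suff C : xi x i @[x --> y] --> y by exact: (cvg_comp _ _ C (cf i)).
apply: cvg_epsdelta => e e0.
exists (Num.min r e); first by rewrite lt_min r0.
move=> x; rewrite lt_min => /andP[xr xe].
have [|b _] := xiP x; first by rewrite -ball_normE /ball_ /= distrC.
by apply: (vbtw_ball (b i)); [exact: ltW | rewrite subrr normr0 ltW].
Qed.

End MeanValue.

Section ChainRule.
Context {R : realType}.

Lemma continuous_rV (T : topologicalType) n (g : T -> 'rV[R]_n) (x : T) :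
  (forall j, {for x, continuous (fun z => g z ord0 j)}) ->
  {for x, continuous g}.
Proof.
move=> cg A [P gP PA].
have H : forall j, nbhs x [set z | P ord0 j (g z ord0 j)].
  by move=> j; apply: (cg j); exact: gP.
by apply: filterS (filter_forall _ H) => z Hz; apply: PA => i j; rewrite ord1; exact: Hz.
Qed.

Lemma continuous_coord (T : topologicalType) n (g : T -> 'rV[R]_n) (x : T) j :
  {for x, continuous g} -> {for x, continuous (fun z => g z ord0 j)}.
Proof.
move=> cg; exact: (continuous_comp cg (@coord_continuous _ _ _ ord0 j (g x))).
Qed.

Lemma derivable_coord_line n (g : 'rV[R]_n -> R) x v :
  derivable g x v -> g (h *: v + x) @[h --> 0^'] --> g x.
Proof.
move=> /derivable1P/derivable1_diffP/differentiable_continuous c.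
have {}c : g (h *: v + x) @[h --> (0 : R)] --> g ((0 : R) *: v + x) by exact: c.
rewrite scale0r add0r in c.
by move=> A /c; exact: nbhs_dnbhs.
Qed.

(** The chain rule for functions with continuous partial derivatives: in the
    factorization of [hadamard] along [phi], each difference quotient is a sum
    of products whose two factors converge. *)
Lemma is_derive_comp n m (f : 'rV[R]_m -> R) (phi : 'rV[R]_n -> 'rV[R]_m)
    (B : set 'rV[R]_m) x v :
  open B -> B (phi x) -> (forall p i, B p -> derivable f p 'e_i) ->
  (forall i, {for phi x, continuous ('D_('e_i) f)}) ->
  (forall k, derivable (fun z => phi z ord0 k) x v) ->
  is_derive x v (f \o phi)
    (\sum_k 'D_v (fun z => phi z ord0 k) x * 'D_('e_k) f (phi x)).
Proof.
move=> oB Bx df cf dphi; have [q [qc qE]] := hadamard oB Bx df cf.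
have cc : phi (h *: v + x) @[h --> 0^'] --> phi x.
  move=> A [P gP PA].
  have H j : \forall h \near 0^', P ord0 j (phi (h *: v + x) ord0 j).
    by apply: (derivable_coord_line (dphi j)); exact: gP.
  apply: filterS (filter_forall _ H) => z Hz; apply: PA => i j.
  by rewrite ord1; exact: Hz.
have L : h^-1 *: (((f \o phi) \o shift x) (h *: v) - (f \o phi) x) @[h --> 0^']
    --> (\sum_k 'D_v (fun z => phi z ord0 k) x * 'D_('e_k) f (phi x)).
  have qE' : \forall h \near 0^', f (phi (h *: v + x)) - f (phi x) =
      \sum_k (phi (h *: v + x) ord0 k - phi x ord0 k) * q k (phi (h *: v + x)).
    exact: cc _ qE.
  have E : \forall h \near 0^', \sum_k h^-1 *: (((fun z => phi z ord0 k)
        \o shift x) (h *: v) - phi x ord0 k) * q k (phi (h *: v + x)) =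
      h^-1 *: (((f \o phi) \o shift x) (h *: v) - (f \o phi) x).
    apply: filterS qE' => h /= ->; rewrite scaler_sumr.
    by apply: eq_bigr => k _; rewrite scalerAl.
  apply: cvg_trans (near_eq_cvg E) _.
  apply: cvg_big => [|k _]; first exact: add_continuous.
  apply: cvgM; first exact: dphi.
  exact: cvg_comp cc (qc k).
by split; [apply/cvg_ex; eexists; exact: L | exact: cvg_lim L].
Qed.

End ChainRule.

Section Ck.
Context {R : realType}.

(** The classes C^k, defined by recursion on the order: this is the form in
    which closure under products and composition is an easy induction. *)
Fixpoint Ck n (k : nat) (A : set 'rV[R]_n) (f : 'rV[R]_n -> R) : Prop :=
  (forall x, A x -> {for x, continuous f}) /\
  if k is k'.+1 then (forall i x, A x -> derivable f x 'e_i) /\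
                     forall i, Ck k' A ('D_('e_i) f)
  else True.

Lemma Ck_continuous n k (A : set 'rV[R]_n) f x :
  Ck k A f -> A x -> {for x, continuous f}.
Proof. by case: k => [|k] [cf _]; exact: cf. Qed.

Lemma CkS n k (A : set 'rV[R]_n) f : Ck k.+1 A f -> Ck k A f.
Proof.
elim: k f => [|k IH] f [cf [df Df]]; first by split.
by split=> //; split=> // i; apply: IH.
Qed.

Lemma near_eq_in n (A : set 'rV[R]_n) (f g : 'rV[R]_n -> R) x :
  open A -> A x -> {in A, f =1 g} -> {near x, f =1 g}.
Proof.
move=> oA Ax fg; have : nbhs x A by exact: open_nbhs_nbhs.
by apply: filterS => y Ay; apply: fg; rewrite inE.
Qed.

Lemma near_eq_continuous (T U : topologicalType) (f g : T -> U) x :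
  {near x, f =1 g} -> {for x, continuous f} -> {for x, continuous g}.
Proof.
move=> fg cf; have e : f x = g x := nbhs_singleton fg.
have c : f y @[y --> x] --> f x by exact: cf.
have : g y @[y --> x] --> g x by rewrite -e; apply: cvg_trans (near_eq_cvg fg) c.
exact.
Qed.

Lemma Ck_eq n k (A : set 'rV[R]_n) f g :
  open A -> {in A, f =1 g} -> Ck k A f -> Ck k A g.
Proof.
move=> oA; elim: k f g => [|k IH] f g fg [cf df].
  split=> // x Ax.
  exact: near_eq_continuous (near_eq_in oA Ax fg) (cf x Ax).
split.
  by move=> x Ax; exact: near_eq_continuous (near_eq_in oA Ax fg) (cf x Ax).
split=> [i x Ax|i].
  by apply: near_eq_derivable (near_eq_in oA Ax fg) _; exact: df.1.
apply: IH (df.2 i) => x; rewrite inE => Ax.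
exact: near_eq_derive (near_eq_in oA Ax fg).
Qed.

Lemma Ck_cst n k (A : set 'rV[R]_n) (c : R) : Ck k A (cst c).
Proof.
elim: k c => [|k IH] c; split => //; try by move=> x _; exact: cst_continuous.
split=> [i x _|i]; first exact: derivable_cst.
have -> : 'D_'e_i (cst c : 'rV[R]_n -> R) = cst 0.
  by apply/funext => x; exact: derive_cst.
exact: IH.
Qed.

Lemma CkD n k (A : set 'rV[R]_n) f g : open A ->
  Ck k A f -> Ck k A g -> Ck k A (fun x => f x + g x).
Proof.
move=> oA; elim: k f g => [|k IH] f g [cf df] [cg dg].
  by split=> // x Ax; apply: continuousD; [exact: cf | exact: cg].
split; first by move=> x Ax; apply: continuousD; [exact: cf | exact: cg].
split=> [i x Ax|i]; first by apply: derivableD; [exact: df.1 | exact: dg.1].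
apply: (Ck_eq oA _ (IH _ _ (df.2 i) (dg.2 i))) => x; rewrite inE => Ax.
by rewrite deriveD //; [exact: df.1 | exact: dg.1].
Qed.

Lemma CkM n k (A : set 'rV[R]_n) f g : open A ->
  Ck k A f -> Ck k A g -> Ck k A (fun x => f x * g x).
Proof.
move=> oA; elim: k f g => [|k IH] f g Cf Cg.
  by split=> // x Ax; apply: continuousM; apply: Ck_continuous Ax; eassumption.
have [Cf' Cg'] := (CkS Cf, CkS Cg); case: Cf => cf df; case: Cg => cg dg.
split; first by move=> x Ax; apply: continuousM; [exact: cf | exact: cg].
split=> [i x Ax|i]; first by apply: derivableM; [exact: df.1 | exact: dg.1].
apply: (Ck_eq oA _ (CkD oA (IH _ _ Cf' (dg.2 i)) (IH _ _ Cg' (df.2 i)))) => x.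
rewrite inE => Ax.
by rewrite deriveM //; [exact: df.1 | exact: dg.1].
Qed.

Lemma Ck_sum n k (A : set 'rV[R]_n) I (r : seq I) (P : pred I)
    (F : I -> 'rV[R]_n -> R) : open A ->
  (forall i, Ck k A (F i)) -> Ck k A (fun x => \sum_(i <- r | P i) F i x).
Proof.
move=> oA CF; elim: r => [|i r IH].
  by apply: (Ck_eq oA _ (Ck_cst k A 0)) => x _; rewrite big_nil.
case Pi : (P i).
  by apply: (Ck_eq oA _ (CkD oA (CF i) IH)) => x _; rewrite big_cons Pi.
by apply: (Ck_eq oA _ IH) => x _; rewrite big_cons Pi.
Qed.

(** By the chain rule the derivatives of [f \o phi] are sums of products of
    derivatives of [phi] and of composites with derivatives of [f], which are
    one class lower. *)
Lemma Ck_comp n m k (A : set 'rV[R]_n) (B : set 'rV[R]_m) f phi :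
  open A -> open B -> (forall x, A x -> B (phi x)) ->
  (forall j, Ck k A (fun x => phi x ord0 j)) -> Ck k B f -> Ck k A (f \o phi).
Proof.
move=> oA oB AB; elim: k f => [|k IH] f Cphi Cf.
  split=> // x Ax; apply: continuous_comp; last exact: Ck_continuous Cf (AB _ Ax).
  by apply: continuous_rV => j; exact: Ck_continuous (Cphi j) Ax.
have Cphi' j := CkS (Cphi j); have Cf' := CkS Cf; case: Cf => cf [df Df].
have d x i : A x -> is_derive x 'e_i (f \o phi)
    (\sum_k 'D_'e_i (fun z => phi z ord0 k) x * 'D_('e_k) f (phi x)).
  move=> Ax; apply: (is_derive_comp oB (AB _ Ax)).
  - by move=> p j; exact: df.
  - by move=> j; exact: Ck_continuous (Df j) (AB _ Ax).
  - by move=> j; have [_ [+ _]] := Cphi j; exact.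
split.
  move=> x Ax; apply: continuous_comp; last exact: cf (AB _ Ax).
  by apply: continuous_rV => j; exact: Ck_continuous (Cphi j) Ax.
split=> [i x /d H|i]; first by have [] := H i.
apply: (@Ck_eq _ _ _ (fun x =>
  \sum_k 'D_'e_i (fun z => phi z ord0 k) x * ('D_('e_k) f \o phi) x)) => //.
  by move=> x; rewrite inE => /d H; have [_ ->] := H i.
apply: Ck_sum => // j; apply: CkM => //; first by have [_ [_ +]] := Cphi j; exact.
exact: IH _ Cphi' (Df j).
Qed.

Lemma CkV n k (A : set 'rV[R]_n) f : open A -> (forall x, A x -> f x != 0) ->
  Ck k A f -> Ck k A (fun x => (f x)^-1).
Proof.
move=> oA f0; elim: k => [|k IH] Cf.
  by split=> // x Ax; apply: continuousV; [exact: f0 | exact: Ck_continuous Cf Ax].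
have Cf' := CkS Cf; case: Cf => cf df.
split; first by move=> x Ax; apply: continuousV; [exact: f0 | exact: cf].
split=> [i x Ax|i]; first by apply: derivableV; [exact: f0 | exact: df.1].
have CV := IH Cf'.
apply: (Ck_eq oA _ (CkM oA (Ck_cst k A (- 1)) (CkM oA (CkM oA CV CV) (df.2 i)))).
move=> x; rewrite inE => Ax.
rewrite deriveV ?f0//; last exact: df.1.
by rewrite mulN1r -invfM -expr2 scaleNr.
Qed.

Lemma pderivs_cat n (s t : seq 'I_n) (f : 'rV[R]_n -> R) :
  pderivs (s ++ t) f = pderivs s (pderivs t f).
Proof. by elim: s => //= i s ->. Qed.

Lemma smooth_onD1 n (A : set 'rV[R]_n) f i :
  smooth_on A f -> smooth_on A ('D_('e_i) f).
Proof.
by move=> sf s x Ax; have := sf (s ++ [:: i]) x Ax; rewrite pderivs_cat.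
Qed.

Lemma smooth_Ck n (A : set 'rV[R]_n) f :
  smooth_on A f <-> forall k, Ck k A f.
Proof.
split=> [sf k|].
  elim: k f sf => [|k IH] f sf; split => //; try by move=> x /(sf [::]) [].
  by split=> [i x /(sf [::]) []//|i]; apply: IH; exact: smooth_onD1.
move=> H s; elim/last_ind: s f H => [|s i IH] f H x Ax.
  by have [cf [df _]] := H 1%N; split=> [|i]; [exact: cf | exact: df].
rewrite -cats1 pderivs_cat; apply: IH => // k.
by have [_ [_ +]] := H k.+1; exact.
Qed.

End Ck.

Section Smooth.
Context {R : realType}.

Lemma smooth_on_sub n (A B : set 'rV[R]_n) f :
  A `<=` B -> smooth_on B f -> smooth_on A f.
Proof. by move=> AB sf s x /AB; exact: sf. Qed.

Lemma smooth_on_eq n (A : set 'rV[R]_n) f g :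
  open A -> {in A, f =1 g} -> smooth_on A f -> smooth_on A g.
Proof. by move=> oA fg /smooth_Ck sf; apply/smooth_Ck => k; exact: Ck_eq fg _. Qed.

Lemma smooth_on_loc n (A : set 'rV[R]_n) f :
  (forall x, A x -> exists B, [/\ open B, B x & smooth_on B f]) -> smooth_on A f.
Proof. by move=> H s x /H [B [_ Bx sf]]; exact: sf. Qed.

Lemma smooth_on_cst n (A : set 'rV[R]_n) c : smooth_on A (cst c).
Proof. by apply/smooth_Ck => k; exact: Ck_cst. Qed.

Lemma smooth_on_coord n (A : set 'rV[R]_n) j : smooth_on A (fun x => x ord0 j).
Proof. exact: (@vsmooth_id R n A j). Qed.

Lemma smooth_onD n (A : set 'rV[R]_n) f g : open A ->
  smooth_on A f -> smooth_on A g -> smooth_on A (fun x => f x + g x).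
Proof.
by move=> oA /smooth_Ck sf /smooth_Ck sg; apply/smooth_Ck => k; exact: CkD.
Qed.

Lemma smooth_onM n (A : set 'rV[R]_n) f g : open A ->
  smooth_on A f -> smooth_on A g -> smooth_on A (fun x => f x * g x).
Proof.
by move=> oA /smooth_Ck sf /smooth_Ck sg; apply/smooth_Ck => k; exact: CkM.
Qed.

Lemma smooth_onB n (A : set 'rV[R]_n) f g : open A ->
  smooth_on A f -> smooth_on A g -> smooth_on A (fun x => f x - g x).
Proof.
move=> oA sf sg.
have H := smooth_onD oA sf (smooth_onM oA (@smooth_on_cst _ A (- 1)) sg).
apply: (smooth_on_eq oA _ H).
by move=> x _; rewrite /= mulN1r.
Qed.

Lemma smooth_on_sum n (A : set 'rV[R]_n) I (r : seq I) (P : pred I)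
    (F : I -> 'rV[R]_n -> R) : open A -> (forall i, smooth_on A (F i)) ->
  smooth_on A (fun x => \sum_(i <- r | P i) F i x).
Proof.
move=> oA sF; apply/smooth_Ck => k; apply: Ck_sum => // i.
by move: k; apply/smooth_Ck.
Qed.

Lemma smooth_on_comp n m (A : set 'rV[R]_n) (B : set 'rV[R]_m) f phi :
  open A -> open B -> (forall x, A x -> B (phi x)) ->
  vsmooth_on A phi -> smooth_on B f -> smooth_on A (f \o phi).
Proof.
move=> oA oB AB sphi /smooth_Ck sf; apply/smooth_Ck => k.
by apply: Ck_comp AB _ (sf k) => // j; move: k; apply/smooth_Ck.
Qed.

Lemma vsmooth_on_comp n m p (A : set 'rV[R]_n) (B : set 'rV[R]_m)
    (psi : 'rV[R]_m -> 'rV[R]_p) (phi : 'rV[R]_n -> 'rV[R]_m) :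
  open A -> open B -> (forall x, A x -> B (phi x)) ->
  vsmooth_on A phi -> vsmooth_on B psi -> vsmooth_on A (psi \o phi).
Proof. by move=> oA oB AB sphi spsi j; exact: smooth_on_comp AB sphi (spsi j). Qed.

Lemma vsmooth_on_sub n m (A B : set 'rV[R]_n) (f : 'rV[R]_n -> 'rV[R]_m) :
  A `<=` B -> vsmooth_on B f -> vsmooth_on A f.
Proof. by move=> AB sf j; exact: smooth_on_sub (sf j). Qed.

Lemma vsmooth_on_eq n m (A : set 'rV[R]_n) (f g : 'rV[R]_n -> 'rV[R]_m) :
  open A -> {in A, f =1 g} -> vsmooth_on A f -> vsmooth_on A g.
Proof. by move=> oA fg sf j; apply: smooth_on_eq (sf j) => // x /fg ->. Qed.

Lemma smooth_on_continuous n (A : set 'rV[R]_n) f x :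
  smooth_on A f -> A x -> {for x, continuous f}.
Proof. by move=> sf Ax; have [] := sf [::] x Ax. Qed.

Lemma vsmooth_on_continuous n m (A : set 'rV[R]_n) (f : 'rV[R]_n -> 'rV[R]_m) x :
  vsmooth_on A f -> A x -> {for x, continuous f}.
Proof.
by move=> sf Ax; apply: continuous_rV => j; exact: smooth_on_continuous (sf j) Ax.
Qed.

Lemma vsmooth_affine n m (A : set 'rV[R]_n) (c : 'rV[R]_m) (M : 'M[R]_(n, m)) :
  open A -> vsmooth_on A (fun x => c + x *m M).
Proof.
move=> oA j; apply: (@smooth_on_eq _ A
  (fun x => (c ord0 j) + \sum_i x ord0 i * M i j)) => //.
  by move=> x _; rewrite !mxE.
apply: smooth_onD => //; first exact: smooth_on_cst.
apply: smooth_on_sum => // i; apply: smooth_onM => //; last exact: smooth_on_cst.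
exact: smooth_on_coord.
Qed.

Lemma vsmooth_linear n m (A : set 'rV[R]_n) (M : 'M[R]_(n, m)) :
  open A -> vsmooth_on A (fun x => x *m M).
Proof.
move=> oA; apply: vsmooth_on_eq oA _ (vsmooth_affine 0 M oA) => x _.
by rewrite add0r.
Qed.

(** Vectors are rows, so this is the transpose of the usual Jacobian matrix and
    the Jacobian of a composite is the product in the order of application. *)
Definition jac n m (f : 'rV[R]_n -> 'rV[R]_m) x : 'M[R]_(n, m) :=
  \matrix_(i, j) 'D_('e_i) (fun y => f y ord0 j) x.

Lemma jac_near n m (f g : 'rV[R]_n -> 'rV[R]_m) x :
  {near x, f =1 g} -> jac f x = jac g x.
Proof.
move=> fg; apply/matrixP => i j; rewrite !mxE; apply: near_eq_derive.
by apply: filterS fg => y ->.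
Qed.

Lemma jac_eq n m (f g : 'rV[R]_n -> 'rV[R]_m) x : f =1 g -> jac f x = jac g x.
Proof. by move=> /funext ->. Qed.

Lemma jac_comp n m p (A : set 'rV[R]_n) (B : set 'rV[R]_m)
    (psi : 'rV[R]_m -> 'rV[R]_p) (phi : 'rV[R]_n -> 'rV[R]_m) x :
  open B -> A x -> B (phi x) -> vsmooth_on A phi -> vsmooth_on B psi ->
  jac (psi \o phi) x = jac phi x *m jac psi (phi x).
Proof.
move=> oB Ax Bx sphi spsi; apply/matrixP => i j; rewrite !mxE.
have [|k|k|_ ->] := @is_derive_comp _ _ _ (fun y => psi y ord0 j) phi B x 'e_i oB Bx.
- by move=> q k Bq; have [_] := spsi j [::] q Bq.
- by have [] := spsi j [:: k] _ Bx.
- by have [_] := sphi k [::] x Ax.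
by apply: eq_bigr => k _; rewrite !mxE.
Qed.

Lemma jac_affine n m (c : 'rV[R]_m) (M : 'M[R]_(n, m)) x :
  jac (fun x => c + x *m M) x = M.
Proof.
apply/matrixP => i j; rewrite !mxE /derive.
have E : {near 0^', (cst (M i j)) =1 (fun h : R => h^-1 *:
  (((fun y : 'rV[R]_n => (c + y *m M) ord0 j) \o shift x) (h *: 'e_i)
    - (c + x *m M) ord0 j))}.
  apply: filterS (nbhs_dnbhs_neq 0) => h h0.
  have -> : ((fun y : 'rV[R]_n => (c + y *m M) ord0 j) \o shift x) (h *: 'e_i) =
      (c + x *m M) ord0 j + h * M i j.
    by rewrite /= mulmxDl -scalemxAl -rowE !mxE; ring.
  by rewrite addrAC subrr add0r /GRing.scale/= mulrA mulVf ?mul1r//.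
by apply: cvg_lim => //; apply: cvg_trans (near_eq_cvg E) _; exact: cvg_cst.
Qed.

Lemma jac_linear n m (M : 'M[R]_(n, m)) x : jac (fun x => x *m M) x = M.
Proof.
by rewrite -[RHS](jac_affine 0 M x); apply: jac_eq => y; rewrite add0r.
Qed.

Lemma jac_id n x : jac (fun x : 'rV[R]_n => x) x = 1%:M.
Proof.
by rewrite -[RHS](jac_linear 1%:M x); apply: jac_eq => y; rewrite mulmx1.
Qed.

Lemma norm_mulmx n m (M : 'M[R]_(n, m)) : exists2 C, 0 < C &
  forall v : 'rV[R]_n, `|v *m M| <= C * `|v|.
Proof.
exists (1 + \sum_i \sum_j `|M i j|).
  by rewrite ltr_wpDr // sumr_ge0 // => i _; rewrite sumr_ge0.
move=> v; apply/mx_norm_leP => [|j].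
  by rewrite mulr_ge0 // addr_ge0 // sumr_ge0 // => i _; rewrite sumr_ge0.
rewrite mxE (le_trans (ler_norm_sum _ _ _)) // mulrDl mul1r ler_wpDl //.
rewrite mulr_suml ler_sum // => i _; rewrite normrM mulrC.
apply: ler_pM => //; last exact: coord_le_norm.
by rewrite (bigD1 j) //= lerDl sumr_ge0.
Qed.

(** Letting both end points vary is what the inverse function theorem needs: a
    map with Jacobian 1 is then a small Lipschitz perturbation of the identity.
    It costs no more than differentiability, because the partial derivatives
    are continuous and the mean value theorem allows any two end points. *)
Lemma strict_diff n m (A : set 'rV[R]_n) (phi : 'rV[R]_n -> 'rV[R]_m) x0 e :
  open A -> A x0 -> vsmooth_on A phi -> 0 < e -> exists2 r, 0 < r &
    forall x y, `|x - x0| < r -> `|y - x0| < r ->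
      `|phi x - phi y - (x - y) *m jac phi x0| <= e * `|x - y|.
Proof.
move=> oA Ax sphi e0; pose e' := e / n.+1%:R.
have e'0 : 0 < e' by rewrite divr_gt0.
have H : \forall p \near x0, A p /\ forall j i,
    `|'D_('e_i) (fun y => phi y ord0 j) p - 'D_('e_i) (fun y => phi y ord0 j) x0|
      <= e'.
  apply: (@filterI _ _ (nbhs_filter x0)); first exact: open_nbhs_nbhs.
  apply: (@filter_forall _ _ _ _ (nbhs_filter x0)) => j.
  apply: (@filter_forall _ _ _ _ (nbhs_filter x0)) => i.
  have [c _] := sphi j [:: i] x0 Ax.
  have [r r0 H] := cvg_epsdeltaP c e'0.
  apply/nbhs_ballP; exists r => // p; rewrite -ball_normE /ball_ /= distrC.
  exact: H.
have /nbhs_ballP [r /= r0 Hr] := H; exists r => // x y xr yr.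
have vr p : vbtw x y p -> ball x0 r p.
  move=> b; rewrite -ball_normE /ball_ /= distrC.
  apply: (@le_lt_trans _ _ (Num.max `|x - x0| `|y - x0|)).
    by apply: vbtw_ball b _ _; rewrite le_max lexx ?orbT.
  by rewrite gt_max xr.
apply/mx_norm_leP => [|j]; first by rewrite mulr_ge0 // ltW.
have [|xi [xib E]] := @mvt_box _ _ (fun y => phi y ord0 j) x y.
  by move=> p i /vr/Hr [Ap _]; have [_] := sphi j [::] p Ap.
rewrite !mxE E -sumrB (le_trans (ler_norm_sum _ _ _)) //.
apply: (@le_trans _ _ (\sum_(i < n) `|x - y| * e')).
  apply: ler_sum => i _; rewrite !mxE -mulrBr normrM ler_pM //.
    by have := coord_le_norm (x - y) i; rewrite !mxE.
  by have [_] := Hr _ (vr _ (xib i)); exact.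
rewrite sumr_const card_ord -mulrnAr mulrC ler_wpM2r // -mulr_natl.
by rewrite /e' mulrCA ger_pMr // ler_pdivrMr // mul1r ler_nat.
Qed.

(** Immersions are defined with the Jacobian of the Frechet derivative; the
    rest of the argument uses the matrix of partial derivatives. *)
Lemma vsmooth_differentiable n m (A : set 'rV[R]_n) (f : 'rV[R]_n -> 'rV[R]_m) x :
  open A -> A x -> vsmooth_on A f -> differentiable f x /\ 'J f x = jac f x.
Proof.
move=> oA Ax sf.
have Lc : continuous (mulmxr (jac f x) : 'rV[R]_n -> 'rV[R]_m).
  move=> y; have := vsmooth_linear (jac f x) openT.
  by move=> /vsmooth_on_continuous; exact.
have N e : 0 < e -> \forall h \near (0 : 'rV[R]_n),
    `|f (h + x) - (f x + h *m jac f x)| <= e * `|h|.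
  move=> e0; have [r r0 H] := strict_diff oA Ax sf e0.
  apply/nbhs_ballP; exists r => // h; rewrite -ball_normE /ball_ /= sub0r normrN => hr.
  have := H (h + x) x; rewrite addrK subrr normr0 => /(_ hr r0).
  by rewrite opprD addrA.
have E : 'd f x = mulmxr (jac f x) :> ('rV[R]_n -> 'rV[R]_m).
  by apply: diff_unique => //; apply/eqaddoP => e /N.
split; last by apply/row_matrixP => i; rewrite rowE mul_rV_lin1 /= E rowE.
apply/diff_locallyP; rewrite E; split=> //.
by apply/eqaddoP => e /N.
Qed.

Lemma jac0_cst n (f : 'rV[R]_n -> R) x0 r :
  smooth_on [set x | `|x - x0| < r] f ->
  (forall x i, `|x - x0| < r -> 'D_('e_i) f x = 0) ->
  forall x y, `|x - x0| < r -> `|y - x0| < r -> f x = f y.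
Proof.
move=> sf f0 x y xr yr.
have vr p : vbtw x y p -> `|p - x0| < r.
  move=> b; apply: (@le_lt_trans _ _ (Num.max `|x - x0| `|y - x0|)).
    by apply: vbtw_ball b _ _; rewrite le_max lexx ?orbT.
  by rewrite gt_max xr.
have [|xi [xib E]] := @mvt_box _ _ f x y.
  by move=> p i /vr pr; have [_] := sf [::] p pr.
apply/eqP; rewrite -subr_eq0 E big1 // => i _.
by rewrite f0 ?mulr0 //; exact: vr.
Qed.

Lemma open_norm_ball n (x : 'rV[R]_n) r : open [set y : 'rV[R]_n | `|y - x| < r].
Proof.
rewrite openE => y /= yr; apply/nbhs_ballP; exists (r - `|y - x|).
  by rewrite /= subr_gt0.
move=> z; rewrite -ball_normE /ball_ /= ltrBrDr distrC => zr.
by rewrite (le_lt_trans _ zr) // -(subrKA y) ler_normD.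
Qed.

Lemma norm_ball_in n (A : set 'rV[R]_n) x : open A -> A x ->
  exists2 r, 0 < r & [set y : 'rV[R]_n | `|y - x| <= r] `<=` A.
Proof.
move=> oA Ax; have /nbhs_ballP [r /= r0 rA] : nbhs x A by exact: open_nbhs_nbhs.
exists (r / 2); first by rewrite divr_gt0.
move=> y /= yr; apply: rA; rewrite -ball_normE /ball_ /= distrC.
by rewrite (le_lt_trans yr) // ltr_pdivrMr // ltr_pMr // ltr1n.
Qed.

End Smooth.

(** * The inverse function theorem *)

(** The fixed point theorem of Banach is stated for complete normed modules:
    this joins the two structures that matrices carry separately. *)
HB.instance Definition _ (R : realType) m n := Complete.on 'M[R]_(m, n).

Section InverseFunction.
Context {R : realType}.

Lemma closed_norm_ball n (x : 'rV[R]_n) r :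
  closed [set y : 'rV[R]_n | `|y - x| <= r].
Proof.
rewrite (_ : [set _ | _] = ~` [set y | r < `|y - x|]); last first.
  by apply/seteqP; split => y /=; rewrite leNgt => /negP.
apply: open_closedC; rewrite openE => y /= yr; apply/nbhs_ballP.
exists (`|y - x| - r); first by rewrite /= subr_gt0.
move=> z; rewrite -ball_normE /ball_ /= ltrBrDr -ltrBrDl => /lt_le_trans; apply.
by rewrite lerBlDr [leRHS]addrC -(subrKA z) ler_normD.
Qed.

Lemma fixpoint_ball n (T : 'rV[R]_n -> 'rV[R]_n) x1 r : 0 <= r ->
  (forall x, `|x - x1| <= r -> `|T x - x1| <= r) ->
  (forall x y, `|x - x1| <= r -> `|y - x1| <= r ->
     `|T x - T y| <= 2^-1 * `|x - y|) ->
  exists2 p, `|p - x1| <= r & T p = p.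
Proof.
move=> r0 TU TL; pose U := [set y : 'rV[R]_n | `|y - x1| <= r].
have h : {homo T : x / U x >-> U x} by [].
have [|||p Up pT] := @banach_fixed_point R 'rV[R]_n U (mkfun_fun h).
- have q0 : 0 <= 2^-1 :> R by [].
  exists (NngNum q0); split => /=; first by lra.
  by move=> [x y] [/= Ux Uy]; exact: TL.
- exact: closed_norm_ball.
- by exists x1; rewrite /U /= subrr normr0.
by exists p.
Qed.

Lemma Ck_det n m (A : set 'rV[R]_n) (M : 'rV[R]_n -> 'M[R]_m) k :
  open A -> (forall i j, Ck k A (fun x => M x i j)) ->
  Ck k A (fun x => \det (M x)).
Proof.
move=> oA CM; apply: Ck_sum => // s; apply: CkM => //; first exact: Ck_cst.
elim: (index_enum _) => [|i l IH].
  by apply: (Ck_eq oA _ (Ck_cst k A 1)) => x _; rewrite big_nil.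
have H := CkM oA (CM i (s i)) IH.
by apply: (Ck_eq oA _ H) => x _; rewrite big_cons.
Qed.

(** Cramer's formula. *)
Lemma Ck_invmx n m (A : set 'rV[R]_n) (M : 'rV[R]_n -> 'M[R]_m) k i j :
  open A -> (forall x, A x -> M x \in unitmx) ->
  (forall i j, Ck k A (fun x => M x i j)) ->
  Ck k A (fun x => invmx (M x) i j).
Proof.
move=> oA uM CM.
apply: (@Ck_eq _ _ _ _ (fun x => (\det (M x))^-1 * ((-1) ^+ (j + i) *
  \det (row' j (col' i (M x)))))) => //.
  by move=> x; rewrite inE => Ax; rewrite /invmx uM // !mxE.
apply: CkM => //.
  apply: CkV => //; last exact: Ck_det.
  by move=> x /uM; rewrite unitmxE unitfE.
apply: CkM => //; first exact: Ck_cst.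
apply: Ck_det => // a b.
by apply: (Ck_eq oA _ (CM (lift j a) (lift i b))) => x _; rewrite !mxE.
Qed.

Definition local_inverse n m (A : set 'rV[R]_n) (phi : 'rV[R]_n -> 'rV[R]_m) x0
    (U : set 'rV[R]_n) psi :=
  [/\ open U, U x0, U `<=` A, open (phi @` U) &
      (forall x, U x -> psi (phi x) = x) /\ vsmooth_on (phi @` U) psi].

(** A preimage of [y] is a fixed point of [x |-> x - phi x + y], which strict
    differentiability makes a contraction of a small ball. This gives openness
    and a continuous inverse [psi], and the same estimate gives the derivative
    of [psi], namely the inverse matrix of the Jacobian at [psi y]. That formula
    raises the class of [psi] from C^k to C^(k+1). *)
Lemma inverse_function1 n (A : set 'rV[R]_n) (phi : 'rV[R]_n -> 'rV[R]_n) x0 :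
  open A -> A x0 -> vsmooth_on A phi -> jac phi x0 = 1%:M ->
  exists U psi, local_inverse A phi x0 U psi.
Proof.
move=> oA Ax0 sphi J1; have h0 : 0 < 2^-1 :> R by [].
have [r r0 H] := strict_diff oA Ax0 sphi h0.
pose D x := \det (jac phi x).
have Cjac k i j : Ck k A (fun x => jac phi x i j).
  have : smooth_on A (fun x => jac phi x i j).
    apply: smooth_on_eq oA _ (smooth_onD1 i (sphi j)) => x _.
    by rewrite mxE.
  by move/smooth_Ck.
have cD : {for x0, continuous D} by apply: (@Ck_continuous _ _ 0 A) => //; exact: Ck_det.
have [r1 r10 Hr1] : exists2 r1, 0 < r1 & forall x, `|x - x0| < r1 -> A x /\ D x != 0.
  have [r1 r10 H1] := cvg_epsdeltaP cD h0.
  have [r2 r20 H2] := norm_ball_in oA Ax0.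
  exists (Num.min r1 r2); first by rewrite lt_min r10.
  move=> x; rewrite lt_min => /andP[/H1 xr /ltW/H2 Ax]; split=> //.
  have {}xr : `|D x - D x0| <= 2^-1 by exact: xr.
  have Dx0 : D x0 = 1 by rewrite /D J1 det1.
  by apply/eqP => Dx; move: xr; rewrite Dx Dx0 sub0r normrN normr1; lra.
pose rho := Num.min r r1; have rho0 : 0 < rho by rewrite lt_min r0.
pose U := [set x : 'rV[R]_n | `|x - x0| < rho].
have Ur x : U x -> `|x - x0| < r by rewrite /U /= lt_min => /andP[].
have Ur1 x : U x -> `|x - x0| < r1 by rewrite /U /= lt_min => /andP[].
have H' x y : U x -> U y -> `|phi x - phi y - (x - y)| <= 2^-1 * `|x - y|.
  by move=> /Ur ux /Ur uy; have := H x y ux uy; rewrite J1 mulmx1.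
have lip x y : U x -> U y -> `|x - y| <= 2 * `|phi x - phi y|.
  move=> ux uy; have := H' x y ux uy.
  have := ler_normB (phi x - phi y) (phi x - phi y - (x - y)).
  by rewrite opprB addrC subrK; lra.
have inj x y : U x -> U y -> phi x = phi y -> x = y.
  move=> ux uy e; have := lip x y ux uy.
  by rewrite e subrr normr0 mulr0 normr_le0 subr_eq0 => /eqP.
have oU : open U by exact: open_norm_ball.
have surj x1 e : U x1 -> 0 < e -> exists2 d, 0 < d &
    forall y, `|y - phi x1| <= d -> exists2 x, U x /\ `|x - x1| <= e & phi x = y.
  move=> Ux1 e0; have [s s0 sU] := norm_ball_in oU Ux1.
  pose t := Num.min s e; have t0 : 0 < t by rewrite lt_min s0.
  exists (t / 2) => [|y yd]; first by rewrite divr_gt0.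
  have tU x : `|x - x1| <= t -> U x.
    by move=> xt; apply: sU => /=; rewrite (le_trans xt) // ge_min lexx.
  have tt : `|x1 - x1| <= t by rewrite subrr normr0 ltW.
  have TE a b : (a - phi a + y) - (b - phi b + y) = - (phi a - phi b - (a - b)).
    by apply/rowP => i; rewrite !mxE; ring.
  have [|x xt|a b at_ bt|p pt pE] := @fixpoint_ball n (fun x => x - phi x + y) x1 t.
  - exact: ltW.
  - have -> : x - phi x + y - x1 = - (phi x - phi x1 - (x - x1)) + (y - phi x1).
      by apply/rowP => i; rewrite !mxE; ring.
    rewrite (le_trans (ler_normD _ _)) // normrN (splitr t) lerD //.
    by rewrite (le_trans (H' _ _ (tU _ xt) (tU _ tt))) // mulrC ler_wpM2r.
  - by rewrite TE normrN; apply: H'; exact: tU.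
  exists p; first by split; [exact: tU | rewrite (le_trans pt) // ge_min lexx orbT].
  by apply/eqP; rewrite eq_sym -subr_eq0; apply/eqP;
    rewrite -[RHS](subrr p) -{2}pE; apply/rowP => i; rewrite !mxE; ring.
have oV : open (phi @` U).
  rewrite openE => _ [x1 Ux1 <-]; have [d d0 Hd] := surj x1 1 Ux1 ltr01.
  apply/nbhs_ballP; exists d => // y; rewrite -ball_normE /ball_ /= distrC.
  by move=> /ltW/Hd [x [Ux _] <-]; exists x.
pose psi y := xget 0 [set x | U x /\ phi x = y].
have psiK x : U x -> psi (phi x) = x.
  move=> Ux; rewrite /psi; case: xgetP => [z _ [Uz e]|/(_ x)[]//].
  exact: inj.
have Vpsi y : (phi @` U) y -> U (psi y) /\ phi (psi y) = y.
  by move=> [x Ux <-]; rewrite psiK.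
have Apsi x : U x -> A x by move=> /Ur1 /Hr1 [].
have ujac x : U x -> jac phi x \in unitmx.
  by move=> /Ur1 /Hr1 [_]; rewrite unitmxE unitfE.
have cpsi y : (phi @` U) y -> {for y, continuous psi}.
  move=> [x1 Ux1 <-]; rewrite /prop_for /=.
  suff : psi z @[z --> phi x1] --> psi (phi x1) by exact.
  apply: cvg_epsdelta => e e0; have [d d0 Hd] := surj x1 e Ux1 e0.
  exists d => // z /ltW/Hd [x [Ux xe] <-].
  by rewrite !psiK.
have dpsi y i j : (phi @` U) y ->
    is_derive y 'e_i (fun y => psi y ord0 j) (invmx (jac phi (psi y)) i j).
  move=> Vy; have [Ux ex] := Vpsi y Vy; set x := psi y in Ux ex *.
  set J := invmx _.
  have L : h^-1 *: (((fun y => psi y ord0 j) \o shift y) (h *: 'e_i)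
      - psi y ord0 j) @[h --> 0^'] --> J i j.
    have [C C0 HC] := norm_mulmx J.
    apply/cvgrPdist_le => e e0.
    have e'0 : 0 < e / (2 * C) by rewrite divr_gt0 // mulr_gt0.
    have [d d0 Hd] := strict_diff oA (Apsi x Ux) sphi e'0.
    have d20 : 0 < d / 2 by rewrite divr_gt0.
    have [d1 d10 Hd1] := cvg_epsdeltaP (cpsi y Vy) d20.
    have [d2 d20' Hd2] := norm_ball_in oV Vy.
    have ei (h : R) : `|h *: ('e_i : 'rV[R]_n)| <= `|h|.
      apply/mx_norm_leP => // k; rewrite !mxE normrM eqxx /=.
      by rewrite ler_piMr //; case: eqP => _; rewrite ?normr1 ?normr0.
    near=> h.
    have h1 : `|h| < d1 by near: h; exact: dnbhs0_lt.
    have h2 : `|h| < d2 by near: h; exact: dnbhs0_lt.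
    have hn0 : h != 0 by near: h; exact: nbhs_dnbhs_neq.
    set z := h *: 'e_i + y; have zy : z - y = h *: 'e_i by rewrite /z addrK.
    have Vz : (phi @` U) z.
      by apply: Hd2; rewrite /= zy (le_trans (ei h)) // ltW.
    have [Ua ea] := Vpsi z Vz; set a := psi z in Ua ea.
    have ad : `|a - x| < d.
      have := Hd1 z; rewrite zy => /(_ (le_lt_trans (ei h) h1)) /le_lt_trans.
      by apply; rewrite ltr_pdivrMr // ltr_pMr // ltr1n.
    have xd : `|x - x| < d by rewrite subrr normr0.
    have E1 : `|z - y - (a - x) *m jac phi x| <= e / (2 * C) * (2 * `|h|).
      rewrite -{1}ea -{1}ex (le_trans (Hd a x ad xd)) // (ler_wpM2l (ltW e'0)) //.
      rewrite (le_trans (lip a x Ua Ux)) // ler_wpM2l // ea ex zy; exact: ei.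
    have E2 : `|(h *: 'e_i - (a - x) *m jac phi x) *m J| <= e * `|h|.
      rewrite -zy (le_trans (HC _)) // (le_trans (ler_wpM2l (ltW C0) E1)) //.
      rewrite le_eqVlt; apply/orP; left; apply/eqP; field.
      by rewrite gt_eqF.
    have E3 : `|h * J i j - (a - x) ord0 j| <= e * `|h|.
      apply: le_trans E2; apply: le_trans (coord_le_norm _ j).
      rewrite mulmxBl -scalemxAl -rowE -mulmxA mulmxV ?ujac// mulmx1.
      by rewrite !mxE.
    rewrite /= -/z -/a.
    have -> : J i j - h^-1 *: (a ord0 j - x ord0 j) =
        h^-1 * (h * J i j - (a - x) ord0 j).
      by rewrite mulrBr mulrA mulVf // mul1r !mxE.
    by rewrite normrM normfV mulrC ler_pdivrMr ?normr_gt0.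
  by split; [apply/cvg_ex; eexists; exact: L | exact: cvg_lim L].
exists U, psi; split=> //; first by rewrite /U /= subrr normr0.
split=> // j; apply/smooth_Ck.
suff K k : forall j, Ck k (phi @` U) (fun y => psi y ord0 j) by [].
elim: k => [|k IH] {}j.
  by split=> // y Vy; exact: continuous_coord (cpsi y Vy).
split; first by move=> y Vy; exact: continuous_coord (cpsi y Vy).
split=> [i y Vy|i]; first by have [] := dpsi y i j Vy.
apply: (@Ck_eq _ _ _ _ (fun y => invmx (jac phi (psi y)) i j)) => //.
  by move=> y; rewrite inE => Vy; have [_ ->] := dpsi y i j Vy.
apply: Ck_invmx => // [y /Vpsi [/ujac]//|a b].
apply: (@Ck_comp _ _ _ _ _ A (fun x => jac phi x a b) psi) => //.
by move=> y /Vpsi [/Apsi].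
Unshelve. all: by end_near. Qed.

(** The dimensions [n] and [m] agree but need not be convertible, as with
    [r + (n - r)] and [n] in the flow boxes: a two-sided inverse of the Jacobian
    takes the place of a cast. *)
Lemma inverse_function n m (A : set 'rV[R]_n) (phi : 'rV[R]_n -> 'rV[R]_m) x0
    (L : 'M[R]_(m, n)) : open A -> A x0 -> vsmooth_on A phi ->
  jac phi x0 *m L = 1%:M -> L *m jac phi x0 = 1%:M ->
  exists U psi, local_inverse A phi x0 U psi.
Proof.
move=> oA Ax0 sphi JL LJ; set J := jac phi x0 in JL LJ.
have sphi' : vsmooth_on A (fun x => phi x *m L).
  exact: (vsmooth_on_comp oA openT (fun _ _ => I) sphi (vsmooth_linear L openT)).
have J1 : jac (fun x => phi x *m L) x0 = 1%:M.
  rewrite (jac_comp openT Ax0 I sphi (vsmooth_linear L openT)).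
  by rewrite jac_linear.
have [U [psi [oU Ux0 UA oV [psiK spsi]]]] := inverse_function1 oA Ax0 sphi' J1.
have VE : phi @` U = (fun y => y *m L) @^-1` ((fun x => phi x *m L) @` U).
  apply/seteqP; split => [_ [x Ux <-]|y [x Ux e]]; first by exists x.
  by exists x => //; rewrite -[LHS]mulmx1 -[RHS]mulmx1 -LJ !mulmxA e.
have oV' : open (phi @` U).
  rewrite VE; apply: open_comp => // y _.
  exact: vsmooth_on_continuous (vsmooth_linear L openT) I.
exists U, (fun y => psi (y *m L)); split=> //; split=> [x Ux|]; first exact: psiK.
apply: (vsmooth_on_comp oV' oV _ (vsmooth_linear L oV') spsi) => y.
by rewrite VE.
Qed.

End InverseFunction.

(** * Smooth images of lower dimension have no interior *)

Section SmallImages.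
Context {R : realType}.

(** Counting: a cube of dimension [a] is covered by [N ^ a] cells on which
    [phi] varies by at most [O(1 / N)], so its image cannot contain the points
    of a grid of mesh [O(1 / N)] in dimension [b > a], of which there are
    [O(N ^ b)]. *)
Lemma lipschitz_image_no_interior (a b : nat) (phi : 'rV[R]_a -> 'rV[R]_b) c rho C
    y0 delta : (a < b)%N -> 0 < rho -> 0 < C -> 0 < delta ->
  (forall x y, `|x - c| <= rho -> `|y - c| <= rho ->
     `|phi x - phi y| <= C * `|x - y|) ->
  exists2 y, `|y - y0| <= delta & forall x, `|x - c| <= rho -> phi x <> y.
Proof.
move=> ab rho0 C0 delta0 lip; apply: contrapT => H.
have {}H y : `|y - y0| <= delta -> exists2 x, `|x - c| <= rho & phi x = y.
  move=> yd; apply: contrapT => H'; apply: H; exists y => // x xr e.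
  by apply: H'; exists x.
(* The grid has mesh [delta / M] and the cells have size [2 * rho / N]. As
   [N >= K * M], the image of a cell has diameter less than [delta / M]; as
   [N.+1 = K * M.+1] and [M = K ^ a], there are [N.+1 ^ a = M * M.+1 ^ a] cells,
   less than the [M.+1 ^ b] points of the grid. *)
pose K := (Num.truncn (2 * rho * C / delta)).+1.
have HK : 2 * rho * C / delta < K%:R by exact: truncnS_gt.
pose M := (K ^ a)%N; pose N := (K * M.+1).-1.
have N1 : N.+1 = (K * M.+1)%N by rewrite /N prednK // muln_gt0.
have M0 : (0 < M)%N by rewrite expn_gt0.
have NKM : (K * M <= N)%N by rewrite -ltnS N1 mulnS -[ltnLHS]add0n ltn_add2r.
have N0 : (0 < N)%N by apply: leq_trans NKM; rewrite muln_gt0.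
pose cell (x : 'rV[R]_a) : {ffun 'I_a -> 'I_N.+1} :=
  [ffun i => inord (Num.truncn (N%:R * ((x ord0 i - c ord0 i + rho) / (2 * rho))))].
have cellP x x' : `|x - c| <= rho -> `|x' - c| <= rho -> cell x = cell x' ->
    `|x - x'| <= 2 * rho / N%:R.
  move=> xr xr' e; apply/mx_norm_leP => [|i].
    by rewrite divr_ge0 // mulr_ge0 // ltW.
  pose t (z : 'rV[R]_a) := N%:R * ((z ord0 i - c ord0 i + rho) / (2 * rho)).
  have tb z : `|z - c| <= rho -> 0 <= t z <= N%:R.
    move=> /(mx_norm_leP _ (ltW rho0))/(_ i); rewrite !mxE ler_norml => /andP[z1 z2].
    apply/andP; split.
      by rewrite /t mulr_ge0 // divr_ge0 //; lra.
    by rewrite /t ler_piMr // ler_pdivrMr; lra.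
  have tc z : `|z - c| <= rho -> (cell z i)%:R <= t z < (cell z i)%:R + 1.
    move=> /tb /andP[tz0 tzN]; rewrite ffunE inordK.
      by rewrite natr1; exact: truncn_itv tz0.
    by rewrite ltnS -(ler_nat R) (le_trans _ tzN) // ; have /andP[] := truncn_itv tz0.
  have := tc x xr; have := tc x' xr'; rewrite e => /andP[t1 t2] /andP[t3 t4].
  have tt : `|t x - t x'| <= 1 by rewrite ler_norml; lra.
  have -> : (x - x') ord0 i = (2 * rho / N%:R) * (t x - t x').
    rewrite !mxE /t; field.
    by rewrite !gt_eqF ?ltr0n // .
  have w0 : 0 <= 2 * rho / N%:R by rewrite divr_ge0 // mulr_ge0 // ltW.
  by rewrite normrM (ger0_norm w0) ler_piMr.
pose grid (g : {ffun 'I_b -> 'I_M.+1}) : 'rV[R]_b :=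
  y0 + \row_j (delta * ((g j)%:R / M%:R)).
have gridB g : `|grid g - y0| <= delta.
  rewrite /grid addrAC subrr add0r; apply/mx_norm_leP => [|j]; first exact: ltW.
  rewrite !mxE normrM gtr0_norm // ger0_norm ?divr_ge0 //.
  rewrite (ler_piMr (ltW delta0)) // ler_pdivrMr ?ltr0n // mul1r ler_nat.
  by rewrite -ltnS.
have gridD g g' : g != g' -> delta / M%:R <= `|grid g - grid g'|.
  move=> gg; have [j gj] : exists j, g j != g' j.
    apply: contrapT => H'; move/eqP: gg; apply; apply/ffunP => j.
    by apply: contrapT => e; apply: H'; exists j; apply/eqP.
  apply: le_trans (coord_le_norm _ j).
  have -> : (grid g - grid g') ord0 j = delta / M%:R * ((g j)%:R - (g' j)%:R).
    by rewrite !mxE; ring.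
  have w0 : 0 <= delta / M%:R by rewrite divr_ge0 // ltW.
  rewrite normrM (ger0_norm w0) ler_peMr //.
  wlog : g g' gg gj / (g j < g' j)%N => [W|lt].
    case: (ltngtP (g j) (g' j)) => [|lt|/val_inj e]; first exact: W.
      by rewrite distrC; apply: W => //; rewrite eq_sym.
    by rewrite e eqxx in gj.
  by rewrite distrC -natrB 1?ltnW // normr_nat ler1n subn_gt0.
have gx g : exists x, `|x - c| <= rho /\ phi x = grid g.
  by have [x xr e] := H _ (gridB g); exists x.
have [x xP] := choice gx.
have inj : injective (cell \o x).
  move=> g g' /= e; apply/eqP; apply: contraT => /gridD.
  have [xr ex] := xP g; have [xr' ex'] := xP g'.
  rewrite -ex -ex' => /le_trans/(_ (lip _ _ xr xr')).
  move=> /le_trans/(_ (ler_wpM2l (ltW C0) (cellP _ _ xr xr' e))).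
  rewrite leNgt => /negP; case.
  rewrite ltr_pdivlMr ?ltr0n //.
  have -> : C * (2 * rho / N%:R) * M%:R = 2 * rho * C * M%:R / N%:R by ring.
  rewrite ltr_pdivrMr ?ltr0n //.
  move: HK; rewrite ltr_pdivrMr // => HK'.
  have : 2 * rho * C * M%:R < K%:R * delta * M%:R by rewrite ltr_pM2r // ltr0n.
  move=> /lt_le_trans; apply; rewrite mulrAC mulrC ler_pM2l //.
  by rewrite -natrM ler_nat.
have := leq_card _ inj; rewrite !card_ffun !card_ord leqNgt => /negP; apply.
rewrite N1 expnMn (@leq_trans (M.+1 ^ a.+1)) ?leq_exp2l //.
by rewrite expnS ltn_pmul2r // expn_gt0.
Qed.

Lemma smooth_lipschitz n m (A : set 'rV[R]_n) (phi : 'rV[R]_n -> 'rV[R]_m) x0 :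
  open A -> A x0 -> vsmooth_on A phi -> exists2 r, 0 < r & exists2 C, 0 < C &
    forall x y, `|x - x0| < r -> `|y - x0| < r ->
      `|phi x - phi y| <= C * `|x - y|.
Proof.
move=> oA Ax sphi; have [r r0 H] := strict_diff oA Ax sphi ltr01.
have [C C0 HC] := norm_mulmx (jac phi x0).
exists r => //; exists (1 + C); first by rewrite addr_gt0.
move=> x y xr yr; rewrite mulrDl -[phi x - phi y](subrK ((x - y) *m jac phi x0)).
by rewrite (le_trans (ler_normD _ _)) // lerD //; exact: H.
Qed.

Lemma rational_ball n (x : 'rV[R]_n) r : 0 < r ->
  exists (c : 'rV[rat]_n) (q : rat), [/\ 0 < ratr q :> R,
    `|x - map_mx ratr c| <= ratr q &
    forall z, `|z - map_mx ratr c| <= ratr q -> `|z - x| < r].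
Proof.
move=> r0; have [q] : exists q : rat, ratr q \in `]0, r / 2[.
  by apply: rat_in_itvoo; rewrite divr_gt0.
rewrite in_itv /= => /andP[q0 qr].
have H i : exists c : rat, ratr c \in `]x ord0 i - ratr q, x ord0 i + ratr q[.
  by apply: rat_in_itvoo; lra.
have [c Hc] := choice H; exists (\row_i c i), q; split=> // [|z zq].
  apply/mx_norm_leP => [|i]; first exact: ltW.
  by have := Hc i; rewrite in_itv /= !mxE ler_norml; lra.
have xq : `|x - map_mx ratr (\row_i c i)| <= ratr q.
  apply/mx_norm_leP => [|i]; first exact: ltW.
  by have := Hc i; rewrite in_itv /= !mxE ler_norml; lra.
rewrite -(subrKA (map_mx ratr (\row_i c i))).
rewrite (le_lt_trans (ler_normD _ _)) // [`|_ - x|]distrC.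
by move: zq xq qr; lra.
Qed.

(** The domains are exhausted by countably many compact balls on which the maps
    are Lipschitz. The image of such a ball is closed, and by the counting
    argument its complement is dense: Baire's theorem gives a point of [Q]
    outside all of these images. *)
Lemma smooth_images_no_interior (a b : nat) (A : nat -> set 'rV[R]_a)
    (phi : nat -> 'rV[R]_a -> 'rV[R]_b) (Q : set 'rV[R]_b) :
  (a < b)%N -> (forall k, open (A k)) -> (forall k, vsmooth_on (A k) (phi k)) ->
  open Q -> Q !=set0 -> ~ (Q `<=` \bigcup_k (phi k @` A k)).
Proof.
move=> ab oA sphi oQ Q0 cover.
pose B (i : nat * 'rV[rat]_a * rat) : set 'rV[R]_a :=
  [set z | `|z - map_mx ratr i.1.2| <= ratr i.2].
pose good (i : nat * 'rV[rat]_a * rat) := [/\ 0 < ratr i.2 :> R,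
  B i `<=` A i.1.1 & exists2 C, 0 < C & forall x y, B i x -> B i y ->
  `|phi i.1.1 x - phi i.1.1 y| <= C * `|x - y|].
(* Each integer codes at most one ball; the codes that stand for no good ball
   remove nothing. *)
pose F (k : nat) : set 'rV[R]_b := [set y | forall i, unpickle k = Some i ->
  good i -> ~ (phi i.1.1 @` B i) y].
have oF k : open (F k) /\ dense (F k).
  case e : (unpickle k) => [i|]; last first.
    have -> : F k = setT by apply/seteqP; split=> // y _ i; rewrite e.
    by split; [exact: openT | move=> O [y Oy] _; exists y].
  have [gi|ngi] := pselect (good i); last first.
    have -> : F k = setT.
      by apply/seteqP; split=> // y _ j; rewrite e => -[<-].
    by split; [exact: openT | move=> O [y Oy] _; exists y].
  have -> : F k = ~` (phi i.1.1 @` B i).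
    apply/seteqP; split=> y /=; first by move/(_ i e gi).
    by move=> H j; rewrite e => -[<-].
  have [q0 BA [C C0 lip]] := gi; split.
    apply: closed_openC; apply: compact_closed; first exact: norm_hausdorff.
    apply: continuous_compact.
      apply: continuous_in_subspaceT => x; rewrite inE => /BA.
      exact: vsmooth_on_continuous.
    apply: bounded_closed_compact; last exact: closed_norm_ball.
    exists (ratr i.2 + `|(map_mx ratr i.1.2 : 'rV[R]_a)|); split; first exact: num_real.
    move=> e' he z; rewrite /B /= => zq; rewrite (le_trans _ (ltW he)) //.
    by rewrite -[z](subrK (map_mx ratr i.1.2)) (le_trans (ler_normD _ _)) // lerD2r.
  move=> O [y Oy] oO; have [d d0 dO] := norm_ball_in oO Oy.
  have [y' yd Hy] := lipschitz_image_no_interior y ab q0 C0 d0 lip.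
  exists y'; split; first exact: dO.
  by move=> [x Bx e']; exact: Hy e'.
have [y [Qy Fy]] := Baire oF Q0 oQ.
have [k _ [x Ax e]] := cover y Qy.
have [r1 r10 [C C0 lip]] := smooth_lipschitz (oA k) Ax (sphi k).
have [r2 r20 r2A] := norm_ball_in (oA k) Ax.
have r0 : 0 < Num.min r1 r2 by rewrite lt_min r10.
have [c [q [q0 xq Hq]]] := rational_ball x r0.
have Hr z : B (k, c, q) z -> `|z - x| < r1 /\ A k z.
  move=> /Hq; rewrite lt_min => /andP[? ?]; split=> //; apply: r2A; exact: ltW.
have := Fy (pickle (k, c, q)) I (k, c, q) (pickleK _); apply.
  split=> // [z /Hr[]//|]; exists C => // z z' /Hr[? _] /Hr[? _]; exact: lip.
by exists x.
Qed.

End SmallImages.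

(** * Smooth maps between manifolds *)

Section SmoothMaps.
Context {R : realType}.

Lemma open_preimage_in (S T : topologicalType) (U : set S) (F : S -> T) D :
  open U -> (forall x, U x -> {for x, continuous F}) -> open D ->
  open (U `&` F @^-1` D).
Proof.
move=> oU cF oD; rewrite openE => x [Ux Dx].
apply: filterI; first exact: open_nbhs_nbhs.
by apply: (cF x Ux); exact: open_nbhs_nbhs.
Qed.

Lemma open_chart_image n (T : topologicalType) (c : @chart R T n) B :
  open B -> open (c @` (dom c `&` B)).
Proof.
move=> oB; have -> : c @` (dom c `&` B) = c @` dom c `&` chart_inv c @^-1` B.
  apply/seteqP; split=> [_ [x [cx Bx] <-]|_ [[x cx <-]]].
    by split; [exists x | rewrite /= chartK].
  by rewrite /= chartK // => Bx; exists x.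
apply: open_preimage_in => //; first exact: cod_open.
exact: chart_inv_continuous.
Qed.

Arguments open_chart_image {n T} c {B}.

Lemma chart_invP n (T : topologicalType) (c : @chart R T n) y :
  (c @` dom c) y -> dom c (chart_inv c y) /\ c (chart_inv c y) = y.
Proof. by move=> [x cx <-]; rewrite chartK. Qed.

Lemma smooth_map_sub m n (M : manifold R m) (N : manifold R n) (U U' : set M)
    (F : M -> N) : U `<=` U' -> smooth_map U' F -> smooth_map U F.
Proof.
move=> UU' [cF sF]; split=> [x /UU'/cF//|c d Ac Ad].
apply: vsmooth_on_sub (sF c d Ac Ad) => _ [x [[cx Ux] dx] <-].
by exists x => //; split=> //; split=> //; exact: UU'.
Qed.

(** The definition quantifies over all pairs of charts. The transition maps are
    smooth, so one pair of charts around each point is enough. *)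
Lemma smooth_map_local m n (M : manifold R m) (N : manifold R n) (U : set M)
    (F : M -> N) : open U -> (forall x, U x -> {for x, continuous F}) ->
  (forall x, U x -> exists c d (B : set 'rV[R]_m),
     [/\ atlas c, atlas d, dom c x, dom d (F x) &
         [/\ open B, B (c x) & vsmooth_on B (d \o F \o chart_inv c)]]) ->
  smooth_map U F.
Proof.
move=> oU cF loc; split=> // c' d' Ac' Ad' j; apply: smooth_on_loc.
move=> _ [x [[cx' Ux] dx'] <-].
have [c [d [B [Ac Ad cx dx [oB Bx sF]]]]] := loc x Ux.
pose D := U `&` F @^-1` (dom d `&` dom d').
have oD : open D.
  by apply: open_preimage_in => //; apply: openI; exact: dom_open.
pose E := (D `&` dom c) `&` (dom c `&` c @^-1` B).
have oE : open E.
  apply: openI; first by apply: openI => //; exact: dom_open.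
  by apply: open_preimage_in oB; [exact: dom_open | move=> y; exact: chart_continuous].
exists (c' @` (dom c' `&` E)); split.
- exact: open_chart_image.
- by exists x.
pose B1 := B `&` c @` (dom c `&` E).
have oB1 : open B1 by apply: openI => //; exact: open_chart_image.
pose B2 := d @` (dom d `&` dom d').
have oB2 : open B2 by apply: open_chart_image; exact: dom_open.
have s1 : vsmooth_on (c' @` (dom c' `&` E)) (c \o chart_inv c').
  apply: vsmooth_on_sub (atlas_compat Ac' Ac) => _ [y [cy' [[_ cy] _]] <-].
  by exists y.
have s2 : vsmooth_on B1 (d \o F \o chart_inv c).
  by apply: vsmooth_on_sub sF => y [].
have s3 : vsmooth_on B2 (d' \o chart_inv d) := atlas_compat Ad Ad'.
have m1 y : (c' @` (dom c' `&` E)) y -> B1 ((c \o chart_inv c') y).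
  move=> [z [cz' Ez] <-] /=; rewrite chartK //; case: (Ez) => [[_ cz] [_ Bz]].
  by split=> //; exists z.
have m2 y : B1 y -> B2 ((d \o F \o chart_inv c) y).
  by move=> [_ [z [cz [[[_ [dz dz']] _] _]] <-]] /=; rewrite chartK //; exists (F z).
have oE' := open_chart_image c' oE.
have s12 := vsmooth_on_comp oE' oB1 m1 s1 s2.
have s123 := vsmooth_on_comp oE' oB2 (fun y h => m2 _ (m1 y h)) s12 s3.
move: j; apply: vsmooth_on_eq oE' _ s123 => y; rewrite inE.
move=> [z [cz' [[[_ [dz dz']] cz] _]] <-] /=.
by rewrite (chartK cz') (chartK cz) (chartK dz).
Qed.

Lemma smooth_open_preimage m n (M : manifold R m) (N : manifold R n)
    (U : set M) (F : M -> N) (D : set N) :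
  open U -> smooth_map U F -> open D -> open (U `&` F @^-1` D).
Proof. by move=> oU [cF _]; exact: open_preimage_in. Qed.

Lemma smooth_map_comp m n p (M : manifold R m) (N : manifold R n)
    (P : manifold R p) (U : set M) (U' : set N) (F : M -> N) (H : N -> P) :
  open U -> open U' -> (forall x, U x -> U' (F x)) ->
  smooth_map U F -> smooth_map U' H -> smooth_map U (H \o F).
Proof.
move=> oU oU' UU' [cF sF] [cH sH].
have cHF x : U x -> {for x, continuous (H \o F)}.
  by move=> Ux; apply: continuous_comp; [exact: cF | apply: cH; exact: UU'].
apply: smooth_map_local => // x Ux.
have [c Ac cx] := atlas_cover x; have [d Ad dx] := atlas_cover (F x).
have [e Ae ex] := atlas_cover (H (F x)).
pose E2 := U' `&` H @^-1` dom e.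
have oE2 : open E2 by apply: open_preimage_in => //; exact: dom_open.
pose E1 := U `&` F @^-1` (E2 `&` dom d).
have oE1 : open E1.
  by apply: open_preimage_in => //; apply: openI => //; exact: dom_open.
exists c, e, (c @` (dom c `&` E1)); split=> //; split.
- exact: open_chart_image.
- by exists x => //; split=> //; split=> //; split=> //; split=> //; exact: UU'.
have s1 : vsmooth_on (c @` (dom c `&` E1)) (d \o F \o chart_inv c).
  apply: vsmooth_on_sub (sF c d Ac Ad) => _ [y [cy [Uy [_ dy]]] <-].
  by exists y.
have s2 : vsmooth_on (d @` (dom d `&` E2)) (e \o H \o chart_inv d).
  apply: vsmooth_on_sub (sH d e Ad Ae) => _ [y [dy [Uy ey]] <-].
  by exists y.
have oE1' := open_chart_image c oE1.
have m1 y : (c @` (dom c `&` E1)) y ->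
    (d @` (dom d `&` E2)) ((d \o F \o chart_inv c) y).
  by move=> [z [cz [Uz [E2z dz]]] <-] /=; rewrite chartK //; exists (F z).
apply: vsmooth_on_eq oE1' _ (vsmooth_on_comp oE1' (open_chart_image d oE2) m1 s1 s2).
move=> y; rewrite inE => -[z [cz [Uz [E2z dz]]] <-] /=.
by rewrite (chartK cz) (chartK dz).
Qed.

Lemma smooth_map_id m (M : manifold R m) (U : set M) : open U ->
  smooth_map U (fun x : M => x).
Proof.
move=> oU; apply: smooth_map_local => // [x _|x Ux]; first exact: cvg_id.
have [c Ac cx] := atlas_cover x; exists c, c, (c @` dom c).
have oc : open (c @` dom c) by exact: cod_open.
split=> //; split=> //; try by exists x.
apply: vsmooth_on_eq oc _ (@vsmooth_id R m _) => y; rewrite inE => -[z cz <-] /=.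
by rewrite chartK.
Qed.

Lemma smooth_map_cst m n (M : manifold R m) (N : manifold R n) (U : set M)
    (a : N) : open U -> smooth_map U (fun x : M => a).
Proof.
move=> oU; apply: smooth_map_local => // [x _|x Ux]; first exact: cvg_cst.
have [c Ac cx] := atlas_cover x; have [d Ad dx] := atlas_cover a.
exists c, d, setT; split=> //; split=> //; first exact: openT.
by move=> j; exact: smooth_on_cst.
Qed.

Lemma smooth_map_euclid m n (U : set 'rV[R]_m) (F : 'rV[R]_m -> 'rV[R]_n) :
  open U -> vsmooth_on U F <-> smooth_map (U : set (euclid R m)) (F : _ -> euclid R n).
Proof.
move=> oU; split=> [sF|[_ /(_ (euclid_chart m) (euclid_chart n) erefl erefl)]].
  apply: smooth_map_local => // [x Ux|x Ux].
    exact: vsmooth_on_continuous sF Ux.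
  by exists (euclid_chart m), (euclid_chart n), U.
apply: vsmooth_on_sub => x Ux; exists x => //.
Qed.

Lemma smooth_chart m (M : manifold R m) (c : chart M m) : atlas c ->
  smooth_map (dom c) (c : M -> euclid R m).
Proof.
move=> Ac; apply: smooth_map_local => [|x cx|x cx]; first exact: dom_open.
  exact: chart_continuous.
exists c, (euclid_chart m), (c @` dom c).
have oc : open (c @` dom c) by exact: cod_open.
split=> //; split=> //; try by exists x.
apply: vsmooth_on_eq oc _ (@vsmooth_id R m _) => y; rewrite inE => -[z cz <-] /=.
by rewrite chartK.
Qed.

Lemma smooth_chart_inv m (M : manifold R m) (c : chart M m) : atlas c ->
  smooth_map (c @` dom c : set (euclid R m)) (chart_inv c : euclid R m -> M).
Proof.
move=> Ac; have oc : open (c @` dom c) by exact: cod_open.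
apply: smooth_map_local => // [x cx|_ [x cx <-]].
  exact: chart_inv_continuous.
exists (euclid_chart m), c, (c @` dom c).
split=> //; first by rewrite chartK.
split=> //; try by exists x.
apply: vsmooth_on_eq oc _ (@vsmooth_id R m _) => y; rewrite inE => -[z cz <-] /=.
by rewrite chartK.
Qed.

Lemma smooth_map_pair m n p (M : manifold R m) (N : manifold R n)
    (P : manifold R p) (U : set M) (F : M -> N) (H : M -> P) :
  open U -> smooth_map U F -> smooth_map U H ->
  smooth_map U (fun x => (F x, H x) : mprod N P).
Proof.
move=> oU [cF sF] [cH sH]; apply: smooth_map_local => // [x Ux|x Ux].
  exact: cvg_pair (cF x Ux) (cH x Ux).
have [c Ac cx] := atlas_cover x; have [d Ad dx] := atlas_cover (F x).
have [e Ae ex] := atlas_cover (H x).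
pose E := (U `&` F @^-1` dom d) `&` (U `&` H @^-1` dom e).
have oE : open E by apply: openI; apply: open_preimage_in => //; exact: dom_open.
have oE' := open_chart_image c oE.
exists c, (prod_chart d e), (c @` (dom c `&` E)); split=> //.
  by exists d, e.
split=> //; try by exists x.
move=> j; rewrite -[j]fintype.splitK; case: (fintype.split j) => k /=.
  apply: smooth_on_eq oE' _ (smooth_on_sub _ (sF c d Ac Ad k)).
    by move=> y _; rewrite /= /prod_map row_mxEl.
  by move=> _ [z [cz [[Uz dz] _]] <-]; exists z.
apply: smooth_on_eq oE' _ (smooth_on_sub _ (sH c e Ac Ae k)).
  by move=> y _; rewrite /= /prod_map row_mxEr.
by move=> _ [z [cz [_ [Uz ez]]] <-]; exists z.
Qed.

Lemma vsmooth_lsubmx m n (A : set 'rV[R]_(m + n)) : vsmooth_on A (@lsubmx R 1 m n).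
Proof.
move=> j s x Ax; have := @smooth_on_coord R _ A (lshift n j) s x Ax.
rewrite (_ : (fun _ => _) = (fun x => lsubmx x ord0 j)) //.
by apply/funext => y; rewrite mxE.
Qed.

Lemma vsmooth_rsubmx m n (A : set 'rV[R]_(m + n)) : vsmooth_on A (@rsubmx R 1 m n).
Proof.
move=> j s x Ax; have := @smooth_on_coord R _ A (rshift m j) s x Ax.
rewrite (_ : (fun _ => _) = (fun x => rsubmx x ord0 j)) //.
by apply/funext => y; rewrite mxE.
Qed.

Lemma smooth_map_snd m n (M : manifold R m) (N : manifold R n)
  (U : set (mprod M N)) : open U -> smooth_map U (snd : mprod M N -> N).
Proof.
move=> oU; apply: smooth_map_local => // [[x y] _|x Ux]; first exact: cvg_snd.
have [c Ac cx] := atlas_cover x.1; have [d Ad dx] := atlas_cover x.2.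
pose e := prod_chart c d; have oe : open (e @` dom e) by exact: cod_open.
exists e, d, (e @` dom e); split=> //; first by exists c, d.
split=> //; try by exists x.
apply: (@vsmooth_on_eq R _ _ _ (@rsubmx R 1 m n)) => //; last exact: vsmooth_rsubmx.
move=> y; rewrite inE => -[z [cz dz] <-].
by rewrite /= /prod_map row_mxKr chartK.
Qed.

Lemma scalar_rV1E (a : R) (j : 'I_1) : (a%:M : 'rV[R]_1) ord0 j = a.
Proof. by rewrite (ord1 j) mxE. Qed.

(** Smooth functions and smooth maps are defined separately; this transfers
    composition and locality from maps to functions. *)
Lemma msmooth_map m (M : manifold R m) (U : set M) (f : M -> R) : open U ->
  msmooth U f <-> smooth_map U (fun x => (f x)%:M : euclid R 1).
Proof.
move=> oU; split=> [sf|[_ sf] c Ac].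
  have cf x : U x -> {for x, continuous f}.
    move=> Ux; have [c Ac cx] := atlas_cover x.
    have cs : {for c x, continuous (f \o chart_inv c)}.
      by apply: smooth_on_continuous (sf c Ac) _; exists x.
    have cc := continuous_comp (chart_continuous cx) cs.
    apply: near_eq_continuous cc.
    have : nbhs x (dom c) by apply: open_nbhs_nbhs; split=> //; exact: dom_open.
    by apply: filterS => y cy /=; rewrite chartK.
  apply: smooth_map_local => // [x Ux|x Ux].
    apply: continuous_rV => j; apply: near_eq_continuous (cf x Ux).
    by apply: nearW => y; rewrite scalar_rV1E.
  have [c Ac cx] := atlas_cover x; have oc := open_chart_image c oU.
  exists c, (euclid_chart 1), (c @` (dom c `&` U)); split=> //; split=> //.
    by exists x.
  move=> j; apply: smooth_on_eq oc _ (sf c Ac) => y _.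
  by rewrite /= scalar_rV1E.
apply: smooth_on_eq (open_chart_image c oU) _ (smooth_on_sub _
  (sf c (euclid_chart 1) Ac erefl ord0)) => [y _|].
  by rewrite /= scalar_rV1E.
by move=> _ [z [cz Uz] <-]; exists z.
Qed.

Lemma msmooth_comp m n (M : manifold R m) (N : manifold R n) (U : set M)
    (U' : set N) (F : M -> N) (f : N -> R) : open U -> open U' ->
  (forall x, U x -> U' (F x)) -> smooth_map U F -> msmooth U' f ->
  msmooth U (f \o F).
Proof.
move=> oU oU' UU' sF /(msmooth_map _ oU') sf; apply/(msmooth_map _ oU).
exact: smooth_map_comp oU oU' UU' sF sf.
Qed.

Lemma msmooth_euclid m (U : set 'rV[R]_m) (f : 'rV[R]_m -> R) :
  smooth_on U f <-> msmooth (U : set (euclid R m)) f.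
Proof.
split=> [sf _ ->|/(_ (euclid_chart m) erefl)].
  by apply: smooth_on_sub sf => _ [x [_ Ux] <-].
by apply: smooth_on_sub => x Ux; exists x.
Qed.

Lemma msmooth_continuous m (M : manifold R m) (U : set M) f x : open U ->
  msmooth U f -> U x -> {for x, continuous f}.
Proof.
move=> oU /(msmooth_map f oU) [cf _] /cf cx; move: (continuous_coord (j := ord0) cx).
by apply: near_eq_continuous; apply: nearW => y; rewrite scalar_rV1E.
Qed.

Lemma msmooth_sub m (M : manifold R m) (U U' : set M) f :
  U `<=` U' -> msmooth U' f -> msmooth U f.
Proof.
move=> UU' sf c Ac; apply: smooth_on_sub (sf c Ac) => _ [x [cx Ux] <-].
by exists x => //; split=> //; exact: UU'.
Qed.

Lemma msmooth_loc m (M : manifold R m) (U : set M) f :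
  (forall x, U x -> exists B, [/\ open B, B x & msmooth B f]) -> msmooth U f.
Proof.
move=> H c Ac; apply: smooth_on_loc => _ [x [cx Ux] <-].
have [B [oB Bx sf]] := H x Ux; exists (c @` (dom c `&` B)).
by split; [exact: open_chart_image | exists x | exact: sf].
Qed.

Lemma msmooth_eq m (M : manifold R m) (U : set M) f g : open U ->
  {in U, f =1 g} -> msmooth U f -> msmooth U g.
Proof.
move=> oU fg sf c Ac.
apply: smooth_on_eq (open_chart_image c oU) _ (sf c Ac).
by move=> y; rewrite inE => -[z [cz Uz] <-] /=; rewrite chartK // fg // inE.
Qed.

Lemma msmoothM m (M : manifold R m) (U : set M) f g : open U ->
  msmooth U f -> msmooth U g -> msmooth U (fun x => f x * g x).
Proof.
move=> oU sf sg c Ac.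
exact: smooth_onM (open_chart_image c oU) (sf c Ac) (sg c Ac).
Qed.

Lemma msmoothB m (M : manifold R m) (U : set M) f g : open U ->
  msmooth U f -> msmooth U g -> msmooth U (fun x => f x - g x).
Proof.
move=> oU sf sg c Ac.
exact: smooth_onB (open_chart_image c oU) (sf c Ac) (sg c Ac).
Qed.

Lemma msmoothD m (M : manifold R m) (U : set M) f g : open U ->
  msmooth U f -> msmooth U g -> msmooth U (fun x => f x + g x).
Proof.
move=> oU sf sg c Ac.
exact: smooth_onD (open_chart_image c oU) (sf c Ac) (sg c Ac).
Qed.

Lemma msmooth_cst m (M : manifold R m) (U : set M) a : msmooth U (cst a).
Proof. by move=> c Ac; exact: smooth_on_cst. Qed.

End SmoothMaps.

Arguments open_chart_image {R n T} c {B}.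

(** * Orbit maps of a local action *)

Section Jacobians.
Context {R : realType}.

Definition mjac m n (M : manifold R m) (N : manifold R n) (F : M -> N)
  (c : @chart R M m) (d : @chart R N n) (x : M) :=
  jac (d \o F \o chart_inv c : 'rV[R]_m -> 'rV[R]_n) (c x).

Lemma nbhs_chart m (M : manifold R m) (c : @chart R M m) x (A : set M) :
  dom c x -> nbhs x A -> nbhs (c x) (chart_inv c @^-1` A).
Proof.
move=> cx Ax; have : {for c x, continuous (chart_inv c)}.
  by apply: chart_inv_continuous; exists x.
by apply; rewrite chartK.
Qed.

Lemma mjac_near m n (M : manifold R m) (N : manifold R n) (F H : M -> N)
    (c : @chart R M m) (d : @chart R N n) x : dom c x -> {near x, F =1 H} ->
  mjac F c d x = mjac H c d x.
Proof.
move=> cx FH; apply: jac_near; have := nbhs_chart cx FH.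
by apply: filterS => y /= ->.
Qed.

Lemma mjac_comp m n p (M : manifold R m) (N : manifold R n) (P : manifold R p)
    (U : set M) (U' : set N) (F : M -> N) (H : N -> P) c d e x :
  atlas c -> atlas d -> atlas e -> open U -> open U' ->
  dom c x -> dom d (F x) -> dom e (H (F x)) -> U x -> U' (F x) ->
  smooth_map U F -> smooth_map U' H ->
  mjac (H \o F) c e x = mjac F c d x *m mjac H d e (F x).
Proof.
move=> Ac Ad Ae oU oU' cx dx ex Ux Ux' sF sH.
have [cF sF'] := sF; have [cH sH'] := sH.
have oB : open (d @` (dom d `&` (U' `&` H @^-1` dom e))).
  by apply: open_chart_image; apply: open_preimage_in => //; exact: dom_open.
have sH2 : vsmooth_on (d @` (dom d `&` (U' `&` H @^-1` dom e))) (e \o H \o chart_inv d).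
  apply: vsmooth_on_sub (sH' d e Ad Ae) => _ [y [dy [Uy ey]] <-].
  by exists y.
have pE : (d \o F \o chart_inv c) (c x) = d (F x) by rewrite /= chartK.
rewrite /mjac -[in RHS]pE -(jac_comp oB _ _ (sF' c d Ac Ad) sH2).
- apply: jac_near.
  have oE : open (U `&` F @^-1` dom d).
    by apply: open_preimage_in => //; exact: dom_open.
  have : nbhs (c x) (chart_inv c @^-1` (U `&` F @^-1` dom d)).
    by apply: nbhs_chart cx _; exact: open_nbhs_nbhs.
  by apply: filterS => y [/= _ dy]; rewrite chartK.
- by exists x.
- by rewrite pE; exists (F x).
Qed.

Lemma mjac_cst m n (M : manifold R m) (N : manifold R n) (F : M -> N) (a : N)
    (c : @chart R M m) (d : @chart R N n) x : dom c x -> {near x, F =1 cst a} ->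
  mjac F c d x = 0.
Proof.
move=> cx Fa; rewrite (mjac_near _ cx Fa); apply/matrixP => i j.
by rewrite !mxE; exact: (derive_cst (d a ord0 j)).
Qed.

End Jacobians.

Section Group.
Context {R : realType} {d : nat} {G : lie_group R d}.
Implicit Types g h k : G.

Lemma lmulK g h : lmul (linv h) (lmul h g) = g.
Proof. by rewrite lmulA lmulV lmul1. Qed.

Lemma lmulgV g : lmul g (linv g) = lone G.
Proof. by rewrite -[LHS](lmulK _ (linv g)) (lmulK (linv g) g) lmulV. Qed.

Lemma lmulg1 g : lmul g (lone G) = g.
Proof. by rewrite -(lmulV g) lmulA lmulgV lmul1. Qed.

Lemma lmulgKV g h : lmul (lmul g (linv h)) h = g.
Proof. by rewrite -lmulA lmulV lmulg1. Qed.

Lemma cts_mul (T : topologicalType) (F H : T -> G) t :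
  {for t, continuous F} -> {for t, continuous H} ->
  {for t, continuous (fun t => lmul (F t) (H t))}.
Proof.
move=> cF cH; have [cm _] := lmul_smooth G.
exact: cvg_comp (cvg_pair cF cH) (cm (F t, H t) I).
Qed.

Lemma smooth_map_mul m (M : manifold R m) (U : set M) (F H : M -> G) :
  open U -> smooth_map U F -> smooth_map U H ->
  smooth_map U (fun x => lmul (F x) (H x)).
Proof.
move=> oU sF sH.
exact: smooth_map_comp oU openT (fun _ _ => I) (smooth_map_pair oU sF sH)
  (lmul_smooth G).
Qed.

End Group.

Section Action.
Context {R : realType} {d n : nat} {G : lie_group R d} {X : manifold R n}.
Context {V : set (mprod G X)} {Psi : mprod G X -> X}.
Hypothesis LA : local_action V Psi.

Lemma act_near (T : topologicalType) (F : T -> G) (H : T -> X) t :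
  {for t, continuous F} -> {for t, continuous H} -> V (F t, H t) ->
  \forall t' \near t, V (F t', H t').
Proof.
move=> cF cH Vt; have nV : nbhs ((F t, H t) : mprod G X) V.
  by apply: open_nbhs_nbhs; split=> //; exact: la_open LA.
exact: (cvg_pair cF cH) nV.
Qed.

Lemma cts_act (T : topologicalType) (F : T -> G) (H : T -> X) t :
  {for t, continuous F} -> {for t, continuous H} -> V (F t, H t) ->
  {for t, continuous (fun t => Psi (F t, H t))}.
Proof.
move=> cF cH Vt; have [cP _] := la_smooth LA.
exact: cvg_comp (cvg_pair cF cH) (cP _ Vt).
Qed.

Lemma smooth_map_act m (M : manifold R m) (U : set M) (F : M -> G) (H : M -> X) :
  open U -> smooth_map U F -> smooth_map U H -> (forall x, U x -> V (F x, H x)) ->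
  smooth_map U (fun x => Psi (F x, H x)).
Proof.
move=> oU sF sH VU.
exact: smooth_map_comp oU (la_open LA) VU (smooth_map_pair oU sF sH)
  (la_smooth LA).
Qed.

Definition act_dom (x : X) : set G := [set g | V (g, x)].

Lemma open_act_dom x : open (act_dom x).
Proof.
rewrite openE => g Vg.
by apply: (@act_near G id (cst x) g) => //; exact: cst_continuous.
Qed.

Lemma smooth_orbit_map x : smooth_map (act_dom x) (fun g : G => Psi (g, x)).
Proof.
apply: smooth_map_act => //; first exact: open_act_dom.
  by apply: smooth_map_id; exact: open_act_dom.
by apply: smooth_map_cst; exact: open_act_dom.
Qed.

Definition pt_dom (g : G) : set X := [set x | V (g, x)].

Lemma open_pt_dom g : open (pt_dom g).
Proof.
rewrite openE => x Vx.
by apply: (@act_near X (cst g) id x) => //; exact: cst_continuous.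
Qed.

Lemma smooth_pt_map g : smooth_map (pt_dom g) (fun x : X => Psi (g, x)).
Proof.
apply: smooth_map_act => //; first exact: open_pt_dom.
  by apply: smooth_map_cst; exact: open_pt_dom.
by apply: smooth_map_id; exact: open_pt_dom.
Qed.

(** The law of an action is only required where its three terms make sense.
    The domain is open, so it is enough that they do at one point. *)
Lemma act_mul_near (T : topologicalType) (F H : T -> G) (Z : T -> X) t :
  {for t, continuous F} -> {for t, continuous H} -> {for t, continuous Z} ->
  V (H t, Z t) -> V (F t, Psi (H t, Z t)) -> V (lmul (F t) (H t), Z t) ->
  \forall t' \near t,
    Psi (F t', Psi (H t', Z t')) = Psi (lmul (F t') (H t'), Z t').
Proof.
move=> cF cH cZ V1 V2 V3.
have n1 := act_near cH cZ V1.
have n2 := act_near cF (cts_act cH cZ V1) V2.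
have n3 := act_near (cts_mul cF cH) cZ V3.
apply: filterS (filterI n1 (filterI n2 n3)) => t' [v1 [v2 v3]].
exact: la_mul LA _ _ _ v1 v2 v3.
Qed.

(** The pair [(lmul g h, y)] may be outside the domain, so that two steps cannot
    be replaced by one. But two pairs of close steps lead to points that differ
    by one element [q p] close to the identity: this is how the countable basis
    of the group controls orbits. *)
Lemma act_chain g h y : V (h, y) -> V (g, Psi (h, y)) ->
  let z := Psi (g, Psi (h, y)) in
  let q (p : G * G) := lmul (lmul p.1 (lmul p.2 (linv h))) (linv g) in
  [/\ q (g, h) = lone G, {for (g, h), continuous q} &
      \forall p \near (g, h), Psi (p.1, Psi (p.2, y)) = Psi (q p, z)].
Proof.
move=> Vh Vg z q; set w := Psi (h, y) in Vg z *.
pose t : G * G := (g, h).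
have c1 : {for t, continuous (fst : G * G -> G)} by exact: cvg_fst.
have c2 : {for t, continuous (snd : G * G -> G)} by exact: cvg_snd.
have cc (T : topologicalType) (a : T) : {for t, continuous (fun _ : G * G => a)}.
  exact: cvg_cst.
have cm : {for t, continuous (fun p : G * G => lmul p.2 (linv h))}.
  by apply: cts_mul => //; exact: cc.
have cgm : {for t, continuous (fun p : G * G => lmul p.1 (lmul p.2 (linv h)))}.
  exact: cts_mul.
have qe : q t = lone G by rewrite /q /= lmulgV lmulg1 lmulgV.
have cq : {for t, continuous q} by apply: cts_mul => //; exact: cc.
split=> //.
have V0 : V (lmul t.2 (linv h), w) by rewrite /= lmulgV; exact: la_mem1 LA _.
have n1 : \forall p \near t, Psi (lmul p.2 (linv h), w) = Psi (p.2, y).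
  have V3 : V (lmul (lmul t.2 (linv h)) h, y) by rewrite lmulgKV.
  have N := act_mul_near cm (cc _ h) (cc _ y) Vh V0 V3.
  by apply: filterS N => p ->; rewrite lmulgKV.
have n2 : \forall p \near t, Psi (p.1, Psi (lmul p.2 (linv h), w)) =
    Psi (lmul p.1 (lmul p.2 (linv h)), w).
  apply: act_mul_near c1 cm (cc _ w) V0 _ _.
    by rewrite /= lmulgV (la_one LA).
  by rewrite /= lmulgV lmulg1.
have n3 : \forall p \near t, Psi (q p, Psi (g, w)) = Psi (lmul (q p) g, w).
  apply: (act_mul_near cq (cc _ g) (cc _ w)) => //.
    by rewrite qe; exact: la_mem1 LA _.
  by rewrite qe lmul1.
apply: filterS (filterI n1 (filterI n2 n3)) => p [<- [-> /= ->]].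
by rewrite /q lmulgKV.
Qed.

Definition orbit_jac (cG : @chart R G d) (c : @chart R X n) (x : X) : 'M[R]_(d, n) :=
  mjac (fun g : G => Psi (g, x)) cG c (lone G).

(** Near the identity, the orbit map of [Psi (g, x)] is that of [x] preceded by
    a conjugation and followed by the action of [g]. Ranks of
    products of matrices are at most those of the factors. *)
Lemma orbit_jac_rank cG c c' g x : atlas cG -> dom cG (lone G) ->
  atlas c -> atlas c' -> V (g, x) -> dom c x -> dom c' (Psi (g, x)) ->
  (\rank (orbit_jac cG c' (Psi (g, x))) <= \rank (orbit_jac cG c x))%N.
Proof.
move=> AG eG Ac Ac' Vg cx cgx; set e := lone G.
have cid : {for e, continuous (fun k : G => k)} by exact: cvg_id.
have cc (T : topologicalType) (a : T) : {for e, continuous (fun _ : G => a)}.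
  exact: cvg_cst.
pose conj k := lmul (lmul (linv g) k) g.
have ce : conj e = e by rewrite /conj lmulg1 lmulV.
have sconj : smooth_map setT conj.
  apply: smooth_map_mul; [exact: openT| |exact/smooth_map_cst/openT].
  apply: smooth_map_mul; [exact: openT|exact/smooth_map_cst/openT|].
  exact/smooth_map_id/openT.
have cconj : {for e, continuous conj} by apply: cts_mul => //; apply: cts_mul.
have E : {near e, (fun k => Psi (k, Psi (g, x))) =1
    (fun x => Psi (g, x)) \o ((fun k => Psi (k, x)) \o conj)}.
  have n1 := act_mul_near cid (cc _ g) (cc _ x) Vg.
  have {}n1 : \forall k \near e, Psi (k, Psi (g, x)) = Psi (lmul k g, x).
    by apply: n1; [exact: la_mem1 LA _ | rewrite /e lmul1].
  have n2 := act_mul_near (cc _ g) cconj (cc _ x).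
  have {}n2 : \forall k \near e,
      Psi (g, Psi (conj k, x)) = Psi (lmul g (conj k), x).
    apply: n2; rewrite ce.
    - exact: la_mem1 LA _.
    - by rewrite (la_one LA).
    - by rewrite lmulg1.
  apply: filterS (filterI n1 n2) => k [-> /= ->].
  by rewrite /conj !lmulA lmulgV lmul1.
rewrite /orbit_jac (mjac_near _ eG E).
have xe : Psi (e, x) = x := la_one LA x.
have oD : open ([set: G] `&` conj @^-1` act_dom x).
  apply: open_preimage_in; [exact: openT| by have [] := sconj |].
  exact: open_act_dom.
have sc : smooth_map ([set: G] `&` conj @^-1` act_dom x)
    ((fun k => Psi (k, x)) \o conj).
  apply: (smooth_map_comp oD (open_act_dom x)).
  - by move=> k [].
  - exact: smooth_map_sub sconj.
  - exact: smooth_orbit_map.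
rewrite (@mjac_comp _ _ _ _ _ _ _ ([set: G] `&` conj @^-1` act_dom x) (pt_dom g)
  _ _ cG c c') //=; last first.
- exact: smooth_pt_map.
- by rewrite ce xe.
- by split=> //; rewrite /= ce; exact: la_mem1 LA _.
- by rewrite ce xe.
- by rewrite ce xe.
- exact: open_pt_dom.
rewrite (@mjac_comp _ _ _ _ _ _ _ [set: G] (act_dom x) _ _ cG cG c) //=; last first.
- exact: smooth_orbit_map.
- by rewrite ce; exact: la_mem1 LA _.
- by rewrite ce xe.
- by rewrite ce.
- exact: open_act_dom.
- exact: openT.
by rewrite ce (leq_trans (mxrankM_maxl _ _)) // mxrankM_maxr.
Qed.

End Action.

(** * Flow boxes *)

Section LinearAlgebra.
Context {R : realType}.

Lemma mx_norm_ltP n (x : 'rV[R]_n) e :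
  0 < e -> (`|x| < e) <-> forall j, `|x ord0 j| < e.
Proof.
move=> e0; rewrite [`|x|]/Num.norm /= mx_normrE; split => [/bigmax_ltP[_ H] j|H].
  exact: (H (ord0, j)).
by apply/bigmax_ltP; split=> // -[i j] _; rewrite /= ord1.
Qed.

Lemma norm_row_mx_lt m n (a : 'rV[R]_m) (b : 'rV[R]_n) e :
  0 < e -> (`|row_mx a b| < e) = (`|a| < e) && (`|b| < e).
Proof.
move=> e0; apply/idP/andP => [/(mx_norm_ltP _ e0) H|[/(mx_norm_ltP _ e0) Ha
    /(mx_norm_ltP _ e0) Hb]].
  by split; apply/(mx_norm_ltP _ e0) => j; [have := H (lshift n j)|
    have := H (rshift m j)]; rewrite ?row_mxEl ?row_mxEr.
apply/(mx_norm_ltP _ e0) => j; rewrite -[j]fintype.splitK.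
by case: (fintype.split j) => k /=; rewrite ?row_mxEl ?row_mxEr.
Qed.

Lemma row_split m n (w : 'rV[R]_(m + n)) : w = row_mx (lsubmx w) (rsubmx w).
Proof. by rewrite hsubmxK. Qed.

Lemma norm_sub_lt m n (w : 'rV[R]_(m + n)) e : 0 < e ->
  (`|w| < e) = (`|lsubmx w| < e) && (`|rsubmx w| < e).
Proof. by move=> e0; rewrite {1}(row_split w) norm_row_mx_lt. Qed.

(** The explicit inverse [L] is the one that [inverse_function] expects. *)
Lemma complete_basis r n (E : 'M[R]_(r, n)) : row_free E ->
  exists (K : 'M[R]_(n - r, n)) (L : 'M[R]_(n, r + (n - r))),
    col_mx E K *m L = 1%:M /\ L *m col_mx E K = 1%:M.
Proof.
move=> fE; have rE : \rank E = r by apply/eqP.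
have rn : (r <= n)%N by rewrite -rE rank_leq_col.
have : \rank (E^C)%MS = (n - r)%N by rewrite mxrank_compl rE.
have : ((E^C)%MS :=: row_base (E^C)%MS)%MS by apply/eqmx_sym; exact: eq_row_base.
move: (row_base _); move: (\rank _) => k K EK kE; subst k.
have full : row_full (col_mx E K).
  rewrite -sub1mx -addsmxE (adds_eqmx (eqmx_refl E) (eqmx_sym EK)).
  by rewrite sub1mx addsmx_compl_full.
have free : row_free (col_mx E K).
  by rewrite /row_free (eqP full) subnKC.
have [L LE] := row_fullP full; have [L' EL'] := row_freeP free.
exists K, L; split=> //.
by rewrite -[L]mulmx1 -EL' [L *m _]mulmxA LE mul1mx.
Qed.

Definition vball k (r : R) : set (euclid R k) := [set a : 'rV[R]_k | `|a| < r].

End LinearAlgebra.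

Arguments vball {R} k r _.

Lemma open_vball (R : realType) k (r : R) : open (vball k r).
Proof.
have -> : vball k r = [set y : 'rV[R]_k | `|y - 0| < r].
  by apply/seteqP; split=> y; rewrite /vball /= subr0.
exact: open_norm_ball.
Qed.

Section FlowBox.
Context {R : realType} {d n : nat} {G : lie_group R d} {X : manifold R n}.
Context {V : set (mprod G X)} {Psi : mprod G X -> X}.
Hypothesis LA : local_action V Psi.
Context {cG : @chart R G d}.
Hypotheses (AG : atlas cG) (eG : dom cG (lone G)).

(** A box around a point swept by the elements [fb_gam a] acting on a slice
    [fb_sec t] transverse to the orbits: [lsubmx] of [fb_inv] is the coordinate
    along the orbit, [rsubmx] of [fb_inv] the transverse one. *)
Record flowbox r k := Flowbox {
  fb_chart : @chart R X n;
  fb_rad : R;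
  fb_gam : euclid R r -> G;
  fb_sec : euclid R k -> X;
  fb_inv : X -> euclid R (r + k);
  fb_map := fun w : euclid R (r + k) => Psi (fb_gam (lsubmx w), fb_sec (rsubmx w));
  fb_box := fb_map @` vball (r + k) fb_rad;
  fb_rad_gt0 : 0 < fb_rad;
  fb_atlas : atlas fb_chart;
  fb_gam_smooth : smooth_map (vball r fb_rad) fb_gam;
  fb_sec_smooth : smooth_map (vball k fb_rad) fb_sec;
  fb_gam0 : fb_gam 0 = lone G;
  fb_dom : forall w, vball (r + k) fb_rad w ->
    V (fb_gam (lsubmx w), fb_sec (rsubmx w));
  fb_mapK : forall w, vball (r + k) fb_rad w -> fb_inv (fb_map w) = w;
  fb_open : open fb_box;
  fb_sub : fb_box `<=` dom fb_chart;
  fb_inv_smooth : smooth_map fb_box fb_inv }.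

(** Choose [M] so that the rows of [E = M *m J] are a basis of the tangent space
    of the orbit of [x0], and complete it by the rows of [K]. In charts, let the
    elements with coordinates [a *m M] act on the points with coordinates
    [t *m K]: the Jacobian at 0 of this map of [(a, t)] is [col_mx E K], so that
    it is a local diffeomorphism. No vector fields are integrated. *)
Lemma flowbox_exists x0 c r : atlas c -> dom c x0 ->
  \rank (orbit_jac (Psi := Psi) cG c x0) = r ->
  exists B : flowbox r (n - r), fb_chart B = c /\ fb_sec B 0 = x0.
Proof.
move=> Ac cx; set J := orbit_jac _ _ _ => rJ.
have [E [M EM] fE] : exists2 E : 'M[R]_(r, n), exists M, E = M *m J & row_free E.
  rewrite -rJ; exists (row_base J); last exact: row_base_free.
  by apply/submxP; rewrite eq_row_base.
have [K [L [EL LE]]] := complete_basis fE.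
set k := (n - r)%N in K L EL LE *.
pose fa (a : euclid R r) : euclid R d := (cG (lone G) : 'rV_d) + a *m M.
pose ft (t : euclid R k) : euclid R n := (c x0 : 'rV_n) + t *m K.
have sfa : smooth_map (setT : set (euclid R r)) fa.
  by apply/(smooth_map_euclid _ openT); exact: vsmooth_affine openT.
have sft : smooth_map (setT : set (euclid R k)) ft.
  by apply/(smooth_map_euclid _ openT); exact: vsmooth_affine openT.
pose gam a := chart_inv cG (fa a); pose sec t := chart_inv c (ft t).
have fa0 : fa 0 = cG (lone G) by rewrite /fa mul0mx addr0.
have ft0 : ft 0 = c x0 by rewrite /ft mul0mx addr0.
have gam0 : gam 0 = lone G by rewrite /gam fa0 chartK.
have sec0 : sec 0 = x0 by rewrite /sec ft0 chartK.
pose Da := setT `&` fa @^-1` (cG @` dom cG).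
pose Dt := setT `&` ft @^-1` (c @` dom c).
have oDa : open Da.
  exact: (@smooth_open_preimage _ _ _ _ _ setT fa _ openT sfa (@cod_open _ _ _ cG)).
have oDt : open Dt.
  exact: (@smooth_open_preimage _ _ _ _ _ setT ft _ openT sft (@cod_open _ _ _ c)).
have sgam : smooth_map Da gam.
  apply: (@smooth_map_comp _ _ _ _ _ _ _ Da (cG @` dom cG : set (euclid R d)) fa
    (chart_inv cG) oDa (@cod_open _ _ _ cG) _ _ (smooth_chart_inv AG)).
    by move=> a [].
  exact: smooth_map_sub sfa.
have ssec : smooth_map Dt sec.
  apply: (@smooth_map_comp _ _ _ _ _ _ _ Dt (c @` dom c : set (euclid R n)) ft
    (chart_inv c) oDt (@cod_open _ _ _ c) _ _ (smooth_chart_inv Ac)).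
    by move=> a [].
  exact: smooth_map_sub sft.
pose lsub (w : euclid R (r + k)) : euclid R r := lsubmx w.
pose rsub (w : euclid R (r + k)) : euclid R k := rsubmx w.
have sl A : open A -> smooth_map A lsub.
  by move=> oA; apply/(smooth_map_euclid _ oA); exact: vsmooth_lsubmx.
have sr A : open A -> smooth_map A rsub.
  by move=> oA; apply/(smooth_map_euclid _ oA); exact: vsmooth_rsubmx.
pose O1 := (setT `&` lsub @^-1` Da) `&` (setT `&` rsub @^-1` Dt).
have oO1 : open O1.
  apply: openI.
    exact: (@smooth_open_preimage _ _ _ _ _ setT lsub _ openT (sl _ openT) oDa).
  exact: (@smooth_open_preimage _ _ _ _ _ setT rsub _ openT (sr _ openT) oDt).
have sgl : smooth_map O1 (gam \o lsub).
  by apply: smooth_map_comp oO1 oDa _ (sl _ oO1) sgam => w [[]].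
have ssr : smooth_map O1 (sec \o rsub).
  by apply: smooth_map_comp oO1 oDt _ (sr _ oO1) ssec => w [_ []].
have spr := smooth_map_pair oO1 sgl ssr.
pose O2 := O1 `&` (fun w => ((gam \o lsub) w, (sec \o rsub) w) : mprod G X) @^-1` V.
have oO2 : open O2.
  exact: (smooth_open_preimage oO1 spr (la_open LA)).
pose Th (w : euclid R (r + k)) := Psi (gam (lsub w), sec (rsub w)).
have sTh : smooth_map O2 Th.
  by apply: (smooth_map_comp oO2 (la_open LA) _ (smooth_map_sub _ spr)
    (la_smooth LA)) => w [].
pose D0 := O2 `&` Th @^-1` dom c.
have oD0 : open D0.
  exact: (smooth_open_preimage oO2 sTh (dom_open c)).
have Th0 : Th 0 = x0.
  by rewrite /Th /lsub /rsub linear0 linear0 gam0 sec0 (la_one LA).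
have D00 : D0 0.
  split; last by rewrite /= Th0.
  split; last by rewrite /= /lsub /rsub linear0 linear0 gam0 sec0; exact: la_mem1 LA _.
  split; split=> //=; rewrite /lsub /rsub linear0; split=> //=.
    by rewrite fa0; exists (lone G).
  by rewrite ft0; exists x0.
pose phi (w : 'rV[R]_(r + k)) : 'rV[R]_n := c (Th w).
have sphi : vsmooth_on D0 phi.
  apply/(smooth_map_euclid _ oD0).
  apply: (smooth_map_comp oD0 (dom_open c) _ (smooth_map_sub _ sTh) (smooth_chart Ac)).
    by move=> w [].
  by move=> w [].
have jphi : jac phi 0 = col_mx E K.
  have ja : row_mx 1%:M 0 *m jac phi 0 = E.
    pose i (a : 'rV[R]_r) : 'rV[R]_(r + k) := a *m row_mx 1%:M 0.
    have i0 : i 0 = 0 by rewrite /i mul0mx.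
    have iE a : i a = row_mx a 0 by rewrite /i mul_mx_row mulmx1 mulmx0.
    have si := @vsmooth_linear R _ _ setT (row_mx 1%:M 0 : 'M[R]_(r, r + k)) openT.
    have <- : jac (phi \o i) 0 = row_mx 1%:M 0 *m jac phi 0.
      have Di0 : D0 (i 0) by rewrite i0.
      have := @jac_comp R _ _ _ setT D0 phi i 0 oD0 Logic.I Di0 si sphi.
      by rewrite i0 jac_linear.
    pose A0 := cG @` (dom cG `&` (act_dom (V := V) x0 `&`
      (fun g : G => Psi (g, x0)) @^-1` dom c)).
    have oA0 : open A0.
      apply: open_chart_image; apply: open_preimage_in;
        [exact: open_act_dom LA x0| |exact: dom_open].
      by have [] := smooth_orbit_map LA x0.
    have sA0 : vsmooth_on A0 (c \o (fun g : G => Psi (g, x0)) \o chart_inv cG).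
      have [_ s] := smooth_orbit_map LA x0.
      by apply: vsmooth_on_sub (s cG c AG Ac) => _ [g [gG [Vg cg]] <-]; exists g.
    have -> : jac (phi \o i) 0 =
        jac ((c \o (fun g : G => Psi (g, x0)) \o chart_inv cG) \o fa) 0.
      by apply: jac_eq => a; rewrite /phi /= iE /Th /lsub /rsub row_mxKl row_mxKr sec0.
    rewrite (@jac_comp _ _ _ _ setT A0 _ fa 0 oA0) //.
    - by rewrite (jac_affine (cG (lone G)) M) fa0 EM.
    - rewrite fa0; exists (lone G) => //; split=> //; split.
        exact: la_mem1 LA _.
      by rewrite /= (la_one LA).
    - exact: vsmooth_affine openT.
  have jt : row_mx 0 1%:M *m jac phi 0 = K.
    pose i (a : 'rV[R]_k) : 'rV[R]_(r + k) := a *m row_mx 0 1%:M.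
    have i0 : i 0 = 0 by rewrite /i mul0mx.
    have iE a : i a = row_mx 0 a by rewrite /i mul_mx_row mulmx1 mulmx0.
    have si := @vsmooth_linear R _ _ setT (row_mx 0 1%:M : 'M[R]_(k, r + k)) openT.
    have <- : jac (phi \o i) 0 = row_mx 0 1%:M *m jac phi 0.
      have Di0 : D0 (i 0) by rewrite i0.
      have := @jac_comp R _ _ _ setT D0 phi i 0 oD0 Logic.I Di0 si sphi.
      by rewrite i0 jac_linear.
    rewrite -[RHS](jac_affine (c x0) K 0); apply: jac_near.
    have : nbhs (0 : 'rV[R]_k) Dt.
      apply: open_nbhs_nbhs; split=> //; split=> //=.
      by rewrite ft0; exists x0.
    apply: filterS => t [_ ct].
    rewrite /phi /= iE /Th /lsub /rsub row_mxKl row_mxKr gam0 (la_one LA) /sec.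
    by have [_] := chart_invP ct.
  rewrite -[LHS]mul1mx [1%:M](_ : _ = col_mx (row_mx 1%:M 0) (row_mx 0 1%:M)).
    by rewrite mul_col_mx ja jt.
  by rewrite -/(block_mx 1%:M 0 0 1%:M) -scalar_mx_block.
have [|| U1 [psi [oU1 U10 U1D oP [psiK spsi]]]] := inverse_function (L := L) oD0 D00 sphi.
- by rewrite jphi; exact: EL.
- by rewrite jphi; exact: LE.
have [rho rho0 rhoU] := norm_ball_in oU1 U10.
have BU : vball (r + k) rho `<=` U1.
  by move=> w wr; apply: rhoU; rewrite /= subr0 ltW.
have BD w : vball (r + k) rho w -> D0 w by move=> /BU/U1D.
pose inv x : euclid R (r + k) := psi (c x).
have ThK w : vball (r + k) rho w -> inv (Th w) = w by move=> /BU/psiK.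
have boxE : Th @` vball (r + k) rho =
    dom c `&` c @^-1` ((phi @` U1) `&` psi @^-1` vball (r + k) rho).
  apply/seteqP; split=> [_ [w wr <-]|x [cx' [[w Uw e] wr]]].
    split; first by case: (BD w wr).
    split; first by exists w => //; exact: BU.
    by rewrite /= -/(phi w) psiK //; exact: BU.
  exists w; first by move: wr; rewrite /= -e psiK.
  have [_ cw] := U1D w Uw.
  by rewrite -(chartK cx') -e /phi chartK.
have oB1 : open ((phi @` U1) `&` psi @^-1` vball (r + k) rho).
  have ov : @open 'rV[R]_(r + k) (vball (r + k) rho) .
    exact: open_vball.
  have cpsi x : (phi @` U1) x -> {for x, continuous psi}.
    exact: vsmooth_on_continuous spsi.
  exact: open_preimage_in oP cpsi ov.
have obox : open (Th @` vball (r + k) rho).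
  rewrite boxE.
  exact: (open_preimage_in (dom_open c) (@chart_continuous _ _ _ c) oB1).
have subl w : vball (r + k) rho w -> vball r rho (lsub w) /\ vball k rho (rsub w).
  by rewrite /vball /= (norm_sub_lt _ rho0) => /andP[].
have invs : smooth_map (Th @` vball (r + k) rho) inv.
  have sc : smooth_map (Th @` vball (r + k) rho) (c : X -> euclid R n).
    by apply: smooth_map_sub (smooth_chart Ac); rewrite boxE => x [].
  have spsi' : smooth_map (phi @` U1 : set (euclid R n))
      (psi : euclid R n -> euclid R (r + k)).
    exact: (smooth_map_euclid psi oP).1 spsi.
  apply: (@smooth_map_comp _ _ _ _ _ _ _ _ (phi @` U1 : set (euclid R n))
    (c : X -> euclid R n) (psi : euclid R n -> euclid R (r + k)) obox oP _ sc spsi').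
  by rewrite boxE => x [_ []].
have gs : smooth_map (vball r rho) gam.
  apply: smooth_map_sub sgam => a ar.
  have : vball (r + k) rho (row_mx a 0).
    by rewrite /vball /= norm_row_mx_lt // ar normr0.
  by move=> /BD [[[[_]]]]; rewrite /lsub /= row_mxKl.
have ss : smooth_map (vball k rho) sec.
  apply: smooth_map_sub ssec => a ar.
  have : vball (r + k) rho (row_mx 0 a).
    by rewrite /vball /= norm_row_mx_lt // normr0 rho0 ar.
  by move=> /BD [[[_ [_]]]]; rewrite /rsub /= row_mxKr.
have VB w : vball (r + k) rho w -> V (gam (lsubmx w), sec (rsubmx w)).
  by move=> /BD [[]].
have sub : Th @` vball (r + k) rho `<=` dom c by rewrite boxE => x [].
by exists (Flowbox rho0 Ac gs ss gam0 VB ThK obox sub invs).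
Qed.

End FlowBox.

Section Transverse.
Context {R : realType} {d n : nat} {G : lie_group R d} {X : manifold R n}.
Context {V : set (mprod G X)} {Psi : mprod G X -> X}.
Hypothesis LA : local_action V Psi.
Context {cG : @chart R G d}.
Hypotheses (AG : atlas cG) (eG : dom cG (lone G)).
Context {r k : nat} (B : flowbox (V := V) (Psi := Psi) r k).

Definition fb_along x : euclid R r := lsubmx (fb_inv B x).
Definition fb_across x : euclid R k := rsubmx (fb_inv B x).

Lemma smooth_along : smooth_map (fb_box B) fb_along.
Proof.
have s : smooth_map (setT : set (euclid R (r + k))) (@lsubmx R 1 r k : _ -> euclid R r).
  by apply/(smooth_map_euclid _ openT); exact: vsmooth_lsubmx.
exact: (smooth_map_comp (fb_open B) openT (fun _ _ => Logic.I)
  (@fb_inv_smooth _ _ _ _ _ _ _ _ _ B) s).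
Qed.

Lemma smooth_across : smooth_map (fb_box B) fb_across.
Proof.
have s : smooth_map (setT : set (euclid R (r + k))) (@rsubmx R 1 r k : _ -> euclid R k).
  by apply/(smooth_map_euclid _ openT); exact: vsmooth_rsubmx.
exact: (smooth_map_comp (fb_open B) openT (fun _ _ => Logic.I)
  (@fb_inv_smooth _ _ _ _ _ _ _ _ _ B) s).
Qed.

Lemma fb_along_map a t : vball r (fb_rad B) a -> vball k (fb_rad B) t ->
  fb_along (fb_map B (row_mx a t)) = a.
Proof.
move=> ar tr; rewrite /fb_along fb_mapK ?row_mxKl //.
by rewrite /vball /= norm_row_mx_lt ?ar //; exact: fb_rad_gt0.
Qed.

Lemma fb_across_map a t : vball r (fb_rad B) a -> vball k (fb_rad B) t ->
  fb_across (fb_map B (row_mx a t)) = t.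
Proof.
move=> ar tr; rewrite /fb_across fb_mapK ?row_mxKr //.
by rewrite /vball /= norm_row_mx_lt ?ar //; exact: fb_rad_gt0.
Qed.

Lemma fb_mapE a t : fb_map B (row_mx a t) = Psi (fb_gam B a, fb_sec B t).
Proof. by rewrite /fb_map row_mxKl row_mxKr. Qed.

Lemma fb_dom2 a t : vball r (fb_rad B) a -> vball k (fb_rad B) t ->
  V (fb_gam B a, fb_sec B t).
Proof.
move=> ar tr; have := @fb_dom _ _ _ _ _ _ _ _ _ B (row_mx a t).
rewrite row_mxKl row_mxKr; apply.
by rewrite /vball /= norm_row_mx_lt ?ar //; exact: fb_rad_gt0.
Qed.

Lemma fb_boxP z : fb_box B z -> exists a t,
  [/\ vball r (fb_rad B) a, vball k (fb_rad B) t & z = fb_map B (row_mx a t)].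
Proof.
move=> [w wr <-]; exists (lsubmx w), (rsubmx w).
move: wr; rewrite /vball /= (norm_sub_lt _ (fb_rad_gt0 B)) => /andP[? ?].
by split=> //; rewrite hsubmxK.
Qed.

Lemma fb_box_map a t : vball r (fb_rad B) a -> vball k (fb_rad B) t ->
  fb_box B (fb_map B (row_mx a t)).
Proof.
move=> ar tr; exists (row_mx a t) => //.
by rewrite /vball /= norm_row_mx_lt ?ar //; exact: fb_rad_gt0.
Qed.

(** The slices of a flow box are swept by the group, so the tangent space of
    the orbit at [z] contains that of the slice, which has dimension [r]. If
    the orbit map has rank at most [r] at [z], the two coincide, and the
    transverse coordinate is stationary along the orbit. *)
Lemma across_orbit_jac z : fb_box B z ->
  (\rank (orbit_jac (Psi := Psi) cG (fb_chart B) z) <= r)%N ->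
  mjac (fb_across \o (fun g : G => Psi (g, z))) cG (euclid_chart k) (lone G) = 0.
Proof.
move=> Bz; set c := fb_chart B; set J := orbit_jac _ _ _ => rJ.
have Ac : atlas c by exact: fb_atlas.
have cz : dom c z by exact: fb_sub Bz.
have [a0 [t0 [ar tr zE]]] := fb_boxP Bz.
set Ba := vball r (fb_rad B).
have oBa : open Ba by exact: open_vball.
have sgam : smooth_map Ba (fb_gam B) := fb_gam_smooth B.
have cgam : {for a0, continuous (fb_gam B)} by have [+ _] := sgam; exact.
pose beta (a : euclid R r) : X := Psi (fb_gam B a, fb_sec B t0).
have sbeta : smooth_map Ba beta.
  apply: (smooth_map_act LA oBa sgam (smooth_map_cst _ oBa)) => a ar'.
  exact: fb_dom2.
have beta0 : beta a0 = z by rewrite zE fb_mapE.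
pose delta (a : euclid R r) : G := lmul (fb_gam B a) (linv (fb_gam B a0)).
have sdelta : smooth_map Ba delta.
  exact: smooth_map_mul oBa sgam (smooth_map_cst _ oBa).
have delta0 : delta a0 = lone G by rewrite /delta lmulgV.
have E1 : {near a0, beta =1 (fun g : G => Psi (g, z)) \o delta}.
  have cd : {for a0, continuous delta} by have [+ _] := sdelta; exact.
  have cc (T : topologicalType) (x : T) : {for a0, continuous (fun _ : euclid R r => x)}.
    exact: (@cst_continuous _ _ x a0).
  have v1 : V (fb_gam B a0, fb_sec B t0) by exact: fb_dom2.
  have v2 : V (delta a0, Psi (fb_gam B a0, fb_sec B t0)).
    by rewrite delta0; exact: la_mem1 LA _.
  have v3 : V (lmul (delta a0) (fb_gam B a0), fb_sec B t0).
    by rewrite delta0 lmul1.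
  have N := act_mul_near LA cd (cc _ (fb_gam B a0)) (cc _ (fb_sec B t0)) v1 v2 v3.
  apply: filterS N => a; rewrite /= -/(beta a0) beta0 => ->.
  by rewrite /delta lmulgKV.
pose ec : @chart R (euclid R r) r := euclid_chart r.
pose et : @chart R (euclid R k) k := euclid_chart k.
have zE' : Psi (lone G, z) = z := la_one LA z.
have BJ : mjac beta ec c a0 = mjac delta ec cG a0 *m J.
  rewrite (@mjac_near _ _ _ _ _ _ _ ec c a0 _ E1) //.
  rewrite (@mjac_comp _ _ _ _ _ _ _ Ba (act_dom (V := V) z) _ _ ec cG c) //=.
  - by rewrite delta0.
  - exact: open_act_dom LA z.
  - by rewrite delta0.
  - by rewrite delta0 zE'.
  - by rewrite delta0; exact: la_mem1 LA _.
  - exact: smooth_orbit_map LA z.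
have cb : dom c (beta a0) by rewrite beta0.
have Bb : fb_box B (beta a0) by rewrite beta0.
have nBa : nbhs (a0 : 'rV[R]_r) Ba by exact: open_nbhs_nbhs.
have BP : mjac beta ec c a0 *m mjac fb_along c ec z = 1%:M.
  have := @mjac_comp R _ _ _ (euclid R r) X (euclid R r) Ba (fb_box B) beta
    fb_along ec c ec a0 erefl Ac erefl oBa (fb_open B) Logic.I cb Logic.I ar Bb
    sbeta smooth_along.
  rewrite beta0 => <-; rewrite -[RHS](jac_id (a0 : 'rV_r)); apply: jac_near.
  by apply: filterS nBa => a ar'; rewrite /= /beta -fb_mapE fb_along_map.
have BN : mjac beta ec c a0 *m mjac fb_across c et z = 0.
  have := @mjac_comp R _ _ _ (euclid R r) X (euclid R k) Ba (fb_box B) beta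
    fb_across ec c et a0 erefl Ac erefl oBa (fb_open B) Logic.I cb Logic.I ar Bb
    sbeta smooth_across.
  rewrite beta0 => <-.
  apply: (@mjac_cst _ _ _ (euclid R r) (euclid R k) _ t0 ec et a0 Logic.I).
  by apply: filterS nBa => a ar'; rewrite /= /beta -fb_mapE fb_across_map.
have cz' : dom c (Psi (lone G, z)) by rewrite zE'.
have Bz' : fb_box B (Psi (lone G, z)) by rewrite zE'.
have := @mjac_comp R _ _ _ G X (euclid R k) (act_dom (V := V) z) (fb_box B)
  (fun g : G => Psi (g, z)) fb_across cG c et (lone G) AG Ac erefl
  (open_act_dom LA z) (fb_open B) eG cz' Logic.I (la_mem1 LA z) Bz'
  (smooth_orbit_map LA z) smooth_across.
rewrite zE' => ->.
rewrite -/(orbit_jac cG c z) -/J.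
set Bm := mjac beta ec c a0 in BJ BP BN.
have BJs : (Bm <= J)%MS by rewrite BJ submxMl.
have rB : \rank Bm = r by apply/eqP; apply/row_freeP; eexists; exact: BP.
have /submxP [Q ->] : (J <= Bm)%MS.
  rewrite -(mxrank_leqif_sup BJs) rB eqn_leq rJ andbT -[X in (X <= _)%N]rB.
  exact: mxrankS.
by rewrite -mulmxA BN mulmx0.
Qed.

(** If the orbit of [y] has rank at most [r] throughout the box, the elements
    close to the identity move [y] inside its slice: the plaque of [y]. *)
Lemma plaque y : fb_box B y ->
  (forall g, V (g, y) -> fb_box B (Psi (g, y)) ->
     (\rank (orbit_jac (Psi := Psi) cG (fb_chart B) (Psi (g, y))) <= r)%N) ->
  exists2 N : set G, nbhs (lone G) N & forall m, N m ->
    [/\ V (m, y), fb_box B (Psi (m, y)) &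
        fb_across (Psi (m, y)) = fb_across y].
Proof.
move=> By rky; pose et : @chart R (euclid R k) k := euclid_chart k.
pose D z := act_dom (V := V) z `&` (fun g : G => Psi (g, z)) @^-1` fb_box B.
have oD z : open (D z).
  apply: (smooth_open_preimage (open_act_dom LA z) (smooth_orbit_map LA z)).
  exact: fb_open.
have De z : fb_box B z -> D z (lone G).
  by move=> Bz; split; [exact: la_mem1 LA _ | rewrite /= (la_one LA)].
pose f z := fb_across \o (fun g : G => Psi (g, z)).
have sf z : smooth_map (D z) (f z).
  apply: (smooth_map_comp (oD z) (fb_open B) _ _ smooth_across); first by move=> g [].
  by apply: smooth_map_sub (smooth_orbit_map LA z) => g [].
have f0 g : dom cG g -> D y g -> mjac (f y) cG et g = 0.
  move=> cg [Vg Bg]; pose z := Psi (g, y).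
  pose tau (g' : G) := lmul g' (linv g).
  have stau : smooth_map [set: G] tau.
    apply: smooth_map_mul; first exact: openT.
      exact/smooth_map_id/openT.
    exact/smooth_map_cst/openT.
  have ctau : {for g, continuous tau} by have [+ _] := stau; exact.
  have tau0 : tau g = lone G by rewrite /tau lmulgV.
  have E : {near g, f y =1 f z \o tau}.
    have cc (T : topologicalType) (x : T) : {for g, continuous (fun _ : G => x)}.
      exact: cvg_cst.
    have v2 : V (tau g, Psi (g, y)) by rewrite tau0; exact: la_mem1 LA _.
    have v3 : V (lmul (tau g) g, y) by rewrite tau0 lmul1.
    have N := act_mul_near LA ctau (cc _ g) (cc _ y) Vg v2 v3.
    by apply: filterS N => h; rewrite /f /= -/z => ->; rewrite /tau lmulgKV.
  rewrite (mjac_near _ cg E).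
  have Bz : fb_box B z by [].
  have et0 : dom cG (tau g) by rewrite tau0.
  have Dt : D z (tau g) by rewrite tau0; exact: De.
  have := @mjac_comp R _ _ _ G G (euclid R k) [set: G] (D z) tau (f z) cG cG et
    g AG AG erefl openT (oD z) cg et0 Logic.I Logic.I Dt stau (sf z).
  move=> ->; rewrite tau0 across_orbit_jac ?mulmx0 //; exact: rky.
pose F (a : 'rV[R]_d) : 'rV[R]_k := f y (chart_inv cG a).
pose A := cG @` (dom cG `&` D y).
have oA : open A by exact: open_chart_image.
have Ae : A (cG (lone G)) by exists (lone G) => //; split=> //; exact: De.
have sF : vsmooth_on A F.
  have [_ s] := sf y.
  by apply: vsmooth_on_sub (s cG et AG erefl) => _ [g [cg Dg] <-]; exists g.
have [rho rho0 rhoA] := norm_ball_in oA Ae.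
exists (dom cG `&` cG @^-1` [set a | `|a - cG (lone G)| < rho]).
  apply: open_nbhs_nbhs; split; last by split=> //=; rewrite subrr normr0.
  apply: open_preimage_in (dom_open cG) (@chart_continuous _ _ _ cG) _.
  exact: open_norm_ball.
move=> m [cm mr]; have [g [cg Dg] e] := rhoA _ (ltW mr).
have {e} gm : g = m by rewrite -(chartK cg) e chartK.
rewrite {}gm in Dg; have [Vm Bm] := Dg; split=> //.
have FE h : dom cG h -> F (cG h) = fb_across (Psi (h, y)).
  by move=> ch; rewrite /F /f /= chartK.
have Fe : F (cG (lone G)) = fb_across y by rewrite FE // (la_one LA).
rewrite -(FE m cm) -Fe; apply/rowP => j.
apply: (@jac0_cst _ _ (fun a => F a ord0 j) (cG (lone G)) rho).
- by apply: smooth_on_sub (sF j) => a /= ar; apply: rhoA => /=; exact: ltW.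
- move=> a i ar; have [h [ch Dh] <-] := rhoA a (ltW ar).
  have /matrixP/(_ i j) := f0 h ch Dh.
  by rewrite /mjac !mxE.
- by [].
- by rewrite subrr normr0.
Qed.

End Transverse.

(** * Orbits and their dimension *)

Section Countability.

Lemma countable_image (T U : Type) (f : T -> U) (A : set T) :
  countable A -> countable (f @` A).
Proof. by apply: card_le_trans; exact: card_image_le. Qed.

(** The values of [e] at the integers that code no element of [A] are [x]. *)
Lemma countable_enum (T : choiceType) (A : set T) (x : T) : countable A ->
  exists2 e : nat -> T, (forall k, A (e k) \/ e k = x) &
    forall z, A z -> exists k, e k = z.
Proof.
move=> /countable_injP [f fi].
exists (fun k => xget x [set z | A z /\ f z = k]) => [k|z Az].
  by case: xgetP => [w _ [Aw _]|_]; [left | right].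
exists (f z); case: xgetP => [w _ [Aw e]|/(_ z)[]//].
by apply: fi => //; rewrite inE.
Qed.

End Countability.

Section Orbits.
Context {R : realType} {d n : nat} {G : lie_group R d} {X : manifold R n}.
Context {V : set (mprod G X)} {Psi : mprod G X -> X}.
Hypothesis LA : local_action V Psi.

(** The smallest stable set containing [x]. In a local action the points
    [Psi (g, x)] need not exhaust it, as several steps may be necessary;
    quantifying over stable sets avoids chains of steps. *)
Definition orbit (x : X) : set X :=
  [set y | forall S : set X, stable V Psi S -> S x -> S y].

Lemma orbit_refl x : orbit x x.
Proof. by []. Qed.

Lemma orbit_act x y g : orbit x y -> V (g, y) -> orbit x (Psi (g, y)).
Proof. by move=> Oy Vg S sS Sx; apply: (sS (g, y)) => //; exact: Oy. Qed.

(** The inverse of an element undoes its step. *)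
Lemma stable_compl S : stable V Psi S -> stable V Psi (~` S).
Proof.
move=> sS [g y] Vg Sy Sgy; apply: Sy => /=.
have [Vi <-] := la_inv LA Vg; exact: (sS (linv g, Psi (g, y))).
Qed.

Lemma stable_orbit x : stable V Psi (orbit x).
Proof. by move=> [g y] Vg Oy; exact: orbit_act. Qed.

(** As complements of stable sets are stable, a stable part of [orbit x] either
    contains [x] or is empty. *)
Lemma is_orbit_orbit x : is_orbit V Psi (orbit x).
Proof.
split; [by exists x; exact: orbit_refl | exact: stable_orbit |].
move=> S SO sS; have [[z Sz]|S0] := pselect (S !=set0); last first.
  by left; apply/seteqP; split=> // z Sz; apply: S0; exists z.
right; apply/seteqP; split=> // y Oy; apply: Oy => //.
apply: contrapT => nSx; exact: (SO z Sz _ (stable_compl sS) nSx Sz).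
Qed.

(** The rank cannot increase along one step, nor along the inverse step; the
    points where it has a given value therefore form a stable set. *)
Lemma orbit_rank cG c c' x y : atlas cG -> dom cG (lone G) ->
  atlas c -> atlas c' -> dom c x -> dom c' y -> orbit x y ->
  \rank (orbit_jac (Psi := Psi) cG c' y) = \rank (orbit_jac (Psi := Psi) cG c x).
Proof.
move=> AG eG Ac Ac' cx cy Oxy.
pose S := [set y | forall c', atlas c' -> dom c' y ->
  \rank (orbit_jac (Psi := Psi) cG c' y) = \rank (orbit_jac (Psi := Psi) cG c x)].
have step g z c1 c2 : V (g, z) -> atlas c1 -> atlas c2 -> dom c1 z ->
    dom c2 (Psi (g, z)) -> \rank (orbit_jac (Psi := Psi) cG c2 (Psi (g, z))) =
    \rank (orbit_jac (Psi := Psi) cG c1 z).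
  move=> Vg A1 A2 d1 d2; apply/eqP; rewrite eqn_leq (orbit_jac_rank LA) //=.
  have [Vi E] := la_inv LA Vg; rewrite -{1}E.
  by apply: (orbit_jac_rank LA) => //; rewrite E.
suff sS : stable V Psi S.
  apply: (Oxy S sS) => // c1 A1 d1; rewrite -{1}(la_one LA x).
  by apply: step => //; [exact: la_mem1 LA _ | rewrite (la_one LA)].
move=> [g z] Vg Sz c2 A2 d2; have [c1 A1 d1] := atlas_cover z.
by rewrite -(Sz c1 A1 d1); exact: step.
Qed.

(** Let the two steps vary in members of a countable basis of the group. Where
    all the resulting points lie in one neighbourhood [N z] of one of them, keep
    such a [z]: this gives countably many [z], and by [act_chain] small members
    of the basis do have this property. *)
Lemma plaque_step (N : X -> set G) (y : X) (U0 : set X) :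
  (forall z, nbhs (lone G) (N z)) -> exists C : set X,
  [/\ countable C, C `<=` U0,
      forall z, C z -> exists g h,
        [/\ V (h, y), V (g, Psi (h, y)) & z = Psi (g, Psi (h, y))] &
      forall g h, V (h, y) -> V (g, Psi (h, y)) -> U0 (Psi (g, Psi (h, y))) ->
        exists z m, [/\ C z, N z m & Psi (g, Psi (h, y)) = Psi (m, z)]].
Proof.
move=> NN; have [Bs cBs [Bo Bb]] := lie_second_countable G.
pose P (p : set G * set G) : set X := [set z | [/\ U0 z, exists g h,
    [/\ V (h, y), V (g, Psi (h, y)) & z = Psi (g, Psi (h, y))] &
  forall g h, p.1 g -> p.2 h ->
    exists2 m, N z m & Psi (g, Psi (h, y)) = Psi (m, z)]].
pose pick p := xget y (P p).
exists [set z | exists2 p, (Bs `*` Bs) p /\ P p !=set0 & pick p = z]; split.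
- apply: (@sub_countable _ _ _ (pick @` (Bs `*` Bs))).
    by apply: subset_card_le => z [p [Bp _] <-]; exists p.
  by apply: countable_image; exact: countableX.
- by move=> z [p [_ [w Pw]] <-]; rewrite /pick; case: xgetP => [? _ []//|/(_ w)].
- by move=> z [p [_ [w Pw]] <-]; rewrite /pick; case: xgetP => [? _ []//|/(_ w)].
move=> g h Vh Vg Uz; set z := Psi (g, _) in Uz *.
have [qe cq nq] := act_chain LA Vh Vg.
have nN : \forall p \near (g, h),
    N z (lmul (lmul p.1 (lmul p.2 (linv h))) (linv g)).
  by apply: cq; rewrite qe; exact: NN.
have [[A1 A2] /= [nA1 nA2] A12] := filterI nq nN.
have [b1 [Bb1 b1g] b1A] := Bb g A1 nA1.
have [b2 [Bb2 b2h] b2A] := Bb h A2 nA2.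
have Pz : P (b1, b2) z.
  split=> //; first by exists g, h.
  move=> g' h' b1g' b2h'.
  have [/= E Nm] := A12 (g', h') (conj (b1A _ b1g') (b2A _ b2h')).
  by eexists; [exact: Nm | exact: E].
exists (pick (b1, b2)); rewrite /pick; case: xgetP => [w ew Pw|/(_ z)//].
have [_ _ /(_ g h b1g b2h) [m Nm e]] := Pw.
exists m; split=> //; exists (b1, b2); last by [].
by split=> //; exists z.
Qed.

(** An orbit is covered by countably many plaques [N y]: the points reached from
    [x] by a bounded number of steps lie in countably many of them, by induction
    on the bound. In this induction the first of the two steps of [plaque_step]
    is the one in the plaque of the previous centre. The last selection
    recentres the plaques at points of [U0], outside of which [N] may carry no
    information. *)
Lemma orbit_plaques (N : X -> set G) (x : X) (U0 : set X) :
  (forall z, nbhs (lone G) (N z)) -> (forall z m, N z m -> V (m, z)) ->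
  exists C : set X, [/\ countable C, C `<=` U0, C `<=` orbit x &
    forall z, orbit x z -> U0 z ->
      exists y m, [/\ C y, N y m & z = Psi (m, y)]].
Proof.
move=> NN NV.
have [st stP] := choice (fun y => plaque_step y setT NN).
have [st' st'P] := choice (fun y => plaque_step y U0 NN).
pose D := fix D k := if k is k'.+1 then \bigcup_(y in D k') st y else [set x].
have cD k : countable (D k).
  elim: k => [|k IH]; first exact: countable1.
  by apply: bigcup_countable => // y _; case: (stP y).
have stO y z : orbit x y -> st y z -> orbit x z.
  move=> Oy sz; have [_ _ /(_ z sz) [g [h [Vh Vg ->]]] _] := stP y.
  by apply: orbit_act => //; exact: orbit_act.
have DO k : D k `<=` orbit x.
  elim: k => [_ ->|k IH z [y Dy sz]]; first exact: orbit_refl.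
  by apply: stO sz; exact: IH.
have cover z : orbit x z -> exists k y m, [/\ D k y, N y m & z = Psi (m, y)].
  move=> Oz; apply: (Oz [set z | exists k y m, [/\ D k y, N y m & z = Psi (m, y)]]).
    move=> [g w] Vg [k [y [m [Dy Nm /= ew]]]]; have Vm := NV _ _ Nm.
    rewrite ew in Vg *; have [_ _ _ /(_ g m Vm Vg Logic.I)] := stP y.
    by move=> [v [m' [sv Nv e]]]; exists k.+1, v, m'; split=> //; exists y.
  exists 0%N, x, (lone G); split=> //; last by rewrite (la_one LA).
  exact: nbhs_singleton (NN x).
exists (\bigcup_k \bigcup_(y in D k) st' y); split.
- apply: bigcup_countable => [|k _]; first exact: countableP.
  by apply: bigcup_countable => // y _; case: (st'P y).
- by move=> z [k _ [y Dy sz]]; have [_ + _ _] := st'P y; exact.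
- move=> z [k _ [y Dy sz]]; have [_ _ /(_ z sz) [g [h [Vh Vg ->]]] _] := st'P y.
  by apply: orbit_act => //; apply: orbit_act => //; exact: DO Dy.
move=> z /cover [k [y [m [Dy Nm ez]]]] Uz; have Vm := NV _ _ Nm.
have [_ _ _ /(_ (lone G) m Vm)] := st'P y.
rewrite (la_one LA) -ez => /(_ (la_mem1 LA _) Uz) [v [m' [sv Nv e]]].
by exists v, m'; split=> //; exists k => //; exists y.
Qed.

End Orbits.

Section OrbitDimension.
Context {R : realType} {d n : nat} {G : lie_group R d} {X : manifold R n}.
Context {V : set (mprod G X)} {Psi : mprod G X -> X}.
Hypothesis LA : local_action V Psi.
Context {cG : @chart R G d}.
Hypotheses (AG : atlas cG) (eG : dom cG (lone G)).

Lemma vsmooth_in_chart m k (M : manifold R m) (U : set M) (F : M -> euclid R k)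
    (c : @chart R M m) : atlas c -> smooth_map U F ->
  vsmooth_on (c @` (dom c `&` U)) (F \o chart_inv c).
Proof.
move=> Ac [_ /(_ c (euclid_chart k) Ac erefl)].
by apply: vsmooth_on_sub => _ [x [cx Ux] <-]; exists x.
Qed.

Lemma fb_across0 r k (B : flowbox (V := V) (Psi := Psi) r k) z :
  fb_sec B 0 = z -> fb_box B z /\ fb_across B z = 0.
Proof.
have b0 j : vball j (fb_rad B) 0 by rewrite /vball /= normr0; exact: fb_rad_gt0.
have E : fb_map B (row_mx 0 0) = fb_sec B 0.
  by rewrite fb_mapE fb_gam0 (la_one LA).
move=> <-; rewrite -E; split; first exact: fb_box_map.
by rewrite fb_across_map.
Qed.

(** The box of dimension [r] swept from [x] lies in the orbit. It is therefore
    covered by the coordinate along the orbit composed with [i], read in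
    countably many charts of [N]; for [s < r] this is impossible. *)
Lemma orbit_rank_le r s c x (N : manifold R s) (i : N -> X) :
  atlas c -> dom c x -> \rank (orbit_jac (Psi := Psi) cG c x) = r ->
  @second_countable N -> smooth_map setT i ->
  range i = orbit (V := V) (Psi := Psi) x -> (r <= s)%N.
Proof.
move=> Ac cx rJ [Bs cBs [Bo Bb]] si iO; rewrite leqNgt; apply/negP => sr.
have [B [_ B0]] := flowbox_exists LA AG eG Ac cx rJ.
have [p0 _ _] : (range i) x by rewrite iO; exact: orbit_refl.
(* a chart for each small member of the basis; the others get any chart *)
have H (b : set N) : exists e : @chart R N s, atlas e /\
    ((exists2 e' : @chart R N s, atlas e' & b `<=` dom e') -> b `<=` dom e).
  have [[e Ae be]|ne] := pselect (exists2 e' : @chart R N s, atlas e' & b `<=` dom e').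
    by exists e.
  by have [e Ae _] := atlas_cover p0; exists e.
have [ch chP] := choice H.
have [enu _ enuP] := countable_enum set0 cBs.
pose O := setT `&` i @^-1` fb_box B.
have oO : open O by exact: smooth_open_preimage openT si (fb_open B).
have sO : smooth_map O (fb_along B \o i).
  apply: (smooth_map_comp oO (fb_open B) _ _ (smooth_along B)).
    by move=> p [].
  exact: smooth_map_sub si.
pose e k := ch (enu k).
pose Q : set 'rV[R]_r := vball r (fb_rad B).
have oQ : open Q by exact: open_vball.
have Q0 : Q !=set0.
  by exists 0; rewrite /Q /vball /= normr0; exact: fb_rad_gt0.
apply: (@smooth_images_no_interior R s r (fun k => e k @` (dom (e k) `&` O))
  (fun k => fb_along B \o i \o chart_inv (e k)) Q sr _ _ oQ Q0).
- by move=> k; exact: open_chart_image.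
- by move=> k; apply: vsmooth_in_chart sO; have [] := chP (enu k).
move=> a Qa.
have t0 : vball (n - r) (fb_rad B) 0 by rewrite /vball /= normr0; exact: fb_rad_gt0.
have [p _ ip] : (range i) (fb_map B (row_mx a 0)).
  rewrite iO fb_mapE B0; apply: (orbit_act (@orbit_refl _ _ _ _ _ _ _ x)).
  by rewrite -B0; exact: fb_dom2.
have [e' Ae' e'p] := atlas_cover p.
have [b [Bsb bp] be'] := Bb p (dom e') (open_nbhs_nbhs (conj (dom_open e') e'p)).
have [k ek] := enuP b Bsb; exists k => //.
have ep : dom (e k) p.
  have [_ +] := chP (enu k); rewrite -/(e k) ek => /(_ _ p bp); apply.
  by exists e'.
exists (e k p).
  by exists p => //; split=> //; split=> //; rewrite /= ip; exact: fb_box_map.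
by rewrite /= (chartK ep) ip fb_along_map.
Qed.

(** Projecting to the tangent space at a point makes the immersion a local
    diffeomorphism, so the projection of the orbit contains an open set of
    dimension [s]. It is covered by the projections of countably many plaques,
    which have dimension [r]; for [r < s] this is impossible. *)
Lemma orbit_rank_ge r s c x (N : manifold R s) (i : N -> X) :
  atlas c -> dom c x -> \rank (orbit_jac (Psi := Psi) cG c x) = r ->
  immersion i -> range i = orbit (V := V) (Psi := Psi) x -> (s <= r)%N.
Proof.
move=> Ac cx rJ [si imm] iO; rewrite leqNgt; apply/negP => rs.
have [p0 _ ip0] : (range i) x by rewrite iO; exact: orbit_refl.
have [e Ae ep0] := atlas_cover p0.
pose A := e @` (dom e `&` (setT `&` i @^-1` dom c)).
have oA : open A.
  by apply: open_chart_image; exact: smooth_open_preimage openT si (dom_open c).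
have sA : vsmooth_on A (c \o i \o chart_inv e).
  have [_ s'] := si.
  by apply: vsmooth_on_sub (s' e c Ae Ac) => _ [p [ep [_ cp]] <-]; exists p.
have Ap0 : A (e p0) by exists p0 => //; split=> //; split=> //=; rewrite ip0.
have cp0 : dom c (i p0) by rewrite ip0.
have := imm p0 e c Ae Ac ep0 cp0.
have [_ ->] := vsmooth_differentiable oA Ap0 sA.
move=> /row_freeP [L JL].
pose zeta (y : 'rV[R]_s) : 'rV[R]_s := c (i (chart_inv e y)) *m L.
have sL := @vsmooth_linear R _ _ setT L openT.
have szeta : vsmooth_on A zeta.
  exact: (vsmooth_on_comp oA openT (fun _ _ => Logic.I) sA sL).
have jzeta : jac zeta (e p0) = 1%:M.
  have := @jac_comp R _ _ _ A setT (fun y => y *m L) (c \o i \o chart_inv e)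
    (e p0) openT Ap0 Logic.I sA sL.
  by rewrite jac_linear JL.
have [U1 [_ [oU1 U1p U1A oQ _]]] := inverse_function1 oA Ap0 szeta jzeta.
(* A plaque at [z], with the map from a ball that parametrizes it. *)
pose good z (D : (euclid R r -> X) * R * set G) :=
  [/\ nbhs (lone G) D.2, forall m, D.2 m -> V (m, z) &
    orbit (V := V) (Psi := Psi) x z -> dom c z ->
    [/\ smooth_map (vball r D.1.2) D.1.1,
        forall a, vball r D.1.2 a -> dom c (D.1.1 a) &
        forall m, D.2 m -> exists2 a, vball r D.1.2 a & Psi (m, z) = D.1.1 a]].
have H z : exists D, good z D.
  have [[Oz cz]|nO] := pselect (orbit (V := V) (Psi := Psi) x z /\ dom c z);
      last first.
    exists (cst x, 0, act_dom (V := V) z); split=> //= [|? ?]; last by case: nO.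
    apply: open_nbhs_nbhs; split; first exact: open_act_dom LA z.
    exact: la_mem1 LA z.
  have rz : \rank (orbit_jac (Psi := Psi) cG c z) = r.
    by rewrite -rJ; exact: (orbit_rank LA AG eG Ac Ac cx cz Oz).
  have [B [Bc B0]] := flowbox_exists LA AG eG Ac cz rz.
  have [Bz az] := fb_across0 B0.
  have rB g : V (g, z) -> fb_box B (Psi (g, z)) ->
      (\rank (orbit_jac (Psi := Psi) cG (fb_chart B) (Psi (g, z))) <= r)%N.
    move=> Vg Bg; rewrite Bc -rJ.
    rewrite (orbit_rank LA AG eG Ac Ac cx _ (orbit_act Oz Vg)) //.
    by rewrite -Bc; exact: fb_sub Bg.
  have [N0 nN0 N0P] := plaque LA AG eG Bz rB.
  have t0 : vball (n - r) (fb_rad B) 0 by rewrite /vball /= normr0; exact: fb_rad_gt0.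
  exists (fun a => Psi (fb_gam B a, fb_sec B 0), fb_rad B, N0).
  split=> //= [m /N0P[]//|_ _]; split.
  - have oB := @open_vball R r (fb_rad B).
    apply: (smooth_map_act LA oB (fb_gam_smooth B) (smooth_map_cst _ oB)) => a ar.
    exact: fb_dom2.
  - move=> a ar; rewrite -Bc; apply: (@fb_sub _ _ _ _ _ _ _ _ _ B).
    by rewrite -fb_mapE; exact: fb_box_map.
  - move=> m /N0P [_ Bm am]; have [a [t [ar tr em]]] := fb_boxP Bm.
    exists a => //; rewrite em -fb_mapE; congr (fb_map B (row_mx _ _)).
    by rewrite -az -am em fb_across_map.
have [D DP] := choice H.
have [C [cC CU CO Ccov]] := @orbit_plaques _ _ _ _ _ _ _ LA (fun z => (D z).2) x (dom c)
  (fun z => let: And3 a _ _ := DP z in a) (fun z => let: And3 _ a _ := DP z in a).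
have [enu enuC enuP] := countable_enum x cC.
have enuO k : orbit (V := V) (Psi := Psi) x (enu k) /\ dom c (enu k).
  by case: (enuC k) => [Ck|->]; split=> //; [exact: CO | exact: CU].
pose f k (a : 'rV[R]_r) : 'rV[R]_s := c ((D (enu k)).1.1 a) *m L.
have := @smooth_images_no_interior R r s (fun k => vball r (D (enu k)).1.2) f
  (zeta @` U1) rs _ _ oQ _; apply.
- by move=> k; exact: open_vball.
- move=> k; have [Ok ck] := enuO k; have [_ _ /(_ Ok ck) [sD Dc _]] := DP (enu k).
  have ob := @open_vball R r (D (enu k)).1.2.
  have s1 : smooth_map (vball r (D (enu k)).1.2) (c \o (D (enu k)).1.1 : _ -> euclid R n).
    exact: smooth_map_comp ob (dom_open c) Dc sD (smooth_chart Ac).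
  have s2 : vsmooth_on (vball r (D (enu k)).1.2) (c \o (D (enu k)).1.1).
    exact: (smooth_map_euclid _ ob).2 s1.
  exact: (vsmooth_on_comp ob openT (fun _ _ => Logic.I) s2 sL).
- by exists (zeta (e p0)); exists (e p0).
move=> _ [y Uy <-]; have [q [eq_ [_ cq]] ey] := U1A y Uy.
have Oq : orbit (V := V) (Psi := Psi) x (i q) by rewrite -iO; exists q.
have [z [m [Cz Nm em]]] := Ccov (i q) Oq cq.
have [k ek] := enuP z Cz; exists k => //.
have [_ _ /(_ (CO z Cz) (CU z Cz)) [_ _ /(_ m Nm) [a ar ea]]] := DP z.
exists a; first by rewrite ek.
by rewrite /f ek -ea -em /zeta -ey chartK.
Qed.

(** The two bounds need the two halves of the definition of a submanifold:
    second countability for the upper bound, the immersion for the lower one. *)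
Lemma orbit_rank_dim s c x : orbits_of_dim V Psi s -> atlas c -> dom c x ->
  \rank (orbit_jac (Psi := Psi) cG c x) = s.
Proof.
move=> dimO Ac cx.
have [N [i [_ scN _ imm iO]]] := dimO _ (is_orbit_orbit LA x).
have [si _] := imm; apply/eqP; rewrite eqn_leq.
rewrite (orbit_rank_le Ac cx erefl scN si iO).
exact: orbit_rank_ge Ac cx erefl imm iO.
Qed.

End OrbitDimension.

(** * Invariants of a regular action *)

Section AdaptedBox.
Context {R : realType}.

(** Connected sets of reals are intervals, and a countable set is Lebesgue
    negligible. *)
Lemma countable_connected (A : set R) u v :
  countable A -> connected A -> A u -> A v -> u = v.
Proof.
move=> cA /connected_intervalP iA.
wlog uv : u v / u < v => [W Au Av|Au Av].
  by case: (ltgtP u v) => // h; [exact: W | apply/esym; exact: W].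
have sub : `[u, v] `<=` A.
  by move=> z /=; rewrite in_itv /= => /andP[? ?]; apply: (iA u v) => //; apply/andP.
have cI : countable `[u, v] by apply: sub_countable cA; exact: subset_card_le.
have := countable_lebesgue_measure0 cI.
rewrite lebesgue_measure_itv /= lte_fin uv -EFinD => -[] /eqP.
by rewrite subr_eq0 gt_eqF.
Qed.

Context {d n : nat} {G : lie_group R d} {X : manifold R n}.
Context {V : set (mprod G X)} {Psi : mprod G X -> X}.
Hypothesis LA : local_action V Psi.

Lemma smooth_fb_map r k (B : flowbox (V := V) (Psi := Psi) r k) :
  smooth_map (vball (r + k) (fb_rad B)) (fb_map B).
Proof.
set rad := fb_rad B; have ob := @open_vball R (r + k) rad.
have rad0 : 0 < rad by exact: fb_rad_gt0.
have sl : smooth_map (vball (r + k) rad) (@lsubmx R 1 r k : _ -> euclid R r).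
  by apply/(smooth_map_euclid _ ob); exact: vsmooth_lsubmx.
have sr : smooth_map (vball (r + k) rad) (@rsubmx R 1 r k : _ -> euclid R k).
  by apply/(smooth_map_euclid _ ob); exact: vsmooth_rsubmx.
have ml w : vball (r + k) rad w -> vball r rad (lsubmx w).
  by rewrite /vball /= (norm_sub_lt _ rad0) => /andP[].
have mr w : vball (r + k) rad w -> vball k rad (rsubmx w).
  by rewrite /vball /= (norm_sub_lt _ rad0) => /andP[].
have s1 := smooth_map_comp ob (@open_vball R r rad) ml sl (fb_gam_smooth B).
have s2 := smooth_map_comp ob (@open_vball R k rad) mr sr (fb_sec_smooth B).
exact: (smooth_map_act LA ob s1 s2 (@fb_dom _ _ _ _ _ _ _ _ _ B)).
Qed.

(** Near each point, a regular action looks like translation along the slices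
    [t = cst]: [t] is invariant, [sigma] is a section of it, and [kappa x]
    moves [x] to the point of the section on its slice.

    The coordinate [t] is constant on plaques, so it takes countably many values
    on an orbit. Regularity makes the part of the orbit in a suitable
    neighbourhood connected, and there [t] has one value only: this excludes
    orbits that return to the box in another slice. *)
Lemma adapted_box s x0 : regular_action V Psi -> orbits_of_dim V Psi s ->
  exists (U : set X) (W : set (euclid R (n - s))) (t : X -> euclid R (n - s))
    (sigma : euclid R (n - s) -> X) (kappa : X -> G),
  [/\ [/\ open U, U x0 & open W] /\
      [/\ smooth_map U t, smooth_map W sigma & smooth_map U kappa],
      [/\ forall x, U x -> W (t x), forall w, W w -> U (sigma w) &
          forall w, W w -> t (sigma w) = w],
      forall x, U x -> V (kappa x, x) /\ Psi (kappa x, x) = sigma (t x),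
      forall g x, V (g, x) -> U x -> U (Psi (g, x)) -> t (Psi (g, x)) = t x &
      forall A, open A -> A `<=` U -> open (t @` A)].
Proof.
move=> [_ reg] dimO; have [cG AG eG] := atlas_cover (lone G).
have [c Ac cx] := atlas_cover x0; set k := (n - s)%N.
have [B [Bc B0]] := flowbox_exists LA AG eG Ac cx (orbit_rank_dim LA AG eG dimO Ac cx).
rewrite -/k in B Bc B0.
have [Bx0 _] := fb_across0 LA B0.
set rad := fb_rad B; have rad0 : 0 < rad by exact: fb_rad_gt0.
have b0 j (rho : R) : 0 < rho -> vball j rho 0 by rewrite /vball /= normr0.
have map0 : fb_map B 0 = x0.
  have <- : row_mx 0 0 = 0 :> 'rV[R]_(s + k) by rewrite row_mx0.
  by rewrite fb_mapE fb_gam0 (la_one LA).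
have rB y : fb_box B y -> forall g, V (g, y) -> fb_box B (Psi (g, y)) ->
    (\rank (orbit_jac (Psi := Psi) cG (fb_chart B) (Psi (g, y))) <= s)%N.
  move=> By g Vg Bg; rewrite (orbit_rank_dim LA AG eG dimO) //.
    by rewrite Bc.
  exact: fb_sub Bg.
have H z : exists N : set G, [/\ nbhs (lone G) N, forall m, N m -> V (m, z) &
    fb_box B z -> forall m, N m -> fb_across B (Psi (m, z)) = fb_across B z].
  have [Bz|nB] := pselect (fb_box B z).
    have [N nN NP] := plaque LA AG eG Bz (rB z Bz).
    by exists N; split=> // [m /NP[]|_ m /NP[]].
  exists (act_dom (V := V) z); split=> //.
  by apply: open_nbhs_nbhs; split; [exact: open_act_dom LA z | exact: la_mem1 LA z].
have [N NP] := choice H.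
have nbB : nbhs x0 (fb_box B) by apply: open_nbhs_nbhs; split=> //; exact: fb_open.
have [N0 [nN0 N0B conn]] := reg x0 _ nbB.
have inv x y : N0 x -> N0 y -> orbit (V := V) (Psi := Psi) x y ->
    fb_across B x = fb_across B y.
  move=> N0x N0y Oxy; apply/rowP => j; pose O := orbit (V := V) (Psi := Psi) x.
  have [C [cC CB _ Ccov]] := @orbit_plaques _ _ _ _ _ _ _ LA N x (fb_box B)
    (fun z => let: And3 a _ _ := NP z in a) (fun z => let: And3 _ a _ := NP z in a).
  pose g z : R := fb_across B z ord0 j.
  apply: (@countable_connected (g @` (O `&` N0))).
  - have : countable (g @` C) by exact: countable_image.
    apply: sub_countable; apply: subset_card_le => _ [z [Oz Nz] <-].
    have [y' [m [Cy Nm ->]]] := Ccov z Oz (N0B _ Nz).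
    exists y' => //; rewrite /g; have [_ _ -> //] := NP y'; exact: CB.
  - apply: connected_continuous_connected; first exact: conn (is_orbit_orbit LA x).
    apply: continuous_in_subspaceT => z; rewrite inE => -[_ /N0B Bz].
    have [ca _] := smooth_across B.
    have {}ca : {for z, continuous (fb_across B : X -> 'rV[R]_k)} by exact: ca z Bz.
    exact: (continuous_coord (j := j) ca).
  - by exists x => //; split=> //; exact: orbit_refl.
  - by exists y.
have smap := smooth_fb_map B.
have [rho rho0 [rhor rhoN]] : exists2 rho, 0 < rho & rho <= rad /\
    forall w, vball (s + k) rho w -> N0 (fb_map B w).
  have cmap : {for (0 : 'rV[R]_(s + k)), continuous (fb_map B)}.
    by have [+ _] := smap; apply; exact: b0.
  have : nbhs (0 : 'rV[R]_(s + k)) (fb_map B @^-1` N0).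
    by apply: cmap; rewrite map0.
  move=> /nbhs_ballP [r /= r0 rN]; exists (Num.min r rad); first by rewrite lt_min r0.
  split; first by rewrite ge_min lexx orbT.
  move=> w; rewrite /vball /= lt_min => /andP[wr _]; apply: rN.
  by rewrite -ball_normE /ball_ /= sub0r normrN.
have brad j : vball j rho `<=` vball j rad.
  by move=> w; rewrite /vball /= => /lt_le_trans; exact.
pose U := fb_map B @` vball (s + k) rho.
have UE : U = fb_box B `&` fb_inv B @^-1` vball (s + k) rho.
  apply/seteqP; split=> [_ [w wr <-]|_ [[w wr <-]]].
    by split; [exists w => //; exact: brad | rewrite /= fb_mapK //; exact: brad].
  by rewrite /= fb_mapK // => wr'; exists w.
have oU : open U.
  rewrite UE.
  apply: (smooth_open_preimage (fb_open B) (@fb_inv_smooth _ _ _ _ _ _ _ _ _ B)).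
  exact: open_vball.
have UB : U `<=` fb_box B by rewrite UE => x [].
have UN : U `<=` N0 by move=> _ [w wr <-]; exact: rhoN.
have UP x : U x -> exists a w,
    [/\ vball s rho a, vball k rho w & x = fb_map B (row_mx a w)].
  move=> [w wr <-]; exists (lsubmx w), (rsubmx w).
  move: wr; rewrite /vball /= (norm_sub_lt _ rho0) => /andP[? ?].
  by split=> //; rewrite hsubmxK.
have Umap a w : vball s rho a -> vball k rho w -> U (fb_map B (row_mx a w)).
  by move=> ar wr; exists (row_mx a w) => //; rewrite /vball /= norm_row_mx_lt // ar.
have sec0 w : fb_sec B w = fb_map B (row_mx 0 w).
  by rewrite fb_mapE fb_gam0 (la_one LA).
exists U, (vball k rho), (fb_across B), (fb_sec B),
  (fun x => linv (fb_gam B (fb_along B x))).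
split.
- split.
    split=> //; last exact: open_vball.
    by exists 0; [exact: b0 | exact: map0].
  split.
  + exact: smooth_map_sub UB (smooth_across B).
  + exact: smooth_map_sub (brad k) (fb_sec_smooth B).
  + have s1 : smooth_map U (fb_gam B \o fb_along B).
      apply: (smooth_map_comp oU (@open_vball R s rad) _ _ (fb_gam_smooth B)).
        by move=> x /UP [a [w [/brad ar /brad wr ->]]]; rewrite fb_along_map.
      exact: smooth_map_sub UB (smooth_along B).
    exact: smooth_map_comp oU openT (fun _ _ => Logic.I) s1 (linv_smooth G).
- split.
  + by move=> x /UP [a [w [ar wr ->]]]; rewrite fb_across_map //; exact: brad.
  + by move=> w wr; rewrite sec0; apply: Umap => //; exact: b0.
  + by move=> w wr; rewrite sec0 fb_across_map //; [exact: b0 | exact: brad].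
- move=> x /UP [a [w [/brad ar /brad wr ->]]].
  rewrite fb_along_map // fb_across_map // fb_mapE.
  exact: (la_inv LA (fb_dom2 ar wr)).
- move=> g x Vg Ux Ug; apply/esym; apply: inv; [exact: UN|exact: UN|].
  exact: orbit_act (@orbit_refl _ _ _ _ _ _ _ x) Vg.
- move=> A oA AU; rewrite openE => _ [x Ax <-].
  have [a [w [/brad ar /brad wr xE]]] := UP x (AU x Ax).
  rewrite xE fb_across_map //.
  pose f (v : 'rV[R]_k) : X := Psi (fb_gam B a, fb_sec B v).
  have sf : smooth_map (vball k rad) f.
    have ob := @open_vball R k rad.
    apply: (smooth_map_act LA ob (smooth_map_cst _ ob) (fb_sec_smooth B)) => v vr.
    exact: fb_dom2.
  have : open (vball k rad `&` f @^-1` A).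
    exact: smooth_open_preimage (@open_vball R k rad) sf oA.
  rewrite openE => /(_ w); rewrite /f /= -fb_mapE -xE => /(_ (conj wr Ax)).
  apply: filterS => v [vr Av]; exists (f v) => //.
  by rewrite /f -fb_mapE fb_across_map.
Qed.

End AdaptedBox.

(** * Iterated derivatives of composites, and bump functions *)

Section IteratedDerivatives.
Context {R : realType}.

Lemma pderivs_eq n (A : set 'rV[R]_n) f g s : open A -> {in A, f =1 g} ->
  {in A, pderivs s f =1 pderivs s g}.
Proof.
move=> oA fg; elim: s => [//|i s IH] x; rewrite inE => Ax /=.
exact: near_eq_derive (near_eq_in oA Ax IH).
Qed.

Lemma smooth_on_pderivs n (A : set 'rV[R]_n) f s :
  smooth_on A f -> smooth_on A (pderivs s f).
Proof. by move=> sf t x Ax; rewrite -pderivs_cat; exact: sf. Qed.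

(** The formula of Faa di Bruno, without its combinatorics: iterated
    derivatives of [f \o phi] are combinations of those of [f] along [phi],
    with smooth coefficients that do not depend on [f]. *)
Lemma pderivs_comp n m (A : set 'rV[R]_n) (B : set 'rV[R]_m)
    (phi : 'rV[R]_n -> 'rV[R]_m) (s : seq 'I_n) :
  open A -> open B -> (forall x, A x -> B (phi x)) -> vsmooth_on A phi ->
  exists (I : finType) (c : I -> 'rV[R]_n -> R) (w : I -> seq 'I_m),
  [/\ forall i, smooth_on A (c i), forall i, (size (w i) <= size s)%N &
      forall f, smooth_on B f -> forall x, A x ->
        pderivs s (f \o phi) x = \sum_i c i x * pderivs (w i) f (phi x)].
Proof.
move=> oA oB AB sphi; elim: s => [|l s [I [c [w [sc sw E]]]]].
  exists unit, (fun _ => cst 1), (fun _ => [::]); split=> // [_|f _ x _].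
    exact: smooth_on_cst.
  by rewrite (big_pred1 tt) /= ?mul1r // => -[].
pose Dphi k := 'D_('e_l) (fun z => phi z ord0 k).
exists (I + I * 'I_m)%type,
  (fun i => match i with inl i => 'D_('e_l) (c i)
            | inr p => fun x => c p.1 x * Dphi p.2 x end),
  (fun i => match i with inl i => w i | inr p => p.2 :: w p.1 end).
split=> [[i|[i k]]|[i|[i k]]|f sf x Ax].
- exact: smooth_onD1.
- by apply: smooth_onM => //; exact: smooth_onD1.
- exact: leqW (sw i).
- exact: sw.
rewrite big_sumType /=.
rewrite -(pair_bigA _ (fun i k =>
  c i x * Dphi k x * pderivs (k :: w i) f (phi x))) /=.
have E' : {in A, pderivs s (f \o phi) =1
    fun x => \sum_i c i x * pderivs (w i) f (phi x)}.
  by move=> y; rewrite inE => Ay; exact: E.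
rewrite (near_eq_derive _ (near_eq_in oA Ax E')).
have dw i : is_derive x 'e_l (pderivs (w i) f \o phi)
    (\sum_k Dphi k x * pderivs (k :: w i) f (phi x)).
  apply: (is_derive_comp oB (AB _ Ax)) => [p k Bp|k|k].
  - by have [_] := sf (w i) p Bp.
  - by have [] := sf (k :: w i) (phi x) (AB _ Ax).
  - by have [_] := sphi k [::] x Ax.
have dci i : derivable (c i) x 'e_l by have [_] := sc i [::] x Ax.
have -> : (fun x => \sum_i c i x * pderivs (w i) f (phi x)) =
    \sum_(j < #|I|) (fun x => c (enum_val j) x * (pderivs (w (enum_val j)) f \o phi) x).
  apply/funext => y; rewrite fct_sumE (reindex (@enum_val I I)) /=; last first.
    by exists enum_rank => i _; rewrite ?enum_valK ?enum_rankK.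
  by apply: eq_bigr.
rewrite derive_sum; last first.
  by move=> j; apply: derivableM => //; have [] := dw (enum_val j).
rewrite -big_split /= [RHS](reindex (@enum_val I I)) /=; last first.
  by exists enum_rank => i _; rewrite ?enum_valK ?enum_rankK.
apply: eq_bigr => j _.
set i := enum_val j; have [dwi dwiE] := dw i.
rewrite (deriveM (dci i) dwi) dwiE.
rewrite /GRing.scale /= [LHS]addrC [X in X + _ = _]mulrC mulr_sumr; congr (_ + _).
by apply: eq_bigr => k _; rewrite mulrA.
Qed.

(** Differential operators are written with one coefficient for each word of
    partial derivatives; this collects the terms that share a word. *)
Lemma words_sum m (I : finType) (c : I -> R) (w : I -> seq 'I_m)
    (g : seq 'I_m -> R) k : (forall i, (size (w i) <= k)%N) ->
  \sum_i c i * g (w i) =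
  \sum_(j < k.+1) \sum_(t : j.-tuple 'I_m) (\sum_(i | w i == t) c i) * g t.
Proof.
move=> sw.
under [RHS]eq_bigr => j _ do under eq_bigr => t _ do rewrite mulr_suml big_mkcond /=.
under [RHS]eq_bigr => j _ do rewrite exchange_big /=.
rewrite exchange_big /=; apply: eq_bigr => i _.
have sk : (size (w i) < k.+1)%N by rewrite ltnS.
rewrite (bigD1 (Ordinal sk)) //= (bigD1 (in_tuple (w i))) //= eqxx.
rewrite big1 ?addr0 => [|t]; last first.
  by move=> tn; case: eqVneq => // e; case/eqP: tn; apply/val_inj/esym.
rewrite big1 ?addr0 // => j jn; rewrite big1 // => t _.
case: eqVneq => // e; case/eqP: jn; apply/val_inj => /=.
by rewrite e size_tuple.
Qed.

End IteratedDerivatives.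

Section Bump.
Context {R : realType}.

(** Each derivative of [exp (- 1 / u)] is a combination of the functions
    [u ^- k * exp (- 1 / u)], which vanish to first order at 0. *)
Definition flat k (u : R) : R := if 0 < u then u ^- k * expR (- u^-1) else 0.

Lemma flat_bound k u : `|flat k u| <= (k.+1)`!%:R * `|u|.
Proof.
rewrite /flat; case: ltP => u0; last by rewrite normr0 mulr_ge0.
have p : 0 <= u ^- k * expR (- u^-1).
  by rewrite mulr_ge0 ?expR_ge0 // invr_ge0 exprn_ge0 // ltW.
rewrite (ger0_norm p) (gtr0_norm u0) expRN ler_pdivrMr ?expR_gt0 //.
have h : u^-1 ^+ k.+1 <= k.+1`!%:R * expR u^-1.
  have u1 : 0 <= u^-1 by rewrite invr_ge0 ltW.
  rewrite mulrC -ler_pdivrMr ?ltr0n ?fact_gt0 //.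
  by apply: le_trans (expR_ge1Dxn k u1); rewrite lerDr.
have -> : u ^- k = u^-1 ^+ k.+1 * u by rewrite exprSr mulfVK ?exprVn // gt_eqF.
by rewrite mulrAC ler_pM2r.
Qed.

Lemma is_derive_flat k (u : R) :
  is_derive u 1 (flat k) (flat k.+2 u - k%:R * flat k.+1 u).
Proof.
have [u0|u0|->] := ltgtP u 0.
- have -> : flat k.+2 u - k%:R * flat k.+1 u = 0.
    by rewrite /flat ltNge ltW //= mulr0 subr0.
  apply: near_eq_is_derive (is_derive_cst (0 : R) u 1).
  have : \near u, u < 0 by exact: lt_nbhsl.
  by apply: filterS => v v0; rewrite /flat ltNge ltW.
- have e : \near u, u ^- k * expR (- u^-1) = flat k u.
    have : \near u, 0 < u by exact: lt_nbhsr.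
    by apply: filterS => v v0; rewrite /flat v0.
  apply: near_eq_is_derive e _.
  have un0 : u != 0 by rewrite gt_eqF.
  have ukn0 : u ^+ k != 0 by rewrite expf_neq0.
  have d1 : is_derive u 1 (fun v => v ^- k) (- (u ^+ k) ^- 2 * (k%:R * u ^+ k.-1)).
    split; first by apply: derivableV => //; exact: exprn_derivable.
    rewrite (@deriveV _ _ (fun v : R => v ^+ k) u 1 ukn0 (@exprn_derivable R k u 1)).
    by rewrite exp_derive /GRing.scale /= mulr1.
  have d2 : is_derive u 1 (fun v => - v^-1) (u ^- 2).
    split; first by apply: derivableN; apply: derivableV => //; exact: derivable_id.
    rewrite deriveN; last by apply: derivableV => //; exact: derivable_id.
    rewrite (deriveV (f := id) un0); last exact: derivable_id.
    by rewrite derive_id /GRing.scale /= mulr1 opprK.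
  have d3 := @is_derive1_comp _ expR (fun v : R => - v^-1) u _ _
    (is_derive_expR (- u^-1)) d2.
  have d4 := is_deriveM d1 d3.
  apply: is_derive_eq d4 _.
  rewrite /GRing.scale /= /flat u0; case: k {d1 ukn0} => [|k] /=.
    by field.
  by rewrite !exprS; field; rewrite expf_neq0.
- have f0 l : flat l 0 = 0 by rewrite /flat ltxx.
  rewrite !f0 mulr0 subr0.
  have L : h^-1 *: ((flat k \o shift 0) (h *: 1) - flat k 0) @[h --> 0^'] --> (0 : R).
    have fE h : h^-1 *: ((flat k \o shift 0) (h *: 1) - flat k 0) = flat k.+1 h.
      rewrite /GRing.scale /= mulr1 addr0 f0 subr0 /flat.
      case: ltP => h0; last by rewrite mulr0.
      by rewrite exprS invfM mulrA.
    under eq_fun do rewrite fE.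
    apply/cvgrPdist_le => e e0.
    pose C : R := k.+2`!%:R; have C0 : 0 < C by rewrite ltr0n fact_gt0.
    near=> h; rewrite sub0r normrN (le_trans (flat_bound _ _)) //.
    rewrite -/C -ler_pdivlMl // ltW //; near: h; apply: dnbhs0_lt.
    by rewrite mulr_gt0 // invr_gt0.
  by split; [apply/cvg_ex; eexists; exact: L | exact: cvg_lim L].
Unshelve. all: by end_near. Qed.

Lemma Ck_flat j k : Ck j [set: 'rV[R]_1] (fun v => flat k (v ord0 ord0)).
Proof.
have d l (v : 'rV[R]_1) (i : 'I_1) : is_derive v 'e_i (fun v => flat l (v ord0 ord0))
    (flat l.+2 (v ord0 ord0) - l%:R * flat l.+1 (v ord0 ord0)).
  have [df <-] := is_derive_flat l (v ord0 ord0).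
  have E : (fun h : R => h^-1 *: (((fun v : 'rV[R]_1 => flat l (v ord0 ord0)) \o shift v)
      (h *: 'e_i) - flat l (v ord0 ord0))) =
    (fun h : R => h^-1 *: ((flat l \o shift (v ord0 ord0)) (h *: 1)
      - flat l (v ord0 ord0))).
    by apply/funext => h /=; rewrite !mxE (ord1 i) !eqxx.
  by split; rewrite /derivable /derive E.
have cf l (v : 'rV[R]_1) : {for v, continuous (fun v : 'rV[R]_1 => flat l (v ord0 ord0))}.
  apply: (@continuous_comp _ _ _ (fun v : 'rV[R]_1 => v ord0 ord0) (flat l)).
    exact: coord_continuous.
  apply/differentiable_continuous/derivable1_diffP.
  by have [] := is_derive_flat l (v ord0 ord0).
elim: j k => [|j IH] k; first by split=> // v _; exact: cf.
split; first by move=> v _; exact: cf.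
split=> [i v _|i]; first by have [] := d k v i.
have -> : 'D_('e_i) (fun v : 'rV[R]_1 => flat k (v ord0 ord0)) =
    fun v => flat k.+2 (v ord0 ord0) + (- k%:R) * flat k.+1 (v ord0 ord0).
  by apply/funext => v; have [_ ->] := d k v i; rewrite mulNr.
apply: (CkD openT (IH k.+2)); apply: (CkM openT _ (IH k.+1)).
exact: (@Ck_cst _ _ _ _ (- k%:R)).
Qed.

(** A product of flat functions of [r ^ 2 - (y_i - p_i) ^ 2], as the ball is a
    cube. *)
Lemma bump n (p : 'rV[R]_n) r : 0 < r -> exists chi : 'rV[R]_n -> R,
  [/\ smooth_on setT chi, chi p != 0 &
      forall y, r <= `|y - p| -> chi y = 0].
Proof.
move=> r0; pose f i (y : 'rV[R]_n) := r ^+ 2 - (y ord0 i - p ord0 i) ^+ 2.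
have sf i : smooth_on setT (f i).
  have s1 : smooth_on setT (fun y : 'rV[R]_n => y ord0 i - p ord0 i).
    apply: (smooth_onB openT); first exact: smooth_on_coord.
    exact: smooth_on_cst.
  exact: (smooth_onB openT (@smooth_on_cst _ _ _ (r ^+ 2)) (smooth_onM openT s1 s1)).
have sff i : smooth_on setT (fun y => flat 0 (f i y)).
  have sM : vsmooth_on setT (fun y => (f i y)%:M : 'rV[R]_1).
    move=> j; apply: smooth_on_eq openT _ (sf i) => y _.
    by rewrite scalar_rV1E.
  have sfl : smooth_on [set: 'rV[R]_1] (fun v => flat 0 (v ord0 ord0)).
    by apply/smooth_Ck => j; exact: Ck_flat.
  apply: smooth_on_eq openT _ (smooth_on_comp openT openT (fun _ _ => Logic.I) sM sfl).
  by move=> y _; rewrite /= scalar_rV1E.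
exists (fun y => \prod_i flat 0 (f i y)); split=> [||y ry].
- elim: (index_enum _) => [|i l IH].
    apply: smooth_on_eq openT _ (@smooth_on_cst _ _ _ 1) => y _.
    by rewrite big_nil.
  have H := smooth_onM openT (sff i) IH.
  by apply: smooth_on_eq openT _ H => y _; rewrite big_cons.
- apply/prodf_neq0 => i _; rewrite /f subrr expr0n subr0 /flat exprn_gt0 //.
  by rewrite mulf_neq0 ?invr_eq0 ?expr0 ?oner_neq0 // gt_eqF ?expR_gt0.
have [i ri] : exists i, r <= `|y ord0 i - p ord0 i|.
  apply: contrapT => H; move: ry; rewrite leNgt => /negP; apply.
  apply/mx_norm_ltP => // i; rewrite !mxE ltNge; apply/negP => ri.
  by apply: H; exists i.
apply/eqP; rewrite prodf_seq_eq0; apply/hasP; exists i.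
  by rewrite mem_index_enum.
rewrite /flat ifF ?eqxx //; apply/negbTE; rewrite -leNgt /f subr_le0.
by rewrite -[leRHS]real_normK ?num_real // lerXn2r // nnegrE // ltW.
Qed.

End Bump.

(** * Differential operators and composition *)

Section Operators.
Context {R : realType}.

(** In a Hausdorff space the compact image of a closed ball in a chart is
    closed, so that a function supported in it extends by 0. *)
Lemma manifold_bump m (M : manifold R m) (c : @chart R M m) p (O : set M) :
  hausdorff_space M -> atlas c -> dom c p -> open O -> O p ->
  exists (chi : M -> R) (K : set M),
    [/\ msmooth setT chi, chi p != 0, closed K, K `<=` dom c `&` O &
        forall x, ~ K x -> chi x = 0].
Proof.
move=> hM Ac cp oO Op.
have oB : open (c @` (dom c `&` O)) by exact: open_chart_image.
have Bp : (c @` (dom c `&` O)) (c p) by exists p.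
have [r r0 rB] := norm_ball_in oB Bp.
have [chi [schi chip chi0]] := bump (c p) r0.
pose K := chart_inv c @` [set y | `|y - c p| <= r].
have KO : K `<=` dom c `&` O.
  by move=> _ [y /rB [x [cx Ox] <-] <-]; rewrite chartK.
have cK : closed K.
  apply: compact_closed => //; apply: continuous_compact.
    apply: continuous_in_subspaceT => y; rewrite inE => /rB [x [cx _] <-].
    by apply: chart_inv_continuous; exists x.
  apply: bounded_closed_compact; last exact: closed_norm_ball.
  exists (r + `|c p|); split; first exact: num_real.
  move=> e he z /= zq; rewrite (le_trans _ (ltW he)) //.
  by rewrite -[z](subrK (c p)) (le_trans (ler_normD _ _)) // lerD2r.
pose chiM x := if `[< dom c x >] then chi (c x) else 0.
have chiK x : ~ K x -> chiM x = 0.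
  move=> nK; rewrite /chiM; case: asboolP => // cx; apply: chi0.
  rewrite leNgt; apply/negP => /ltW xr; apply: nK; exists (c x) => //.
  by rewrite chartK.
exists chiM, K; split=> //; last by rewrite /chiM; case: asboolP.
apply: msmooth_loc => x _; have [cx|ncx] := pselect (dom c x).
  exists (dom c); split=> //; first exact: dom_open.
  have s : msmooth (dom c) (chi \o c).
    apply: (@msmooth_comp R _ _ M (euclid R m) (dom c) setT c chi (dom_open c)
      openT (fun _ _ => Logic.I) (smooth_chart Ac)).
    exact: (msmooth_euclid setT chi).1 schi.
  apply: msmooth_eq (dom_open c) _ s => y; rewrite inE => cy.
  by rewrite /chiM /=; case: asboolP.
exists (~` K); split; first exact: closed_openC.
  by move=> /KO [].
apply: (msmooth_eq _ _ (@msmooth_cst R _ M (~` K) 0)); first exact: closed_openC.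
by move=> y; rewrite inE => /chiK ->.
Qed.

Definition chart_op m (M : manifold R m) (chi : M -> R) (c : @chart R M m)
    (w : seq 'I_m) (f : M -> R) (x : M) : R :=
  chi x * pderivs w (f \o chart_inv c) (c x).

(** Moderateness only speaks of operators defined on all of [U]. Cut off by
    [chi], the derivatives in one chart become such operators: [pderivs_comp]
    gives the coefficients in the other charts, and [chi] makes them vanish
    smoothly where the chart ends. *)
Lemma diffop_chart_op m (M : manifold R m) (U : set M) (chi : M -> R)
    (c : @chart R M m) (K : set M) (w : seq 'I_m) :
  open U -> atlas c -> msmooth setT chi -> closed K -> K `<=` dom c ->
  (forall x, ~ K x -> chi x = 0) -> diffop U (chart_op chi c w).
Proof.
move=> oU Ac schi cK Kc chi0; exists (size w) => c' Ac'.
pose W := dom c' `&` U; have oW : open W by apply: openI => //; exact: dom_open.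
pose A := c @` (dom c `&` W); have oA : open A by exact: open_chart_image.
pose B := c' @` W; have oB : open B by exact: open_chart_image.
pose phi := c' \o chart_inv c.
have AB y : A y -> B (phi y).
  by move=> [x [cx Wx] <-]; exists x => //=; rewrite /phi /= chartK.
have sphi : vsmooth_on A phi.
  apply: vsmooth_on_sub (atlas_compat Ac Ac') => _ [x [cx [cx' _]] <-].
  by exists x.
have [I [b [ww [sb sw E]]]] := pderivs_comp w oA oB AB sphi.
exists (fun t x => chi x * \sum_(i | ww i == t) b i (c x)); split=> [t|f sf x cx' Ux].
  apply: msmooth_loc => x Wx; have [cx|ncx] := pselect (dom c x).
    exists (dom c `&` W); split=> //; first by apply: openI => //; exact: dom_open.
    have oCW : open (dom c `&` W) by apply: openI => //; exact: dom_open.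
    apply: msmoothM => //; first exact: msmooth_sub schi.
    have sS : smooth_on A (fun y => \sum_(i | ww i == t) b i y).
      exact: smooth_on_sum oA sb.
    have sS' : msmooth (A : set (euclid R m)) (fun y => \sum_(i | ww i == t) b i y).
      exact: (msmooth_euclid A _).1 sS.
    have scW : smooth_map (dom c `&` W) (c : M -> euclid R m).
      by apply: smooth_map_sub (smooth_chart Ac) => y [].
    have mp y : (dom c `&` W) y -> A (c y) by exists y.
    exact: (@msmooth_comp R _ _ M (euclid R m) _ A c _ oCW oA mp scW sS').
  have oK : open (~` K) by exact: closed_openC.
  exists (~` K); split=> //; first by move=> /Kc.
  apply: (msmooth_eq oK _ (@msmooth_cst R _ M (~` K) 0)).
  by move=> y; rewrite inE => /chi0 ->; rewrite mul0r.
rewrite /chart_op; have [Kx|nK] := pselect (K x); last first.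
  rewrite chi0 // mul0r big1 // => j _; rewrite big1 // => t _.
  by rewrite !mul0r.
have cx := Kc x Kx; have Ax : A (c x) by exists x.
have fE : {in A, f \o chart_inv c =1 (f \o chart_inv c') \o phi}.
  by move=> y; rewrite inE => -[z [cz [cz' _]] <-]; rewrite /phi /= (chartK cz) chartK.
rewrite (pderivs_eq w oA fE) ?inE // (E _ (sf c' Ac') _ Ax).
have -> : phi (c x) = c' x by rewrite /phi /= chartK.
rewrite (words_sum (fun i => b i (c x))
  (fun t => pderivs t (f \o chart_inv c') (c' x)) sw).
rewrite mulr_sumr; apply: eq_bigr => j _; rewrite mulr_sumr.
by apply: eq_bigr => t _; rewrite mulrA.
Qed.

Lemma continuous_sum (T : topologicalType) I (r : seq I) (P : pred I)
    (f : I -> T -> R) x : (forall i, {for x, continuous (f i)}) ->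
  {for x, continuous (fun y => \sum_(i <- r | P i) f i y)}.
Proof.
by move=> cf; apply: cvg_big => [|i _]; [exact: add_continuous | exact: cf].
Qed.

(** The definition only determines [P f] on [U], and only for smooth [f]; so
    the continuity, locality and additivity of [P] are read in a chart. *)
Lemma diffop_continuous m (M : manifold R m) (U : set M) P f x : open U ->
  diffop U P -> msmooth U f -> U x -> {for x, continuous (P f)}.
Proof.
move=> oU [k Pk] sf Ux; have [c Ac cx] := atlas_cover x.
have [a [sa aE]] := Pk c Ac.
have oW : open (dom c `&` U) by apply: openI => //; exact: dom_open.
have nW : nbhs x (dom c `&` U) by exact: open_nbhs_nbhs.
apply: (@near_eq_continuous _ _ (fun x => \sum_(j < k.+1) \sum_(t : j.-tuple 'I_m)
   a t x * pderivs t (f \o chart_inv c) (c x))).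
  by apply: filterS nW => y [cy Uy]; rewrite aE.
apply: continuous_sum => j; apply: continuous_sum => t; apply: continuousM.
  exact: (@msmooth_continuous R _ M (dom c `&` U)).
have : {for c x, continuous (pderivs t (f \o chart_inv c))}.
  apply: (@smooth_on_continuous R _ (c @` (dom c `&` U))); last by exists x.
  by apply: smooth_on_pderivs; exact: sf.
exact: continuous_comp (chart_continuous cx).
Qed.

Lemma diffop_loc m (M : manifold R m) (U : set M) P f g x : open U ->
  diffop U P -> msmooth U f -> msmooth U g -> {in U, f =1 g} -> U x ->
  P f x = P g x.
Proof.
move=> oU [k Pk] sf sg fg Ux; have [c Ac cx] := atlas_cover x.
have [a [sa aE]] := Pk c Ac; rewrite !aE //.
have oW := open_chart_image c oU.
apply: eq_bigr => j _; apply: eq_bigr => t _; congr (_ * _).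
apply: (pderivs_eq t oW); last by rewrite inE; exists x.
by move=> y; rewrite inE => -[z [cz Uz] <-]; rewrite /= chartK // fg // inE.
Qed.

Lemma pderivsD n (A : set 'rV[R]_n) f g s x : open A -> smooth_on A f ->
  smooth_on A g -> A x ->
  pderivs s (fun x => f x + g x) x = pderivs s f x + pderivs s g x.
Proof.
move=> oA sf sg; elim: s x => [//|i s IH] x Ax /=.
have E : {in A, pderivs s (fun x => f x + g x) =1
    (fun x => pderivs s f x + pderivs s g x)}.
  by move=> y; rewrite inE => /IH.
rewrite (near_eq_derive _ (near_eq_in oA Ax E)).
rewrite (deriveD (f := pderivs s f) (g := pderivs s g)) //.
  by have [_] := sf s x Ax.
by have [_] := sg s x Ax.
Qed.

Lemma diffopD m (M : manifold R m) (U : set M) P f g x : open U ->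
  diffop U P -> msmooth U f -> msmooth U g -> U x ->
  P (fun y => f y + g y) x = P f x + P g x.
Proof.
move=> oU [k Pk] sf sg Ux; have [c Ac cx] := atlas_cover x.
have [a [sa aE]] := Pk c Ac; rewrite !aE //; last exact: msmoothD.
have oW := open_chart_image c oU.
rewrite -big_split; apply: eq_bigr => j _ /=.
rewrite -big_split; apply: eq_bigr => t _ /=.
rewrite -mulrDr; congr (_ * _).
by apply: (pderivsD t oW (sf c Ac) (sg c Ac)); exists x.
Qed.

End Operators.

Section Domination.
Context {R : realType} {m n : nat} {M' : manifold R m} {M : manifold R n}.
Context {U' : set M'} {U : set M} {F : M' -> M}.
Hypotheses (hM : hausdorff_space M) (oU' : open U') (oU : open U).
Hypotheses (F_U : forall x, U' x -> U (F x)) (sF : smooth_map U' F).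

Lemma msmooth_pull f : msmooth U f -> msmooth U' (f \o F).
Proof. exact: msmooth_comp. Qed.

(** The estimate that transfers growth conditions from [f] to [f \o F]. It is
    uniform in [f], hence applies to all the members of a net at once, and asks
    for nothing but finitely many operators on the target. *)
Definition dominated (S : set M') (Phi : (M -> R) -> M' -> R) : Prop :=
  exists (I : finType) (Q : I -> (M -> R) -> M -> R) (C : R),
  [/\ forall i, diffop U (Q i), 0 <= C &
      forall f x, msmooth U f -> S x -> `|Phi f x| <= C * \sum_i `|Q i f (F x)|].

Lemma dominated0 (S : set M') : dominated S (fun _ _ => 0).
Proof.
exists 'I_0, (fun _ f => f), 0; split=> // [[]//|f x _ _].
by rewrite normr0 mul0r.
Qed.

Lemma dominatedP S1 S2 Phi1 Phi2 : dominated S1 Phi1 -> dominated S2 Phi2 ->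
  exists (I : finType) (Q : I -> (M -> R) -> M -> R) (C : R),
  [/\ forall i, diffop U (Q i), 0 <= C,
      forall f x, msmooth U f -> S1 x -> `|Phi1 f x| <= C * \sum_i `|Q i f (F x)| &
      forall f x, msmooth U f -> S2 x -> `|Phi2 f x| <= C * \sum_i `|Q i f (F x)|].
Proof.
move=> [I1 [Q1 [C1 [d1 C10 E1]]]] [I2 [Q2 [C2 [d2 C20 E2]]]].
exists (I1 + I2)%type, (fun i => match i with inl i => Q1 i | inr i => Q2 i end).
exists (C1 + C2); split=> [[i|i]//||f x sf Sx|f x sf Sx]; first exact: addr_ge0.
  rewrite big_sumType /=; apply: le_trans (E1 f x sf Sx) _.
  by rewrite ler_pM ?sumr_ge0 ?lerDl ?sumr_ge0.
rewrite big_sumType /=; apply: le_trans (E2 f x sf Sx) _.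
by rewrite ler_pM ?sumr_ge0 ?lerDr ?sumr_ge0.
Qed.

Lemma dominatedU S1 S2 Phi : dominated S1 Phi -> dominated S2 Phi ->
  dominated (S1 `|` S2) Phi.
Proof.
move=> D1 D2; have [I [Q [C [dQ C0 E1 E2]]]] := dominatedP D1 D2.
exists I, Q, C; split=> // f x sf [Sx|Sx]; [exact: E1 | exact: E2].
Qed.

Lemma dominated_sub S1 S2 Phi : S1 `<=` S2 -> dominated S2 Phi -> dominated S1 Phi.
Proof.
move=> S12 [I [Q [C [dQ C0 E]]]]; exists I, Q, C; split=> // f x sf /S12.
exact: E.
Qed.

Definition dominated_near (p : M') Phi := exists2 S, nbhs p S & dominated S Phi.

Lemma dominated_near_eq p Phi Phi' S : nbhs p S ->
  (forall f x, msmooth U f -> S x -> Phi f x = Phi' f x) ->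
  dominated_near p Phi' -> dominated_near p Phi.
Proof.
move=> nS e [S' nS' [I [Q [C [dQ C0 E]]]]]; exists (S `&` S'); first exact: filterI.
by exists I, Q, C; split=> // f x sf [Sx S'x]; rewrite e //; exact: E.
Qed.

Lemma dominated_near_sum p I (r : seq I) Phi :
  (forall i, dominated_near p (Phi i)) ->
  dominated_near p (fun f x => \sum_(i <- r) Phi i f x).
Proof.
move=> DP; elim: r => [|i r [S nS DS]].
  exists setT; first exact: filterT.
  have [J [Q [C [dQ C0 E]]]] := dominated0 setT.
  by exists J, Q, C; split=> // f x sf Sx; rewrite big_nil; exact: E.
have [S' nS' DS'] := DP i; exists (S' `&` S); first exact: filterI.
have [J [Q [C [dQ C0 E1 E2]]]] := dominatedP DS' DS.
exists J, Q, (C + C); split=> // [|f x sf [S'x Sx]]; first exact: addr_ge0.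
rewrite big_cons (le_trans (ler_normD _ _)) // mulrDl lerD //; first exact: E1.
exact: E2.
Qed.

Lemma dominated_near_mul p (g : M' -> R) Phi : {for p, continuous g} ->
  dominated_near p Phi -> dominated_near p (fun f x => g x * Phi f x).
Proof.
move=> cg [S nS [I [Q [C [dQ C0 E]]]]].
have ng : \forall x \near p, `|g x| <= `|g p| + 1.
  have : \forall x \near p, `|g p - g x| < 1.
    by move: cg => /cvgrPdist_lt; apply.
  apply: filterS => x gx; rewrite -[g x](subrK (g p)) addrC.
  by rewrite (le_trans (ler_normD _ _)) // lerD2l distrC ltW.
exists (S `&` [set x | `|g x| <= `|g p| + 1]); first exact: filterI.
exists I, Q, ((`|g p| + 1) * C); split=> // [|f x sf [Sx gx]].
  by rewrite mulr_ge0 // addr_ge0.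
by rewrite normrM -mulrA ler_pM //; exact: E.
Qed.

(** In charts [P (f \o F)] is a combination of derivatives of [f] along [F],
    with continuous coefficients. Each derivative is a cut-off operator divided
    by the value of the cut-off function, which stays away from 0 near [p]. *)
Lemma dominated_near_diffop p P : diffop U' P -> U' p ->
  dominated_near p (fun f => P (f \o F)).
Proof.
move=> [k Pk] Up; have [c' Ac' cp'] := atlas_cover p.
have [c Ac cp] := atlas_cover (F p).
have [a [sa aE]] := Pk c' Ac'.
have [chi [K [schi chip cK KcU chi0]]] := manifold_bump hM Ac cp oU (F_U Up).
have Kc : K `<=` dom c by move=> y /KcU [].
pose D := U' `&` F @^-1` dom c.
have oD : open D by exact: smooth_open_preimage oU' sF (dom_open c).
pose A := c' @` (dom c' `&` D); have oA : open A by exact: open_chart_image.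
pose B := c @` (dom c `&` U); have oB : open B by exact: open_chart_image.
pose phi := c \o F \o chart_inv c'.
have AB y : A y -> B (phi y).
  move=> [x [cx [Ux cFx]] <-]; exists (F x); first by split=> //; exact: F_U.
  by rewrite /phi /= chartK.
have sphi : vsmooth_on A phi.
  have [_ s] := sF; apply: vsmooth_on_sub (s c' c Ac' Ac) => _ [x [cx [Ux cFx]] <-].
  by exists x.
have cF : {for p, continuous F} by have [+ _] := sF; exact.
pose base w (f : M -> R) (x : M') := pderivs w (f \o chart_inv c) (c (F x)).
have dbase w : dominated_near p (base w).
  pose S := [set x | `|chi (F p)| / 2 <= `|chi (F x)|].
  have chip0 : 0 < `|chi (F p)| / 2 by rewrite divr_gt0 // normr_gt0.
  exists S.
    have cchi : {for p, continuous (chi \o F)}.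
      apply: continuous_comp cF _.
      exact: (@msmooth_continuous R _ M setT chi (F p) openT schi Logic.I).
    have : \forall x \near p, `|chi (F p) - chi (F x)| < `|chi (F p)| / 2.
      by move: cchi => /cvgrPdist_lt; apply.
    apply: filterS => x h; rewrite /S /=.
    have := ler_normD (chi (F p) - chi (F x)) (chi (F x)); rewrite subrK.
    by move: h; lra.
  exists unit, (fun _ => chart_op chi c w), (`|chi (F p)| / 2)^-1; split.
  - by move=> _; exact: diffop_chart_op oU Ac schi cK Kc chi0.
  - by rewrite invr_ge0 ltW.
  move=> f x sf Sx; rewrite (big_pred1 tt) => [|[]//].
  rewrite ler_pdivlMl // /chart_op normrM -/(base w f x).
  by rewrite ler_wpM2r.
pose nS := dom c' `&` D.
have nbS : nbhs p nS.
  by apply: open_nbhs_nbhs; split=> //; apply: openI => //; exact: dom_open.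
apply: (dominated_near_eq nbS (Phi' := fun f x => \sum_(j < k.+1)
  \sum_(t : j.-tuple 'I_m) a t x * pderivs t ((f \o chart_inv c) \o phi) (c' x))).
  move=> f x sf [cx [Ux cFx]]; rewrite aE //; last exact: msmooth_pull.
  have fE : {in A, (f \o F) \o chart_inv c' =1 (f \o chart_inv c) \o phi}.
    by move=> y; rewrite inE => -[z [cz [_ cz']] <-]; rewrite /phi /= (chartK cz) chartK.
  apply: eq_bigr => j _; apply: eq_bigr => t _; congr (_ * _).
  by apply: (pderivs_eq t oA fE); rewrite inE; exists x.
apply: dominated_near_sum => j; apply: dominated_near_sum => t.
apply: dominated_near_mul.
  apply: (@msmooth_continuous R _ M' (dom c' `&` U')) => //.
  by apply: openI => //; exact: dom_open.
have [I [b [w [sb _ E]]]] := pderivs_comp t oA oB AB sphi.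
apply: (dominated_near_eq nbS (Phi' := fun f x => \sum_i b i (c' x) * base (w i) f x)).
  move=> f x sf [cx [Ux cFx]]; rewrite (E _ (sf c Ac)); last by exists x.
  by apply: eq_bigr => i _; rewrite /base /phi /= chartK.
apply: dominated_near_sum => i; apply: dominated_near_mul => //.
apply: (@continuous_comp _ _ _ c' (b i)); first exact: chart_continuous.
by apply: smooth_on_continuous (sb i) _; exists p.
Qed.

(** If [K] is not dominated, the sets outside of which [K] is dominated form a
    proper filter, because finite unions of dominated sets are dominated. It has
    a cluster point in [K], near which there is domination: a contradiction. *)
Lemma dominated_compact K P : diffop U' P -> compact K -> K `<=` U' ->
  dominated K (fun f => P (f \o F)).
Proof.
move=> dP cK KU; apply: contrapT => nD.
pose Fl : set_system M' := [set S | dominated (K `&` ~` S) (fun f => P (f \o F))].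
have FF : ProperFilter Fl.
  apply: Build_ProperFilter_ex => [S FS|].
    apply: contrapT => S0; apply: nD; apply: dominated_sub FS => x Kx; split=> //.
    by move=> Sx; apply: S0; exists x.
  split.
  - rewrite /Fl /= setCT setI0.
    have [I [Q [C [dQ C0 _]]]] := dominated0 set0.
    by exists I, Q, C.
  - move=> S1 S2 F1 F2; apply: dominated_sub (dominatedU F1 F2) => x [Kx nS].
    have [S1x|nS1] := pselect (S1 x); [right | by left].
    by split=> // S2x; apply: nS.
  - move=> S1 S2 S12 F1; apply: dominated_sub F1 => x [Kx nS].
    by split=> // /S12.
have FK : Fl K.
  have [I [Q [C [dQ C0 _]]]] := dominated0 set0.
  by exists I, Q, C; split=> // f x _ [].
have [p [Kp cl]] := cK Fl FF FK.
have [S nS DS] := dominated_near_diffop dP (KU p Kp).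
have FS : Fl (~` S) by apply: dominated_sub DS => x [_ /contrapT].
by have [x []] := cl _ _ FS nS.
Qed.

End Domination.

(** * Nets and composition *)

Section Nets.
Context {R : realType}.

(** These two lemmas trade the suprema in the definitions for pointwise bounds.
    The converse needs a continuous function on a compact set, as the supremum
    of an unbounded set is a default value. *)
Lemma sup_on_bigO n (M : manifold R n) (K : set M) (h : R -> M -> R) (g : R -> R) C :
  (\forall e \near 0^'+, forall x, K x -> `|h e x| <= C * `|g e|) ->
  (fun e => sup_on K (h e)) =O_ (0^'+) g.
Proof.
move=> H; apply/eqO_exP; exists (`|C| + 1); first by rewrite ltr_wpDl.
apply: filterS H => e H; rewrite /sup_on.
have [[x Kx]|K0] := pselect (K !=set0); last first.
  have -> : [set `|h e x| | x in K] = set0.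
    by apply/seteqP; split=> // y [x Kx _]; apply: K0; exists x.
  by rewrite sup0 normr0 mulr_ge0 // addr_ge0.
have ub : ubound [set `|h e x| | x in K] (C * `|g e|).
  by move=> _ [y Ky <-]; exact: H.
have s0 : 0 <= sup [set `|h e x| | x in K].
  apply: (@le_trans _ _ `|h e x|) => //.
  by apply: ub_le_sup; [exists (C * `|g e|) | exists x].
rewrite ger0_norm //; apply: (@le_trans _ _ (C * `|g e|)).
  by apply: ge_sup ub; exists `|h e x|; exists x.
by rewrite ler_wpM2r // (le_trans (ler_norm _)) // lerDl.
Qed.

Lemma bigO_sup_on n (M : manifold R n) (K : set M) (h : R -> M -> R) (g : R -> R) :
  compact K -> (forall e x, 0 < e <= 1 -> K x -> {for x, continuous (h e)}) ->
  (fun e => sup_on K (h e)) =O_ (0^'+) g ->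
  exists C, 0 <= C /\ \forall e \near 0^'+, forall x, K x -> `|h e x| <= C * `|g e|.
Proof.
move=> cK ch /eqO_exP [C C0 H]; exists C; split; first exact: ltW.
near=> e; have e01 : 0 < e <= 1.
  by apply/andP; split; near: e; [exact: nbhs_right_gt | exact: nbhs_right_le].
have He : `|sup_on K (h e)| <= C * `|g e| by near: e.
move=> x Kx; apply: le_trans He; apply: le_trans (ler_norm _).
rewrite /sup_on; apply: ub_le_sup; last by exists x.
have [||c _ Hc] := @compact_EVT_max M R (fun x => `|h e x|) K _ cK.
- by exists x.
- apply: continuous_in_subspaceT => y; rewrite inE => Ky.
  exact: continuous_comp (ch e y e01 Ky) (@norm_continuous _ _ _).
by exists `|h e c| => _ [y Ky <-]; apply: Hc; rewrite inE.
Unshelve. all: by end_near. Qed.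

Lemma near_unit_interval (P : R -> Prop) :
  (forall e, 0 < e <= 1 -> P e) -> \forall e \near 0^'+, P e.
Proof.
move=> H; near=> e; apply: H; apply/andP.
by split; near: e; [exact: nbhs_right_gt | exact: nbhs_right_le].
Unshelve. all: by end_near. Qed.

Section Pullback.
Context {m n : nat} {M' : manifold R m} {M : manifold R n}.
Context {U' : set M'} {U : set M} {F : M' -> M}.
Hypotheses (hM : hausdorff_space M) (oU' : open U') (oU : open U).
Hypotheses (F_U : forall x, U' x -> U (F x)) (sF : smooth_map U' F).

Lemma smooth_net_comp (r : net M) : smooth_net U r ->
  smooth_net U' (fun e => r e \o F).
Proof. by move=> sr e e01; apply: msmooth_comp (sr e e01). Qed.

Lemma compact_image_in (K : set M') : compact K -> K `<=` U' ->
  compact (F @` K) /\ F @` K `<=` U.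
Proof.
move=> cK KU; split; last by move=> _ [x /KU/F_U Ux <-].
apply: continuous_compact cK; apply: continuous_in_subspaceT => x.
by rewrite inE => /KU Ux; have [+ _] := sF; exact.
Qed.

(** The common part of the transfer of moderateness and of negligibility, for a
    bound [g] on the finitely many operators of a dominating family. *)
Lemma pull_bigO (r : net M) (K : set M') P (g : R -> R) :
  smooth_net U r -> compact K -> K `<=` U' ->
  (exists (I : finType) (Q : I -> (M -> R) -> M -> R) C,
    [/\ 0 <= C, forall i, exists C', \forall e \near 0^'+,
          forall y, (F @` K) y -> `|Q i (r e) y| <= C' * `|g e| &
        forall f x, msmooth U f -> K x ->
          `|P (f \o F) x| <= C * \sum_i `|Q i f (F x)|]) ->
  (fun e => sup_on K (P (r e \o F))) =O_ (0^'+) g.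
Proof.
move=> sr cK KU [I [Q [C [C0 HQ HP]]]]; have [C' HC'] := choice HQ.
apply: (@sup_on_bigO _ _ _ _ _ (C * \sum_i C' i)).
have H : \forall e \near 0^'+, forall i y, (F @` K) y ->
    `|Q i (r e) y| <= C' i * `|g e| by exact: filter_forall.
apply: filterS (filterI H (near_unit_interval sr)) => e [He se] x Kx.
apply: le_trans (HP _ _ se Kx) _.
rewrite -mulrA ler_wpM2l // mulr_suml ler_sum // => i _.
by apply: He; exists x.
Qed.

Lemma diffop_net_continuous (r : net M) P K e x : smooth_net U r ->
  diffop U P -> K `<=` U -> 0 < e <= 1 -> K x -> {for x, continuous (P (r e))}.
Proof.
move=> sr dP KU e01 Kx; apply: diffop_continuous dP _ _ => //; last exact: KU.
exact: sr.
Qed.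

Lemma moderate_comp (r : net M) : moderate U r -> moderate U' (fun e => r e \o F).
Proof.
move=> [sr mr]; split; first exact: smooth_net_comp.
move=> K P cK KU dP.
have [I [Q [C [dQ C0 HP]]]] := dominated_compact hM oU' oU F_U sF dP cK KU.
have [cFK FKU] := compact_image_in cK KU.
have [N HN] := choice (fun i => mr _ (Q i) cFK FKU (dQ i)).
(* One exponent for finitely many operators, as [e <= 1]. *)
pose NN := (\sum_i N i)%N; exists NN.
apply: pull_bigO => //; exists I, Q, C; split=> // i.
have [C' [C'0 HC']] := bigO_sup_on cFK
  (fun e x h => diffop_net_continuous sr (dQ i) FKU h) (HN i).
exists C'; apply: filterS (filterI HC' (near_unit_interval (fun e h => h))).
move=> e [He /andP[e0 e1]] y Fy; apply: le_trans (He y Fy) _.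
have p k : 0 <= e ^- k by rewrite invr_ge0 exprn_ge0 // ltW.
rewrite ler_wpM2l //= (ger0_norm (p (N i))) (ger0_norm (p NN)).
rewrite lef_pV2 ?posrE ?exprn_gt0 //; apply: ler_wiXn2l => //; first exact: ltW.
by rewrite /NN (bigD1 i) //= leq_addr.
Qed.

Lemma negligible_comp (r : net M) : negligible_net U r ->
  negligible_net U' (fun e => r e \o F).
Proof.
move=> [sr nr]; split; first exact: smooth_net_comp.
move=> K P cK KU dP k.
have [I [Q [C [dQ C0 HP]]]] := dominated_compact hM oU' oU F_U sF dP cK KU.
have [cFK FKU] := compact_image_in cK KU.
apply: pull_bigO => //; exists I, Q, C; split=> // i.
have [C' [_ HC']] := bigO_sup_on cFK
  (fun e x h => diffop_net_continuous sr (dQ i) FKU h) (nr _ _ cFK FKU (dQ i) k).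
by exists C'.
Qed.

End Pullback.

Section NegligibleAlgebra.
Context {n : nat} {M : manifold R n} {U : set M}.
Hypothesis oU : open U.

Lemma negligibleD (u v : net M) : negligible_net U u -> negligible_net U v ->
  negligible_net U (fun e x => u e x + v e x).
Proof.
move=> [su nu] [sv nv]; split=> [e e01|K P cK KU dP k].
  by apply: msmoothD => //; [exact: su | exact: sv].
have cu := fun e x h => diffop_net_continuous oU su dP KU h (x := x) (e := e).
have cv := fun e x h => diffop_net_continuous oU sv dP KU h (x := x) (e := e).
have [C1 [_ H1]] := bigO_sup_on cK cu (nu K P cK KU dP k).
have [C2 [_ H2]] := bigO_sup_on cK cv (nv K P cK KU dP k).
apply: (@sup_on_bigO _ _ _ _ _ (C1 + C2)).
apply: filterS (filterI H1 (filterI H2 (near_unit_interval (fun e h => h)))).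
move=> e [h1 [h2 e01]] x Kx.
rewrite (diffopD oU dP (su e e01) (sv e e01) (KU x Kx)).
by rewrite (le_trans (ler_normD _ _)) // mulrDl lerD //; [exact: h1 | exact: h2].
Qed.

(** Nets may be changed outside [U], and at indices outside the unit
    interval, where their values carry no meaning. *)
Lemma negligible_eq (u v : net M) :
  (forall e x, 0 < e <= 1 -> U x -> u e x = v e x) ->
  negligible_net U u -> negligible_net U v.
Proof.
move=> uv [su nu].
have uvU e : 0 < e <= 1 -> {in U, u e =1 v e}.
  by move=> e01 x; rewrite inE => Ux; exact: uv.
have sv : smooth_net U v.
  by move=> e e01; exact: msmooth_eq oU (uvU e e01) (su e e01).
split=> // K P cK KU dP k.
have cu := fun e x h => diffop_net_continuous oU su dP KU h (x := x) (e := e).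
have [C1 [_ H1]] := bigO_sup_on cK cu (nu K P cK KU dP k).
apply: (@sup_on_bigO _ _ _ _ _ C1).
apply: filterS (filterI H1 (near_unit_interval (fun e h => h))).
move=> e [h1 e01] x Kx.
by rewrite -(diffop_loc oU dP (su e e01) (sv e e01) (uvU e e01) (KU x Kx)) h1.
Qed.

Lemma diffop0 P x : diffop U P -> U x -> P (cst 0) x = 0.
Proof.
move=> dP Ux; have s0 := @msmooth_cst R n M U 0.
have := diffopD oU dP s0 s0 Ux.
rewrite (_ : (fun _ => _) = cst 0); last by apply/funext => y; rewrite /= addr0.
by move/esym/eqP; rewrite -subr_eq0 addrK => /eqP.
Qed.

Lemma negligible0 : negligible_net U (fun _ _ => 0 : R).
Proof.
split=> [e _|K P cK KU dP k]; first exact: msmooth_cst.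
apply: (@sup_on_bigO _ _ _ _ _ 0); apply: near_unit_interval => e _ x Kx.
by rewrite (diffop0 dP (KU x Kx)) normr0 mul0r.
Qed.

Lemma negligibleN (u : net M) : negligible_net U u ->
  negligible_net U (fun e x => - u e x).
Proof.
move=> [su nu].
have sN : smooth_net U (fun e x => - u e x).
  move=> e e01; have H := msmoothB oU (@msmooth_cst R n M U 0) (su e e01).
  by apply: msmooth_eq oU _ H => x _; rewrite /= sub0r.
split=> // K P cK KU dP k.
have cu := fun e x h => diffop_net_continuous oU su dP KU h (x := x) (e := e).
have [C1 [_ H1]] := bigO_sup_on cK cu (nu K P cK KU dP k).
apply: (@sup_on_bigO _ _ _ _ _ C1).
apply: filterS (filterI H1 (near_unit_interval (fun e h => h))).
move=> e [h1 e01] x Kx; have Ux := KU x Kx.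
have E0 : (fun y => u e y + - u e y) = cst 0 by apply/funext => y; rewrite subrr.
have := diffopD oU dP (su e e01) (sN e e01) Ux; rewrite E0.
rewrite (diffop0 dP Ux) => /eqP; rewrite eq_sym addrC addr_eq0 => /eqP ->.
by rewrite normrN h1.
Qed.

Lemma negligible_trans (u v w : net M) :
  negligible_net U (fun e x => u e x - v e x) ->
  negligible_net U (fun e x => v e x - w e x) ->
  negligible_net U (fun e x => u e x - w e x).
Proof.
move=> H1 H2; apply: negligible_eq (negligibleD H1 H2) => e x _ _.
by rewrite addrA subrK.
Qed.

Lemma negligible_sym (u v : net M) :
  negligible_net U (fun e x => u e x - v e x) ->
  negligible_net U (fun e x => v e x - u e x).
Proof.
by move=> H; apply: negligible_eq (negligibleN H) => e x _ _; rewrite opprB.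
Qed.

Lemma negligible_refl (u : net M) : negligible_net U (fun e x => u e x - u e x).
Proof. by apply: negligible_eq negligible0 => e x _ _; rewrite subrr. Qed.

End NegligibleAlgebra.

End Nets.

(** * Invariant generalized functions *)

Section GeneralizedFunctions.
Context {R : realType}.

Lemma hausdorff_pair (S T : topologicalType) :
  hausdorff_space S -> hausdorff_space T -> hausdorff_space (S * T)%type.
Proof.
move=> hS hT [x y] [x' y'] cl; congr (_, _).
  apply: hS => A B nA nB.
  have [||[a b] [/= Aa Ba]] := cl (A `*` setT) (B `*` setT).
  - by exists (A, setT) => //=; split=> //; exact: filterT.
  - by exists (B, setT) => //=; split=> //; exact: filterT.
  by exists a; case: Aa; case: Ba.
apply: hT => A B nA nB.
have [||[a b] [/= Aa Ba]] := cl (setT `*` A) (setT `*` B).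
- by exists (setT, A) => //=; split=> //; exact: filterT.
- by exists (setT, B) => //=; split=> //; exact: filterT.
by exists b; case: Aa; case: Ba.
Qed.

Lemma lie_hausdorff_prod d n (G : lie_group R d) (X : manifold R n) :
  hausdorff_space X -> hausdorff_space (mprod G X).
Proof. by move=> hX; apply: hausdorff_pair hX; exact: lie_hausdorff. Qed.

Lemma smooth_map_coord m n (M : manifold R m) (U : set M) (t : M -> euclid R n) j :
  open U -> smooth_map U t -> msmooth U (fun x => t x ord0 j).
Proof.
move=> oU st.
have sc : msmooth (setT : set (euclid R n)) (fun w : 'rV[R]_n => w ord0 j).
  by apply/(msmooth_euclid setT); exact: smooth_on_coord.
exact: (@msmooth_comp R _ _ M (euclid R n) U setT t _ oU openT
  (fun _ _ => Logic.I) st sc).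
Qed.

(** A function that vanishes on the image of an open set vanishes on an open
    set. *)
Lemma open_map_independent n k (M : manifold R n) (U : set M) (f : 'I_k -> M -> R) :
  (forall A, open A -> A `<=` U -> open (tuple_map f @` A)) ->
  functionally_independent U f.
Proof.
move=> fo A oA [x Ax] AU dep; have [W [F [[oW Wx WA] _ F0 FW]]] := dep x Ax.
have oI : open (tuple_map f @` W).
  by apply: fo => // y /WA/AU.
have [|_ [y Wy <-]] := F0 _ oI; first by exists (tuple_map f x); exists x.
by rewrite FW // eqxx.
Qed.

Lemma open_restr_dom d n (G : lie_group R d) (X : manifold R n)
    (V : set (mprod G X)) (Psi : mprod G X -> X) (U : set X) :
  local_action V Psi -> open U -> open (restr_dom V Psi U).
Proof.
move=> LA oU.
have -> : restr_dom V Psi U = (V `&` Psi @^-1` U) `&` (setT `&` snd @^-1` U).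
  by apply/seteqP; split=> z; [move=> [] | move=> [[? ?] [_ ?]]].
apply: openI; first exact: smooth_open_preimage (la_open LA) (la_smooth LA) oU.
exact: smooth_open_preimage openT (smooth_map_snd openT) oU.
Qed.

Lemma mem_net_class n (M : manifold R n) (U : set M) (r : net M) : open U ->
  moderate U r -> net_class U r r.
Proof. by move=> oU mr; split=> //; exact: negligible_refl. Qed.

Section Invariance.
Context {d n : nat} {G : lie_group R d} {X : manifold R n}.
Context {V : set (mprod G X)} {Psi : mprod G X -> X} {U : set X}.
Hypotheses (hX : hausdorff_space X) (LA : local_action V Psi) (oU : open U).

(** The composition of a class is the union of the compositions of all its
    representatives. Composition preserves negligible nets, so the equality of
    two such unions can be read on a single representative. *)
Lemma invariant_representative (r : net X) : moderate U r ->
  colombeau_invariant V Psi U (net_class U r) ->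
  negligible_net (restr_dom V Psi U) (fun e z => (r e \o Psi) z - (r e \o snd) z).
Proof.
move=> mr inv; set VU := restr_dom V Psi U.
have oV : open VU by exact: open_restr_dom.
have sP : smooth_map VU Psi.
  by apply: smooth_map_sub (la_smooth LA) => z [].
have s2 : smooth_map VU (snd : mprod G X -> X) by exact: smooth_map_snd.
have VP z : VU z -> U (Psi z) by case.
have V2 z : VU z -> U z.2 by case.
have : colombeau_comp VU (net_class U r) Psi (fun e => r e \o Psi).
  exists r; first exact: mem_net_class.
  by apply: mem_net_class => //; exact: moderate_comp mr.
rewrite inv => -[r' [mr' nr'] [_ nP]].
apply: (negligible_trans oV nP).
exact: (negligible_comp hX oV oU V2 s2 nr').
Qed.

End Invariance.

End GeneralizedFunctions.

Theorem theorem3p11 (R : realType) (n d s : nat)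
    (X : manifold R n) (G : lie_group R d)
    (V : set (mprod G X)) (Psi : mprod G X -> X) :
  hausdorff_space X -> paracompact X -> connected [set: X] ->
  local_action V Psi -> regular_action V Psi -> orbits_of_dim V Psi s ->
  forall x0 : X, exists (U : set X) (f : 'I_(n - s) -> X -> R),
    [/\ open U, U x0, complete_invariants V Psi U f
      & exists W : set (euclid R (n - s)),
          [/\ open W, tuple_map f @` U `<=` W
            & forall u : set (net X), colombeau U u ->
                colombeau_invariant V Psi U u ->
                exists2 v : set (net (euclid R (n - s))), colombeau W v &
                  u = colombeau_comp U v (tuple_map f)]].
Proof.
move=> hX _ _ LA reg dimO x0.
have [U [W [t [sigma [kappa [[[oU Ux0 oW] [st ss sk]] [tW sU tK] kP inv topen]]]]]]
  := adapted_box LA x0 reg dimO.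
pose f (i : 'I_(n - s)) (x : X) : R := t x ord0 i.
have fE : tuple_map f = t by apply/funext => x; apply/rowP => i; rewrite mxE.
have tU : tuple_map f @` U `<=` W by move=> _ [x Ux <-]; rewrite fE; exact: tW.
exists U, f; split=> //.
  split=> [i||g [sg ginv]].
  - split=> [|[g x] [Vg Ux Ug]]; first exact: smooth_map_coord.
    by rewrite /f (inv g x Vg Ux Ug).
  - by apply: open_map_independent => A oA AU; rewrite fE; exact: topen.
  (* [g] is constant on the slices, which the section [sigma] meets once *)
  - exists W, (g \o sigma); split=> //.
      apply/(msmooth_euclid W).
      exact: (@msmooth_comp R _ _ (euclid R (n - s)) X W U sigma g oW oU sU ss sg).
    move=> x Ux; rewrite fE /=; have [Vx <-] := kP x Ux.
    apply/esym; apply: (ginv (kappa x, x)); split=> //=.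
    by have [_ ->] := kP x Ux; apply: sU; exact: tW.
exists W; split=> // _ [r mr <-] cinv.
pose VU := restr_dom V Psi U; have oV : open VU by exact: open_restr_dom.
pose h (x : X) : mprod G X := (kappa x, x).
have sh : smooth_map U h by apply: smooth_map_pair => //; exact: smooth_map_id.
have hV x : U x -> VU (h x).
  move=> Ux; have [Vx E] := kP x Ux; split=> //=.
  by rewrite /h E; apply: sU; exact: tW.
have hW : hausdorff_space (euclid R (n - s)) by exact: norm_hausdorff.
pose v0 : net (euclid R (n - s)) := fun e => r e \o sigma.
have mv0 : moderate W v0 by exact: (moderate_comp hX oW oU sU ss mr).
(* Composed with [x |-> (kappa x, x)], invariance compares the values of [r]
     at [sigma (t x)] and at [x]. *)
have nrep : negligible_net U (fun e x => v0 e (t x) - r e x).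
  have N := negligible_comp (lie_hausdorff_prod (G := G) hX) oU oV hV sh
    (invariant_representative hX LA oU mr cinv).
  apply: negligible_eq N => // e x _ Ux /=.
  by have [_ ->] := kP x Ux.
exists (net_class W v0); first by exists v0.
rewrite fE; apply/seteqP; split=> [w [mw nw]|w [r' [mr' nr'] [mw nw]]].
  exists v0; first exact: mem_net_class.
  split=> //; apply: (negligible_trans oU nw).
  exact: (negligible_sym oU nrep).
split=> //; apply: (negligible_trans oU nw).
apply: (negligible_trans oU _ nrep).
exact: (negligible_comp hW oU oW tW st nr').
Qed.
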